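(* Let $X$ be a compact Riemann surface endowed with the twisting current $\theta=dd^cf$, where $f$ is a Hölder continuous function on $X$, and let $\omega_0$, $\omega$ be Kähler forms on $X$. For $\beta>0$ let $\varphi^{(\beta)}(t)$ be the solution of the corresponding non-normalized Kähler-Ricci flow $$\frac{\partial\varphi^{(\beta)}(t)}{\partial t}=\frac1\beta\log\frac{\omega_0+dd^c\varphi^{(\beta)}(t)}{\omega}+f,\qquad\varphi^{(\beta)}(0)=0.$$ Then $\omega_\beta(t):=\omega_0+dd^c\varphi^{(\beta)}(t)$ defines a family of Hölder continuous Kähler metrics such that, for every $t\ge0$, $$\lim_{\beta\to\infty}\omega_\beta(t)=P(\omega_0+t\theta):=\omega_0+dd^cP_{\omega_0}(tf)$$ in the weak topology of currents. More precisely, the convergence holds in $C^0(X)$ on the level of Kähler potentials: $\varphi^{(\beta)}(t)\to P_{\omega_0}(tf)$ in $C^0(X)$.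
   Context: $dd^c:=\frac{i}{2\pi}\partial\bar\partial$. The flow is the potential form of $\partial_t\omega(t)=-\frac1\beta\mathrm{Ric}\,\omega(t)+\theta_\beta$, $\omega(0)=\omega_0$, with $\theta_\beta=dd^cf+\frac1\beta\mathrm{Ric}\,\omega$, where $\mathrm{Ric}\,\omega=-dd^c\log\frac{\omega}{dV(z)}$ locally (so $\frac1\beta c_1(K_X)+[\theta_\beta]$ is trivial); its solution is of class $C^{2,\alpha}(X)$ in space for some $\alpha>0$. $PSH(X,\omega_0)$ is the set of usc $u\in L^1(X)$ with $\omega_0+dd^cu\ge0$, and $P_{\omega_0}(h)(x):=\sup\{u(x):u\in PSH(X,\omega_0),\ u\le h\}$. *)

(* Defs.v *)
From HB Require Import structures.
From mathcomp Require Import all_boot all_order all_algebra.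
From mathcomp Require Import all_classical all_reals all_analysis.
Set Implicit Arguments.
Unset Strict Implicit.
Unset Printing Implicit Defensive.
Import Order.TTheory GRing.Theory Num.Theory.
Import numFieldNormedType.Exports.
Local Open Scope classical_set_scope.
Local Open Scope ring_scope.

(* The complex plane, (x, y) standing for x + i y. *)
Notation plane R := (R * R)%type.

Definition Dx (R : realType) (h : plane R -> R) : plane R -> R :=
  fun z => 'D_((1, 0) : plane R) h z.
Definition Dy (R : realType) (h : plane R -> R) : plane R -> R :=
  fun z => 'D_((0, 1) : plane R) h z.

Fixpoint Ck (R : realType) (k : nat) (U : set (plane R)) (h : plane R -> R) :
    Prop :=
  (forall z, U z -> {for z, continuous h}) /\
  if k is k'.+1 then
    [/\ forall z, U z -> derivable h z ((1, 0) : plane R)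
                      /\ derivable h z ((0, 1) : plane R),
        Ck k' U (Dx h) & Ck k' U (Dy h)]
  else True.

Definition smooth_on (R : realType) (U : set (plane R)) (h : plane R -> R) :=
  forall k, Ck k U h.

(* Locally a-Hoelder; on a compact surface, imposing this in every chart is the
   same as global a-Hoelder continuity for any Riemannian distance. *)
Definition hoelder_on (R : realType) (a : R) (U : set (plane R))
    (h : plane R -> R) :=
  forall z, U z -> exists C : R, exists2 V : set (plane R), nbhs z V &
    forall p q, V p -> V q -> `|h p - h q| <= C * `|p - q| `^ a.

Definition laplacian (R : realType) (h : plane R -> R) : plane R -> R :=
  fun z => Dx (Dx h) z + Dy (Dy h) z.

(* Smooth solutions of the Cauchy-Riemann equations. *)
Definition holomorphic_on (R : realType) (U : set (plane R))
    (tau : plane R -> plane R) :=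
  let a := fun z => (tau z).1 in
  let b := fun z => (tau z).2 in
  [/\ smooth_on U a, smooth_on U b &
      forall z, U z -> Dx a z = Dy b z /\ Dy a z = - Dx b z].

Definition jacobian (R : realType) (tau : plane R -> plane R) (z : plane R) :
    R :=
  let a := fun z => (tau z).1 in
  let b := fun z => (tau z).2 in
  Dx a z * Dy b z - Dy a z * Dx b z.

Definition area (R : realType) :=
  ((@lebesgue_measure R) \x (@lebesgue_measure R))%E.
Arguments area : clear implicits.

Definition usc_at (R : realType) (T : topologicalType) (u : T -> \bar R)
    (x : T) :=
  forall a : R, (u x < a%:E)%E -> \forall y \near x, (u y < a%:E)%E.

Definition closed_disc (R : realType) (c : plane R) (r : R) : set (plane R) :=
  [set z | (z.1 - c.1) ^+ 2 + (z.2 - c.2) ^+ 2 <= r ^+ 2].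

(* In one variable plurisubharmonic means subharmonic.  The constant -oo is not
   excluded here; it is excluded by integrability in [PSH] below. *)
Definition psh_on (R : realType) (V : set (plane R)) (v : plane R -> \bar R) :=
  (forall z, V z -> (v z < +oo)%E /\ usc_at v z) /\
  forall (c : plane R) (r : R), 0 < r -> closed_disc c r `<=` V ->
    (v c <= ((2 * pi)^-1)%:E *
      \int[@lebesgue_measure R]_(s in `[0%R, (2 * pi)%R])
         v (c.1 + r * cos s, c.2 + r * sin s)%R)%E.

(* A finite atlas is no restriction, by compactness.  [param i] is the inverse
   of the chart [coord i] : [dom i] -> [img i]; the values of [coord i] and
   [param i] outside [dom i] and [img i] are irrelevant. *)
Record compactRiemannSurface (R : realType) := CompactRiemannSurface {
  rs_space :> topologicalType;
  chart : finType;
  dom : chart -> set rs_space;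
  img : chart -> set (plane R);
  coord : chart -> rs_space -> plane R;
  param : chart -> plane R -> rs_space;
  dom_open : forall i, open (dom i);
  img_open : forall i, open (img i);
  coord_img : forall i x, dom i x -> img i (coord i x);
  param_dom : forall i z, img i z -> dom i (param i z);
  coordK : forall i x, dom i x -> param i (coord i x) = x;
  paramK : forall i z, img i z -> coord i (param i z) = z;
  coord_continuous : forall i x, dom i x -> {for x, continuous (coord i)};
  param_continuous : forall i z, img i z -> {for z, continuous (param i)};
  dom_cover : forall x, exists i, dom i x;
  transition_holomorphic : forall i j,
    holomorphic_on (img i `&` param i @^-1` dom j) (coord j \o param i);
  rs_hausdorff : hausdorff_space rs_space;
  rs_connected : connected [set: rs_space];
  rs_compact : compact [set: rs_space]
}.

Section Surface.
Variables (R : realType) (X : compactRiemannSurface R).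

Definition smooth_fun (h : X -> R) :=
  forall i, smooth_on (img i) (h \o @param R X i).

Definition hoelder_fun (a : R) (h : X -> R) :=
  forall i, hoelder_on a (img i) (h \o @param R X i).

Definition C2_hoelder_fun (a : R) (h : X -> R) :=
  forall i, let hi := h \o @param R X i in
    Ck 2 (img i) hi /\
    [/\ hoelder_on a (img i) (Dx (Dx hi)), hoelder_on a (img i) (Dx (Dy hi)),
        hoelder_on a (img i) (Dy (Dx hi)) & hoelder_on a (img i) (Dy (Dy hi))].

(* [g i] is the coefficient of the form: it is  g i dx /\ dy  in the chart i. *)
Definition coefs := chart X -> plane R -> R.

Definition is_form (g : coefs) :=
  forall i j z, img i z -> dom j (param i z) ->
    g i z = g j (coord j (param i z)) * jacobian (coord j \o param i) z.

Definition positive_form (g : coefs) := forall i z, img i z -> 0 < g i z.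

(* Closedness is automatic in complex dimension one. *)
Definition kahler_form (g : coefs) :=
  [/\ is_form g, positive_form g & forall i, smooth_on (img i) (g i)].

Definition hoelder_kahler_metric (a : R) (g : coefs) :=
  [/\ is_form g, positive_form g & forall i, hoelder_on a (img i) (g i)].

(* (i / 2 pi) d dbar h = (1 / 4 pi) (laplacian h) dx /\ dy, because
   d dbar h = (1/4) (laplacian h) dz /\ dzbar  and  i dz /\ dzbar = 2 dx /\ dy *)
Definition ddc (h : X -> R) : coefs :=
  fun i z => (4 * pi)^-1 * laplacian (h \o param i) z.

Definition add_ddc (g : coefs) (h : X -> R) : coefs :=
  fun i z => g i z + ddc h i z.

Definition mult (x : X) : R := \sum_(i : chart X) \1_(dom i) x.

(* Integral over X of a 2-form with extended real coefficients; the functions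
   \1_(dom i) / mult form a Borel partition of unity. *)
Definition form_int (a : chart X -> plane R -> \bar R) : \bar R :=
  (\sum_(i : chart X)
     \int[area R]_(z in img i) (a i z * ((mult (param i z))^-1)%:E))%E.

Definition form_L1 (g : coefs) (u : X -> \bar R) :=
  forall i, (area R).-integrable (img i)
    (fun z => (u (param i z) * (g i z)%:E)%E).

(* Currents of bidegree (1,1) are represented as functionals on the smooth
   functions on X. *)

Definition form_current (g : coefs) (chi : X -> R) : \bar R :=
  form_int (fun i z => (chi (param i z) * g i z)%:E).

(* The current dd^c u, for u integrable. *)
Definition ddc_current (u : X -> \bar R) (chi : X -> R) : \bar R :=
  form_int (fun i z => (u (param i z) * (ddc chi i z)%:E)%E).

Definition add_ddc_current (g : coefs) (u : X -> \bar R) (chi : X -> R) :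
    \bar R :=
  (form_current g chi + ddc_current u chi)%E.

Definition positive_current (T : (X -> R) -> \bar R) :=
  forall chi, smooth_fun chi -> (forall x, 0 <= chi x) -> (0 <= T chi)%E.

Definition cvg_current (S : R -> (X -> R) -> \bar R)
    (T : (X -> R) -> \bar R) :=
  forall chi, smooth_fun chi -> S b chi @[b --> +oo] --> T chi.

Definition quasi_psh (u : X -> \bar R) :=
  forall i z, img i z -> exists V : set (plane R),
    [/\ open V, V z, V `<=` img i &
      exists v : plane R -> \bar R, exists s : plane R -> R,
        [/\ psh_on V v, smooth_on V s &
            forall w, V w -> u (param i w) = (v w + (s w)%:E)%E]].

(* Without [quasi_psh], which is implicit in the usual reading of
   omega_0 + dd^c u >= 0, the definition would also admit upper semicontinuous
   functions that only agree almost everywhere with a psh one (for instance the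
   indicator function of a point), and the envelope would be trivial. *)
Definition PSH (g : coefs) (u : X -> \bar R) :=
  [/\ forall x, (u x < +oo)%E /\ usc_at u x,
      form_L1 g u, quasi_psh u & positive_current (add_ddc_current g u)].

Definition envelope (g : coefs) (h : X -> R) (x : X) : \bar R :=
  ereal_sup [set u x | u in [set u : X -> \bar R |
    PSH g u /\ forall y, (u y <= (h y)%:E)%E]].

(* The equation is imposed for t > 0; the initial condition is attained through
   the continuity of phi up to t = 0. *)
Definition kahler_ricci_flow (omega0 omega : coefs) (f : X -> R) (beta : R)
    (phi : R -> X -> R) :=
  [/\ {within [set p : R * X | 0 <= p.1],
        continuous (fun p : R * X => phi p.1 p.2)},
      forall x, phi 0 x = 0,
      forall t, 0 <= t -> positive_form (add_ddc omega0 (phi t)),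
      (exists2 a : R, 0 < a <= 1 &
        forall t, 0 <= t -> C2_hoelder_fun a (phi t)) &
      forall (t : R) (x : X) (i : chart X), 0 < t -> dom i x ->
        is_derive t 1 (fun s => phi s x)
          (beta^-1 * ln (add_ddc omega0 (phi t) i (coord i x)
                         / omega i (coord i x)) + f x)].

End Surface.

(* Main.v *)
(* Maximum principles on both sides.

   Upper bound: if f <= f_1 with f_1 smooth and omega_0 + s dd^c f_1 <= C omega for s in
   [0, t], then at a positive maximum of phi(s) - s f_1 - K s the flow equation gives K <= (log C) / beta;
   hence phi(t) <= t f_1 + t (log C) / beta.  Choosing f_1 close to f at a given point and
   using compactness, phi(t) <= t f + o(1) uniformly, so that phi(t) - o(1) is a competitor
   for the envelope.

   Lower bound: for a competitor u and 0 < d < 1 consider a positive maximum (s, x) of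
   (1 - d) (s / t) u - phi(s) - K s.  There a multiple of phi(s) touches u from above, and u
   is omega_0-psh in the viscosity sense, so omega_0 + dd^c phi(s) >= d omega_0 at x; the
   flow equation then bounds K by (log (C / d)) / beta + d sup |f|.  Hence
   u <= phi(t) + o(1), uniformly in u.

   The viscosity property of u is obtained by testing the positive current
   omega_0 + dd^c u on Green kernels with a smoothed pole at x: the smoothed Dirac mass is
   radial, so the sub-mean value property on circles controls its pairing with u.  This
   needs the change of variables formula for holomorphic transition maps, and Green's
   formula on the surface, which follows from the planar one by a partition of unity. *)

Require Import Defs.
From HB Require Import structures.
From mathcomp Require Import all_boot all_order all_algebra.
From mathcomp Require Import all_classical all_reals all_analysis.
From mathcomp Require Import measurable_realfun ring lra.
Set Implicit Arguments.
Unset Strict Implicit.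
Unset Printing Implicit Defensive.
Import Order.TTheory GRing.Theory Num.Theory.
Import numFieldNormedType.Exports.
Local Open Scope classical_set_scope.
Local Open Scope ring_scope.

(** * Calculus in the plane *)

(** [PSH] gives a competitor u two separate pieces of information: positivity of a current, which is
    global and integrated, and local splittings u = v + s into a psh and a smooth part, with nothing
    said about dd^c s. The maximum principle needs an inequality at one point, where u, possibly
    discontinuous and -oo elsewhere, is touched from above by a C^2 function. The kernel is built so
    that the two pieces meet there: its Laplacian is a nonnegative part [kernel_out] minus a
    concentrated radial part [kernel_in]. Replacing u by its majorant is free against [kernel_out];
    against [kernel_in] it costs the integral of majorant minus u, which the circle means of v make
    small. The mass of the kernel stays bounded below as the pole sharpens, so a strictly negative
    form cannot survive the test. The factor s / t makes the lower comparison function vanish at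
    time 0 and turns u <= t f into a bound on its time derivative. The factor 1 - d keeps a share d
    of omega_0, which bounds the logarithm in the flow equation from below. *)

Section DerivePlane.
Context {R : realType}.

(** Multiplying out the difference quotient gives an estimate on a full neighbourhood of 0, trivial
    at t = 0, that composes and transfers between functions without any division. *)
Lemma is_derive_epsP (V : normedModType R) (f : V -> R) (z v : V) (d : R) :
  is_derive z v f d <-> forall e, 0 < e ->
    \forall t \near (0 : R), `|f (t *: v + z) - f z - t * d| <= e * `|t|.
Proof.
split.
  move=> [df dE] e e0.
  have : (fun h => h^-1 *: (f (h *: v + z) - f z)) @ 0^' --> d.
    by rewrite -dE; exact: df.
  move=> /cvgrPdist_le/(_ e e0).
  rewrite near_withinE; apply: filterS => t.
  have [->|t0] := eqVneq t 0.
    by move=> _; rewrite scale0r add0r subrr mul0r subrr normr0 mulr0.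
  move=> /(_ isT) H.
  have -> : f (t *: v + z) - f z - t * d
      = - (t * (d - t^-1 * (f (t *: v + z) - f z))) by field.
  by rewrite normrN normrM mulrC ler_wpM2r.
move=> H.
have cv : (fun h => h^-1 *: (f (h *: v + z) - f z)) @ 0^' --> d.
  apply/cvgrPdist_le => e e0; rewrite near_withinE.
  apply: filterS (H e e0) => t Ht t0.
  have -> : d - t^-1 *: (f (t *: v + z) - f z)
      = - (t^-1 * (f (t *: v + z) - f z - t * d)).
    by rewrite /GRing.scale /=; field.
  rewrite normrN normrM normfV mulrC ler_pdivrMr ?normr_gt0//.
split; last exact/cvg_lim.
by apply/cvg_ex; exists d.
Qed.

Lemma is_derive_Dx (h : plane R -> R) x y :
  derivable h (x, y) (1, 0) -> is_derive x 1 (fun s => h (s, y)) (Dx h (x, y)).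
Proof.
move=> dh; have /is_derive_epsP H : is_derive (x, y) (1, 0) h (Dx h (x, y)).
  exact/derivableP.
apply/is_derive_epsP => e e0; apply: filterS (H e e0) => t.
rewrite [X in h X - _](_ : _ = (t *: 1 + x, y)) //.
by congr pair; rewrite /= scaler0 add0r.
Qed.

Lemma is_derive_Dy (h : plane R -> R) x y :
  derivable h (x, y) (0, 1) -> is_derive y 1 (fun s => h (x, s)) (Dy h (x, y)).
Proof.
move=> dh; have /is_derive_epsP H : is_derive (x, y) (0, 1) h (Dy h (x, y)).
  exact/derivableP.
apply/is_derive_epsP => e e0; apply: filterS (H e e0) => t.
rewrite [X in h X - _](_ : _ = (x, t *: 1 + y)) //.
by congr pair; rewrite /= scaler0 add0r.
Qed.

(** The mean value theorem gives F b - F a = F' c (b - a) for some c in between. The end points are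
    unordered because the estimate is used along segments joining two arbitrary points of a ball. *)
Lemma mvt_bound (F F' : R -> R) (a b L e : R) :
  (forall s, Num.min a b <= s <= Num.max a b -> is_derive s 1 F (F' s)) ->
  (forall s, Num.min a b <= s <= Num.max a b -> `|F' s - L| <= e) ->
  `|F b - F a - L * (b - a)| <= e * `|b - a|.
Proof.
wlog ab : a b / a <= b.
  move=> W H1 H2; have [ab|/ltW ba] := leP a b; first exact: W.
  rewrite -normrN opprD opprB [in X in _ <= X]distrC.
  rewrite -mulrN opprB; apply: W => //; rewrite minC maxC//.
rewrite (min_idPl ab) (max_idPr ab) => H1 H2.
have [c] : exists2 c, c \in `[a, b]%R & F b - F a = F' c * (b - a).
  apply: MVT_segment => //.
    by move=> x; rewrite in_itv/= => /andP[/ltW ? /ltW ?]; apply: H1; apply/andP.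
  apply: derivable_within_continuous => x; rewrite in_itv/= => /H1 [].
  by [].
rewrite in_itv/= => /H2 cE ->.
by rewrite -mulrBl normrM ler_wpM2r.
Qed.

Lemma Ck_mono k (U V : set (plane R)) h : V `<=` U -> Ck k U h -> Ck k V h.
Proof.
elim: k h => [|k IH] h VU /= [c H]; split; try by move=> z /VU; exact: c.
  by [].
by case: H => d hx hy; split; [move=> z /VU; exact: d|exact: IH|exact: IH].
Qed.

(** Every clause of [Ck] is quantified over the points of the set, so the set can be cut down to
    singletons. Gluing, and replacing a function by one equal to it near a point, become statements
    about one point. *)
Lemma Ck_pt k (U : set (plane R)) h :
  Ck k U h <-> forall z, U z -> Ck k [set z] h.
Proof.
split; first by move=> H z Uz; apply: Ck_mono H => _ ->.
elim: k h => [|k IH] h H /=.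
  by split=> // z Uz; have [/(_ z erefl)] := H z Uz.
split; first by move=> z Uz; have [/(_ z erefl)] := H z Uz.
split.
- by move=> z Uz; have [_ [/(_ z erefl)]] := H z Uz.
- by apply: IH => z Uz; have [_ []] := H z Uz.
- by apply: IH => z Uz; have [_ []] := H z Uz.
Qed.

Lemma Ck_S k (U : set (plane R)) h : Ck k.+1 U h -> Ck k U h.
Proof.
elim: k h => [|k IH] h [c [d hx hy]]; first by split; [exact: c|].
split; first exact: c.
split; [exact: d|exact (IH _ hx)|exact (IH _ hy)].
Qed.

Lemma Ck_le k l (U : set (plane R)) h : (k <= l)%N -> Ck l U h -> Ck k U h.
Proof.
elim: l => [|l IH]; first by rewrite leqn0 => /eqP ->.
by rewrite leq_eqVlt => /predU1P[->//|/IH H /Ck_S /H].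
Qed.

Lemma near_Dx (f g : plane R -> R) (z : plane R) : (\forall w \near z, f w = g w) ->
  \forall w \near z, Dx f w = Dx g w.
Proof.
by move=> /nbhs_interior; apply: filterS => w fg; exact: near_eq_derive.
Qed.

Lemma near_Dy (f g : plane R -> R) (z : plane R) : (\forall w \near z, f w = g w) ->
  \forall w \near z, Dy f w = Dy g w.
Proof.
by move=> /nbhs_interior; apply: filterS => w fg; exact: near_eq_derive.
Qed.

Lemma near_continuous (T : topologicalType) (f g : T -> R) (z : T) :
  (\forall w \near z, f w = g w) ->
  {for z, continuous f} -> {for z, continuous g}.
Proof.
move=> fg cf; rewrite /prop_for /continuous_at -(nbhs_singleton fg).
by apply: cvg_trans cf; apply: near_eq_cvg; apply: filterS fg => w ->.
Qed.

Lemma Ck_near k (f g : plane R -> R) (z : plane R) : (\forall w \near z, f w = g w) ->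
  Ck k [set z] f -> Ck k [set z] g.
Proof.
elim: k f g => [|k IH] f g fg /= [c H].
  split=> // w /= ->; exact: near_continuous fg (c z erefl).
split.
  by move=> w /= ->; exact: near_continuous fg (c z erefl).
case: H => d hx hy; split.
- move=> w /= ->; have [d1 d2] := d z erefl.
  by split; [exact: near_eq_derivable d1|exact: near_eq_derivable d2].
- apply: IH hx; exact: near_Dx.
- apply: IH hy; exact: near_Dy.
Qed.

Lemma near_open (U : set (plane R)) (P : set (plane R)) (z : plane R) :
  open U -> U z -> (forall w, U w -> P w) -> \forall w \near z, P w.
Proof. by move=> oU Uz H; apply: filterS (open_nbhs_nbhs (conj oU Uz)). Qed.

Lemma Ck_congr k (U : set (plane R)) f g : open U ->
  (forall z, U z -> f z = g z) -> Ck k U f -> Ck k U g.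
Proof.
move=> oU fg /Ck_pt H; apply/Ck_pt => z Uz; apply: (Ck_near (f := f)) (H z Uz).
exact: near_open fg.
Qed.

End DerivePlane.

Opaque Dx Dy.

(** * Strict differentiability and the chain rule *)

Section Differentiable.
Context {R : realType}.

Lemma between_ball (a b c d s : R) : `|c - a| < d -> `|c - b| < d ->
  Num.min a b <= s <= Num.max a b -> `|c - s| < d.
Proof.
rewrite !ltr_norml => /andP[? ?] /andP[? ?].
by case: (leP a b) => ? /andP[? ?]; apply/andP; split; lra.
Qed.

Lemma prod_norm_le (p : plane R) e : (`|p| <= e) = (`|p.1| <= e) && (`|p.2| <= e).
Proof. by rewrite prod_normE ge_max. Qed.

Lemma norm_fst (p : plane R) : `|p.1| <= `|p|.
Proof. by rewrite [leRHS]prod_normE le_max lexx. Qed.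

Lemma norm_snd (p : plane R) : `|p.2| <= `|p|.
Proof. by rewrite [leRHS]prod_normE le_max lexx orbT. Qed.

Lemma ball_planeE (z p : plane R) d :
  ball z d p <-> `|z.1 - p.1| < d /\ `|z.2 - p.2| < d.
Proof. by []. Qed.

(** Going from q to p by a horizontal and a vertical segment, both inside the sup-norm ball, leaves
    two one-variable mean value estimates. Both points are free: this two-point form is what the
    symmetry of second derivatives, the Lipschitz bound and the change of variables rely on. *)
Lemma Ck1_strict (U : set (plane R)) h (z : plane R) :
  open U -> U z -> Ck 1 U h ->
  forall e, 0 < e -> exists2 d, 0 < d & forall p q, ball z d p -> ball z d q ->
    `|h p - h q - (Dx h z * (p.1 - q.1) + Dy h z * (p.2 - q.2))| <= e * `|p - q|.
Proof.
move=> oU Uz [c [dh [hx _] [hy _]]] e e0.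
have e20 : 0 < e / 2 by rewrite divr_gt0.
have /cvgrPdist_le/(_ _ e20) cx := hx z Uz.
have /cvgrPdist_le/(_ _ e20) cy := hy z Uz.
have nU : \forall w \near z, U w by apply: (near_open oU Uz).
have /nbhs_ballP[d /= d0 H] : nbhs z [set w | [/\ U w,
    `|Dx h z - Dx h w| <= e / 2 & `|Dy h z - Dy h w| <= e / 2]].
  by apply: filterS3 nU cx cy => w u v t; exact (And3 u v t).
exists d => // -[p1 p2] -[q1 q2] [/= P1 P2] [/= Q1 Q2].
have hor s : Num.min q1 p1 <= s <= Num.max q1 p1 -> ball z d (s, p2).
  by move=> /(between_ball Q1 P1).
have ver s : Num.min q2 p2 <= s <= Num.max q2 p2 -> ball z d (q1, s).
  by move=> /(between_ball Q2 P2).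
have m1 : `|h (p1, p2) - h (q1, p2) - Dx h z * (p1 - q1)| <= e / 2 * `|p1 - q1|.
  apply: (@mvt_bound R (fun s => h (s, p2)) (fun s => Dx h (s, p2))).
    by move=> s /hor/H[Us _ _]; apply: is_derive_Dx (dh _ Us).1.
  by move=> s /hor/H[_ ? _]; rewrite distrC.
have m2 : `|h (q1, p2) - h (q1, q2) - Dy h z * (p2 - q2)| <= e / 2 * `|p2 - q2|.
  apply: (@mvt_bound R (fun s => h (q1, s)) (fun s => Dy h (q1, s))).
    by move=> s /ver/H[Us _ _]; apply: is_derive_Dy (dh _ Us).2.
  by move=> s /ver/H[_ _ ?]; rewrite distrC.
rewrite /=.
have -> : h (p1, p2) - h (q1, q2) - (Dx h z * (p1 - q1) + Dy h z * (p2 - q2)) =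
  (h (p1, p2) - h (q1, p2) - Dx h z * (p1 - q1)) +
  (h (q1, p2) - h (q1, q2) - Dy h z * (p2 - q2)) by ring.
apply: le_trans (ler_normD _ _) _.
have n1 : `|p1 - q1| <= `|(p1, p2) - (q1, q2)| := norm_fst ((p1, p2) - (q1, q2)).
have n2 : `|p2 - q2| <= `|(p1, p2) - (q1, q2)| := norm_snd ((p1, p2) - (q1, q2)).
rewrite [in leRHS](splitr e) mulrDl; apply: lerD.
  by apply: le_trans m1 _; rewrite ler_pM2l.
by apply: le_trans m2 _; rewrite ler_pM2l.
Qed.

Lemma is_derive_chain (V : normedModType R) (h : plane R -> R) (a b : V -> R)
    (A B : R) (z v : V) (da db : R) :
  (forall e, 0 < e -> \forall w \near ((a z, b z) : plane R),
     `|h w - h (a z, b z) - (A * (w.1 - a z) + B * (w.2 - b z))|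
       <= e * `|w - (a z, b z)|) ->
  is_derive z v a da -> is_derive z v b db ->
  is_derive z v (fun w => h (a w, b w)) (A * da + B * db).
Proof.
move=> dh /is_derive_epsP Ha /is_derive_epsP Hb; apply/is_derive_epsP => e e0.
(* Once [e2 <= 1], [M] is a Lipschitz constant at z for the inner pair. [e1] spends half of e on the
   remainder of h, [e2] the other half on the remainders of a and b, weighted by [N]. *)
pose M := `|da| + `|db| + 1.
have M0 : 0 < M by rewrite /M ltr_wpDl// addr_ge0.
pose e1 := e / (2 * M).
have e10 : 0 < e1 by rewrite divr_gt0// mulr_gt0.
pose N := `|A| + `|B| + 1.
have N0 : 0 < N by rewrite /N ltr_wpDl// addr_ge0.
pose e2 := Num.min 1 (e / (2 * N)).
have e20 : 0 < e2 by rewrite lt_min ltr01 divr_gt0// mulr_gt0.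
have /nbhs_ballP[d /= d0 D] := dh _ e10.
have nt : \forall t \near (0 : R), `|t| < d / M.
  have dM : 0 < d / M by rewrite divr_gt0.
  apply/nbhs_ballP; exists (d / M) => //= t.
  by rewrite /ball/= sub0r normrN.
apply: filterS3 (Ha _ e20) (Hb _ e20) nt => t {}Ha {}Hb {}nt.
have tM : M * `|t| < d by rewrite mulrC -ltr_pdivlMr.
have e21 : e2 <= 1 by rewrite ge_min lexx.
have e2N : e2 <= e / (2 * N) by rewrite ge_min lexx orbT.
have aM : `|a (t *: v + z) - a z| <= M * `|t|.
  rewrite -[X in `|X|](subrK (t * da)) (le_trans (ler_normD _ _))// normrM.
  rewrite (le_trans (lerD Ha (lexx _)))// (mulrC `|t|) -mulrDl ler_wpM2r//.
  by rewrite /M; have := normr_ge0 db; lra.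
have bM : `|b (t *: v + z) - b z| <= M * `|t|.
  rewrite -[X in `|X|](subrK (t * db)) (le_trans (ler_normD _ _))// normrM.
  rewrite (le_trans (lerD Hb (lexx _)))// (mulrC `|t|) -mulrDl ler_wpM2r//.
  by rewrite /M; have := normr_ge0 da; lra.
set w : plane R := (a (t *: v + z), b (t *: v + z)).
have wM : `|w - (a z, b z)| <= M * `|t| by rewrite prod_norm_le aM bM.
have /D /= Hw : ball ((a z, b z) : plane R) d w.
  apply/ball_planeE; rewrite /= ![`|_ z - _|]distrC.
  by split; apply: le_lt_trans tM.
have -> : h w - h (a z, b z) - t * (A * da + B * db) =
  (h w - h (a z, b z) - (A * (w.1 - a z) + B * (w.2 - b z)))
  + (A * (w.1 - a z - t * da) + B * (w.2 - b z - t * db)) by ring.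
apply: le_trans (ler_normD _ _) _.
rewrite (splitr e) mulrDl; apply: lerD.
  apply: le_trans Hw _; rewrite (le_trans (ler_wpM2l (ltW e10) wM))//.
  by rewrite mulrA ler_wpM2r// /e1 le_eqVlt; apply/orP; left; apply/eqP; field; rewrite gt_eqF.
apply: le_trans (ler_normD _ _) _; rewrite !normrM.
apply: (@le_trans _ _ (N * (e / (2 * N) * `|t|))); last first.
  by rewrite mulrA ler_wpM2r// le_eqVlt; apply/orP; left; apply/eqP; field; rewrite gt_eqF.
have tt : e2 * `|t| <= e / (2 * N) * `|t| by rewrite ler_wpM2r.
have -> : N * (e / (2 * N) * `|t|) = `|A| * (e / (2 * N) * `|t|) +
   `|B| * (e / (2 * N) * `|t|) + (e / (2 * N) * `|t|) by rewrite /N; ring.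
rewrite -[leLHS]addr0; apply: lerD; last by rewrite mulr_ge0// divr_ge0// ?ltW// mulr_gt0.
by apply: lerD; apply: ler_wpM2l => //; [apply: le_trans Ha _|apply: le_trans Hb _].
Qed.

Lemma Ck1_chain (U : set (plane R)) h (V : normedModType R) (a b : V -> R)
    (z v : V) (da db : R) : open U -> U (a z, b z) -> Ck 1 U h ->
  is_derive z v a da -> is_derive z v b db ->
  is_derive z v (fun w => h (a w, b w))
    (Dx h (a z, b z) * da + Dy h (a z, b z) * db).
Proof.
move=> oU Uz hC; apply: is_derive_chain => e e0.
have [d d0 H] := Ck1_strict oU Uz hC e0.
apply/nbhs_ballP; exists d => //= w bw; apply: (H w) => //; exact: ballxx.
Qed.

End Differentiable.

(** * Stability of [Ck] under algebra and composition *)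

Section CkClosure.
Context {R : realType}.
Implicit Types (U V : set (plane R)) (f g h a b : plane R -> R) (z : plane R) (c d : R).

Lemma is_derive_DxP h z d : is_derive z (1, 0) h d ->
  derivable h z (1, 0) /\ Dx h z = d.
Proof. by move=> [? ?]; split. Qed.

Lemma is_derive_DyP h z d : is_derive z (0, 1) h d ->
  derivable h z (0, 1) /\ Dy h z = d.
Proof. by move=> [? ?]; split. Qed.

Lemma Ck_is_derive_x k U h z : Ck k.+1 U h -> U z ->
  is_derive z (1, 0) h (Dx h z).
Proof. by move=> [_ [d _ _]] /d[? _]; exact: derivableP. Qed.

Lemma Ck_is_derive_y k U h z : Ck k.+1 U h -> U z ->
  is_derive z (0, 1) h (Dy h z).
Proof. by move=> [_ [d _ _]] /d[_ ?]; exact: derivableP. Qed.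

Lemma Ck_Dx k U h : Ck k.+1 U h -> Ck k U (Dx h).
Proof. by case=> _ [_ ? ?]. Qed.

Lemma Ck_Dy k U h : Ck k.+1 U h -> Ck k U (Dy h).
Proof. by case=> _ [_ ? ?]. Qed.

Lemma Ck_cont k U h : Ck k U h -> forall z, U z -> {for z, continuous h}.
Proof. by case: k => [|k] []. Qed.

(** The partial derivatives are proposed by formulas [hx] and [hy], so that inductions on k run on
    the formulas of the sum, product and chain rules. *)
Lemma CkS_intro k U h hx hy : open U ->
  (forall z, U z -> {for z, continuous h}) ->
  (forall z, U z -> is_derive z (1, 0) h (hx z)) ->
  (forall z, U z -> is_derive z (0, 1) h (hy z)) ->
  Ck k U hx -> Ck k U hy -> Ck k.+1 U h.
Proof.
move=> oU hc dx dy Cx Cy; split; first exact: hc.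
split.
- move=> z Uz; split; first exact: (is_derive_DxP (dx z Uz)).1.
  exact: (is_derive_DyP (dy z Uz)).1.
- apply: (Ck_congr oU) Cx => z Uz; apply/esym.
  exact: (is_derive_DxP (dx z Uz)).2.
- apply: (Ck_congr oU) Cy => z Uz; apply/esym.
  exact: (is_derive_DyP (dy z Uz)).2.
Qed.

Lemma Ck_cst k U c : open U -> Ck k U (fun=> c).
Proof.
move=> oU; elim: k c => [|k IH] c; first by split=> // z _; exact: cst_continuous.
apply: (CkS_intro oU _ _ _ (IH 0) (IH 0)) => z _.
exact: cst_continuous.
Qed.

Lemma is_derive_fst (z v : plane R) : is_derive z v (@fst R R) v.1.
Proof.
apply/is_derive_epsP => e e0; near=> t.
by rewrite /= addrK /GRing.scale/= subrr normr0 mulr_ge0// ltW.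
Unshelve. all: by end_near. Qed.

Lemma is_derive_snd (z v : plane R) : is_derive z v (@snd R R) v.2.
Proof.
apply/is_derive_epsP => e e0; near=> t.
by rewrite /= addrK /GRing.scale/= subrr normr0 mulr_ge0// ltW.
Unshelve. all: by end_near. Qed.

Lemma Ck_fst k U : open U -> Ck k U (@fst R R).
Proof.
move=> oU; case: k => [|k]; first by split; [move=> z _; exact: cvg_fst|exact: I].
apply: (CkS_intro oU _ _ _ (Ck_cst k 1 oU) (Ck_cst k 0 oU)) => z _.
- exact: cvg_fst.
- exact (is_derive_fst z (1, 0)).
- exact (is_derive_fst z (0, 1)).
Qed.

Lemma Ck_snd k U : open U -> Ck k U (@snd R R).
Proof.
move=> oU; case: k => [|k]; first by split; [move=> z _; exact: cvg_snd|exact: I].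
apply: (CkS_intro oU _ _ _ (Ck_cst k 0 oU) (Ck_cst k 1 oU)) => z _.
- exact: cvg_snd.
- exact (is_derive_snd z (1, 0)).
- exact (is_derive_snd z (0, 1)).
Qed.

Lemma CkD k U f g : open U -> Ck k U f -> Ck k U g ->
  Ck k U (fun z => f z + g z).
Proof.
move=> oU; elim: k f g => [|k IH] f g Cf Cg.
  by split=> // z Uz; apply: continuousD; [exact: Cf.1|exact: Cg.1].
apply: (CkS_intro oU _ _ _ (IH _ _ (Ck_Dx Cf) (Ck_Dx Cg))
  (IH _ _ (Ck_Dy Cf) (Ck_Dy Cg))) => z Uz.
- by apply: continuousD; [exact: Cf.1|exact: Cg.1].
- exact (is_deriveD (Ck_is_derive_x Cf Uz) (Ck_is_derive_x Cg Uz)).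
- exact (is_deriveD (Ck_is_derive_y Cf Uz) (Ck_is_derive_y Cg Uz)).
Qed.

Lemma CkM k U f g : open U -> Ck k U f -> Ck k U g ->
  Ck k U (fun z => f z * g z).
Proof.
move=> oU; elim: k f g => [|k IH] f g Cf Cg.
  by split=> // z Uz; apply: continuousM; [exact: Cf.1|exact: Cg.1].
apply: (CkS_intro oU _ _ _
  (CkD oU (IH _ _ (Ck_S Cf) (Ck_Dx Cg)) (IH _ _ (Ck_S Cg) (Ck_Dx Cf)))
  (CkD oU (IH _ _ (Ck_S Cf) (Ck_Dy Cg)) (IH _ _ (Ck_S Cg) (Ck_Dy Cf)))) => z Uz.
- by apply: continuousM; [exact: Cf.1|exact: Cg.1].
- exact (is_deriveM (Ck_is_derive_x Cf Uz) (Ck_is_derive_x Cg Uz)).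
- exact (is_deriveM (Ck_is_derive_y Cf Uz) (Ck_is_derive_y Cg Uz)).
Qed.

Lemma CkZ k U c f : open U -> Ck k U f -> Ck k U (fun z => c * f z).
Proof. by move=> oU Cf; apply: CkM => //; exact: Ck_cst. Qed.

Lemma CkN k U f : open U -> Ck k U f -> Ck k U (fun z => - f z).
Proof.
move=> oU Cf; apply: (Ck_congr oU _ (CkZ (-1) oU Cf)) => z _.
by rewrite mulN1r.
Qed.

Lemma CkB k U f g : open U -> Ck k U f -> Ck k U g ->
  Ck k U (fun z => f z - g z).
Proof. by move=> oU Cf Cg; apply: CkD => //; exact: CkN. Qed.

Lemma is_derive_comp1 (W : normedModType R) (F : R -> R) (q : W -> R) (z v : W) F' q' :
  is_derive (q z) 1 F F' -> is_derive z v q q' ->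
  is_derive z v (fun w => F (q w)) (F' * q').
Proof.
move=> /is_derive_epsP dF dq.
(* The one-variable function goes through the planar chain rule with a constant second
   coordinate. *)
have -> : F' * q' = F' * q' + 0 * 0 by rewrite mulr0 addr0.
apply: (@is_derive_chain R W (fun w => F w.1) q (fun=> 0) F' 0 z v q' 0) => //.
move=> e e0; have /nbhs_ballP[d /= d0 H] := dF e e0.
apply/nbhs_ballP; exists d => //= -[w1 w2] /ball_planeE[/= wd _].
have /H /= : ball 0 d (w1 - q z) by rewrite /ball/= sub0r normrN distrC.
rewrite [_ *: 1]mulr1 subrK mul0r addr0 mulrC => Hw.
apply: le_trans Hw _; rewrite ler_pM2l//.
exact: (norm_fst ((w1, w2) - (q z, 0))).
Qed.

Lemma is_derive_inv (x : R) : x != 0 ->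
  is_derive x 1 (fun s => s^-1) (- (x^-1 * x^-1)).
Proof.
move=> x0; apply: (is_derive_eq (@is_deriveV R id x 1 1 x0 _)).
by rewrite /GRing.scale/= mulr1 -exprVn expr2.
Qed.

Lemma CkV k U f : open U -> (forall z, U z -> f z != 0) -> Ck k U f ->
  Ck k U (fun z => (f z)^-1).
Proof.
move=> oU f0; elim: k => [|k IH] Cf.
  by split=> // z Uz; apply: continuousV; [exact: f0|exact: Cf.1].
have CVV := CkN oU (CkM oU (IH (Ck_S Cf)) (IH (Ck_S Cf))).
apply: (CkS_intro oU _ _ _ (CkM oU CVV (Ck_Dx Cf)) (CkM oU CVV (Ck_Dy Cf))) => z Uz.
- by apply: continuousV; [exact: f0|exact: Cf.1].
- exact (is_derive_comp1 (is_derive_inv (f0 z Uz)) (Ck_is_derive_x Cf Uz)).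
- exact (is_derive_comp1 (is_derive_inv (f0 z Uz)) (Ck_is_derive_y Cf Uz)).
Qed.

Lemma continuous_pair (T : topologicalType) (a b : T -> R) (z : T) :
  {for z, continuous a} -> {for z, continuous b} ->
  {for z, continuous (fun w => (a w, b w))}.
Proof.
move=> ca cb A; rewrite nbhsE/= => -[B [oB Bz] BA].
have [[P Q] /= [Pz Qz] PQ] : nbhs (a z, b z) B by apply: open_nbhs_nbhs.
have H : nbhs z ((a @^-1` P) `&` (b @^-1` Q)).
  by apply: filterI; [exact: ca|exact: cb].
by apply: (@filterS _ (nbhs z) _ _ _ _ H) => w [Pw Qw]; apply: BA; exact: (PQ (_, _)).
Qed.

Lemma Ck_comp k U V h a b : open U -> open V -> Ck k V h ->
  Ck k U a -> Ck k U b -> (forall z, U z -> V (a z, b z)) ->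
  Ck k U (fun z => h (a z, b z)).
Proof.
move=> oU oV; elim: k h => [|k IH] h Ch Ca Cb ab.
  split=> // z Uz; apply: (@continuous_comp _ _ _ (fun z => (a z, b z)) h).
    exact: continuous_pair (Ca.1 z Uz) (Cb.1 z Uz).
  exact: (Ch.1 _ (ab z Uz)).
have C1 : Ck 1 V h by exact: Ck_le Ch.
apply: (CkS_intro oU _ _ _
 (CkD oU (CkM oU (IH _ (Ck_Dx Ch) (Ck_S Ca) (Ck_S Cb) ab) (Ck_Dx Ca))
     (CkM oU (IH _ (Ck_Dy Ch) (Ck_S Ca) (Ck_S Cb) ab) (Ck_Dx Cb)))
 (CkD oU (CkM oU (IH _ (Ck_Dx Ch) (Ck_S Ca) (Ck_S Cb) ab) (Ck_Dy Ca))
     (CkM oU (IH _ (Ck_Dy Ch) (Ck_S Ca) (Ck_S Cb) ab) (Ck_Dy Cb)))) => z Uz.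
- apply: (@continuous_comp _ _ _ (fun z => (a z, b z)) h).
    exact: continuous_pair (Ca.1 z Uz) (Cb.1 z Uz).
  exact: (Ch.1 _ (ab z Uz)).
- exact (Ck1_chain oV (ab z Uz) C1 (Ck_is_derive_x Ca Uz) (Ck_is_derive_x Cb Uz)).
- exact (Ck1_chain oV (ab z Uz) C1 (Ck_is_derive_y Ca Uz) (Ck_is_derive_y Cb Uz)).
Qed.

(** [F] lists successive derivatives on [I]; differentiating the composite shifts the index, so the
    induction on k is made for all n at once. *)
Lemma Ck_comp1 k U (I : set R) (F : nat -> R -> R) n q : open U ->
  (forall m s, I s -> is_derive s 1 (F m) (F m.+1 s)) ->
  (forall z, U z -> I (q z)) -> Ck k U q -> Ck k U (fun z => F n (q z)).
Proof.
move=> oU dF qI; elim: k n => [|k IH] n Cq.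
  split=> // z Uz; apply: (@continuous_comp _ _ _ q (F n)); first exact: Cq.1.
  apply/differentiable_continuous/derivable1_diffP.
  by have [] := dF n _ (qI z Uz).
apply: (CkS_intro oU _ _ _ (CkM oU (IH n.+1 (Ck_S Cq)) (Ck_Dx Cq))
  (CkM oU (IH n.+1 (Ck_S Cq)) (Ck_Dy Cq))) => z Uz.
- apply: (@continuous_comp _ _ _ q (F n)); first exact: Cq.1.
  apply/differentiable_continuous/derivable1_diffP.
  by have [] := dF n _ (qI z Uz).
- exact (is_derive_comp1 (dF n _ (qI z Uz)) (Ck_is_derive_x Cq Uz)).
- exact (is_derive_comp1 (dF n _ (qI z Uz)) (Ck_is_derive_y Cq Uz)).
Qed.

End CkClosure.

(** * Second derivatives: symmetry, conformal covariance, tests at a maximum *)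

Section SecondOrder.
Context {R : realType}.
Implicit Types (U V : set (plane R)) (h : plane R -> R) (z : plane R).

Lemma Ck_dx k U h z : Ck k.+1 U h -> U z -> derivable h z (1, 0).
Proof. move=> [_ [d _ _]] Uz; exact (proj1 (d z Uz)). Qed.

Lemma Ck_dy k U h z : Ck k.+1 U h -> U z -> derivable h z (0, 1).
Proof. move=> [_ [d _ _]] Uz; exact (proj2 (d z Uz)). Qed.

Lemma eps_eq0 (x : R) : (forall e, 0 < e -> `|x| <= e) -> x = 0.
Proof.
move=> H; apply/eqP; rewrite -normr_le0; apply/ler_addgt0Pl => e e0.
by rewrite addr0; exact: H.
Qed.

Lemma min3_exists (a b c : R) : 0 < a -> 0 < b -> 0 < c ->
  exists2 d, 0 < d & [/\ d <= a, d <= b & d <= c].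
Proof.
move=> a0 b0 c0; exists (Num.min a (Num.min b c)); first by rewrite !lt_min a0 b0.
by split; rewrite !ge_min lexx ?orbT.
Qed.

(** The double difference [D] of h over a small square of side s is s^2 times either mixed
    derivative, up to e / 2 s^2 each; the two readings of [D] are compared. *)
Lemma schwarz U h z : open U -> U z -> Ck 2 U h ->
  Dx (Dy h) z = Dy (Dx h) z.
Proof.
move=> oU Uz h2; have hx := Ck_Dx h2; have hy := Ck_Dy h2.
apply/eqP; rewrite -subr_eq0; apply/eqP/eps_eq0 => e e0.
have e20 : 0 < e / 2 by rewrite divr_gt0.
have [d1 d10 H1] := Ck1_strict oU Uz hx e20.
have [d2 d20 H2] := Ck1_strict oU Uz hy e20.
have /nbhs_ballP[d3 /= d30 H3] : nbhs z U by exact: open_nbhs_nbhs.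
have [d d0 [dd1 dd2 dd3]] := min3_exists d10 d20 d30.
have [s s0 sd] : exists2 s, 0 < s & s < d.
  by exists (d / 2); rewrite ?divr_gt0// ltr_pdivrMr// ltr_pMr// ltr1n.
case: z Uz H1 H2 H3 => x y Uz H1 H2 H3.
have bl u v : x <= u <= x + s -> y <= v <= y + s -> ball (x, y) d (u, v).
  move=> /andP[xu ux] /andP[yv vy]; apply/ball_planeE; rewrite /=.
  by split; rewrite ltr_norml; apply/andP; split; lra.
have ss : `|s| = s by rewrite gtr0_norm.
have xs : x <= x <= x + s by rewrite lexx lerDl ltW.
have xs' : x <= x + s <= x + s by rewrite lexx lerDl ltW.
have ys : y <= y <= y + s by rewrite lexx lerDl ltW.
have ys' : y <= y + s <= y + s by rewrite lexx lerDl ltW.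
pose D := h (x + s, y + s) - h (x + s, y) - (h (x, y + s) - h (x, y)).
have n0s (u : R) : `|(u, y + s) - (u, y)| <= s.
  by rewrite prod_norm_le /= subrr normr0 ltW//= (addrC y) addrK ss lexx.
have ns0 (u : R) : `|(x + s, u) - (x, u)| <= s.
  by rewrite prod_norm_le /= subrr normr0 (ltW s0) andbT (addrC x) addrK ss lexx.
have b1 : `|D - Dy (Dx h) (x, y) * s * s| <= e / 2 * s * s.
  have := @mvt_bound R (fun u => h (u, y + s) - h (u, y))
    (fun u => Dx h (u, y + s) - Dx h (u, y)) x (x + s)
    (Dy (Dx h) (x, y) * s) (e / 2 * s).
  rewrite (addrC x) addrK ss (addrC s); apply.
    move=> u; rewrite min_l ?max_r ?lerDl ?(ltW s0)// => xu.
    have U1 : U (u, y + s) by apply/H3/(le_ball dd3)/bl.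
    have U2 : U (u, y) by apply/H3/(le_ball dd3)/bl.
    exact (is_deriveB (is_derive_Dx (Ck_dx h2 U1)) (is_derive_Dx (Ck_dx h2 U2))).
  move=> u; rewrite min_l ?max_r ?lerDl ?(ltW s0)// => xu.
  have := H1 (u, y + s) (u, y) (le_ball dd1 (bl _ _ xu ys')) (le_ball dd1 (bl _ _ xu ys)).
  rewrite (_ : _ * _ + _ = Dy (Dx h) (x, y) * s); last first.
    by move: (Dx (Dx h) (x, y)) (Dy (Dx h) (x, y)) => A B /=; ring.
  move=> /le_trans; apply.
  by rewrite ler_pM2l.
have b2 : `|D - Dx (Dy h) (x, y) * s * s| <= e / 2 * s * s.
  have -> : D = h (x + s, y + s) - h (x, y + s) - (h (x + s, y) - h (x, y)).
    by rewrite /D; ring.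
  have := @mvt_bound R (fun u => h (x + s, u) - h (x, u))
    (fun u => Dy h (x + s, u) - Dy h (x, u)) y (y + s)
    (Dx (Dy h) (x, y) * s) (e / 2 * s).
  rewrite (addrC y) addrK ss (addrC s); apply.
    move=> u; rewrite min_l ?max_r ?lerDl ?(ltW s0)// => yu.
    have U1 : U (x + s, u) by apply/H3/(le_ball dd3)/bl.
    have U2 : U (x, u) by apply/H3/(le_ball dd3)/bl.
    exact (is_deriveB (is_derive_Dy (Ck_dy h2 U1)) (is_derive_Dy (Ck_dy h2 U2))).
  move=> u; rewrite min_l ?max_r ?lerDl ?(ltW s0)// => yu.
  have := H2 (x + s, u) (x, u) (le_ball dd2 (bl _ _ xs' yu)) (le_ball dd2 (bl _ _ xs yu)).
  rewrite (_ : _ * _ + _ = Dx (Dy h) (x, y) * s); last first.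
    by move: (Dx (Dy h) (x, y)) (Dy (Dy h) (x, y)) => A B /=; ring.
  move=> /le_trans; apply.
  by rewrite ler_pM2l.
rewrite -(@ler_pM2r _ (s * s)) ?mulr_gt0// -{1}(gtr0_norm (mulr_gt0 s0 s0)).
rewrite -normrM.
have -> : (Dx (Dy h) (x, y) - Dy (Dx h) (x, y)) * (s * s) =
  (D - Dy (Dx h) (x, y) * s * s) - (D - Dx (Dy h) (x, y) * s * s) by ring.
apply: le_trans (ler_normB _ _) _; apply: le_trans (lerD b1 b2) _.
by rewrite le_eqVlt; apply/orP; left; apply/eqP; field.
Qed.

(** In the second-order chain rule the Cauchy-Riemann equations cancel the mixed derivatives of h
    and give the pure ones the common factor |tau'|^2, which is the jacobian. The gradient of h only
    meets the Laplacians of the two components of tau, which vanish. *)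
Lemma laplacian_holomorphic U V h (tau : plane R -> plane R) z :
  open U -> open V -> Ck 2 V h -> holomorphic_on U tau ->
  (forall w, U w -> V (tau w)) -> U z ->
  laplacian (h \o tau) z = laplacian h (tau z) * Defs.jacobian tau z.
Proof.
move=> oU oV h2 [sa sb CR] UV Uz.
set a := fun z => (tau z).1; set b := fun z => (tau z).2.
have tE w : (a w, b w) = tau w by rewrite /a /b -surjective_pairing.
have {}UV w : U w -> V (a w, b w) by rewrite tE; exact: UV.
have a2 : Ck 2 U a by exact: sa. have b2 : Ck 2 U b by exact: sb.
have -> : h \o tau = fun w => h (a w, b w) by apply/funext => w; rewrite tE.
have C1 : Ck 1 V h := Ck_S h2.
have ex : \forall w \near z, Dx (fun w => h (a w, b w)) w =
    Dx h (a w, b w) * Dx a w + Dy h (a w, b w) * Dx b w.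
  apply: (near_open oU Uz) => w Uw; apply: (is_derive_DxP _).2.
  exact (Ck1_chain oV (UV w Uw) C1 (Ck_is_derive_x a2 Uw) (Ck_is_derive_x b2 Uw)).
have ey : \forall w \near z, Dy (fun w => h (a w, b w)) w =
    Dx h (a w, b w) * Dy a w + Dy h (a w, b w) * Dy b w.
  apply: (near_open oU Uz) => w Uw; apply: (is_derive_DyP _).2.
  exact (Ck1_chain oV (UV w Uw) C1 (Ck_is_derive_y a2 Uw) (Ck_is_derive_y b2 Uw)).
rewrite /laplacian (nbhs_singleton (near_Dx ex)) (nbhs_singleton (near_Dy ey)).
have ax := Ck_is_derive_x a2 Uz; have bx := Ck_is_derive_x b2 Uz.
have ay := Ck_is_derive_y a2 Uz; have by_ := Ck_is_derive_y b2 Uz.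
have Hx := is_deriveD
  (is_deriveM (Ck1_chain oV (UV z Uz) (Ck_Dx h2) ax bx) (Ck_is_derive_x (Ck_Dx a2) Uz))
  (is_deriveM (Ck1_chain oV (UV z Uz) (Ck_Dy h2) ax bx) (Ck_is_derive_x (Ck_Dx b2) Uz)).
have Hy := is_deriveD
  (is_deriveM (Ck1_chain oV (UV z Uz) (Ck_Dx h2) ay by_) (Ck_is_derive_y (Ck_Dy a2) Uz))
  (is_deriveM (Ck1_chain oV (UV z Uz) (Ck_Dy h2) ay by_) (Ck_is_derive_y (Ck_Dy b2) Uz)).
have -> := (is_derive_DxP Hx).2; have -> := (is_derive_DyP Hy).2.
have Dax : \forall w \near z, Dx a w = Dy b w.
  by apply: (near_open oU Uz) => w Uw; exact: (CR w Uw).1.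
have Day : \forall w \near z, Dy a w = - Dx b w.
  by apply: (near_open oU Uz) => w Uw; exact: (CR w Uw).2.
have axx : Dx (Dx a) z = Dx (Dy b) z by exact: (nbhs_singleton (near_Dx Dax)).
have ayx : Dx (Dy a) z = - Dx (Dx b) z.
  rewrite (nbhs_singleton (near_Dx Day)); apply: (is_derive_DxP _).2.
  exact (is_deriveN (Ck_is_derive_x (Ck_Dx b2) Uz)).
have axy : Dy (Dx a) z = Dy (Dy b) z by exact: (nbhs_singleton (near_Dy Dax)).
have ayy : Dy (Dy a) z = - Dy (Dx b) z.
  rewrite (nbhs_singleton (near_Dy Day)); apply: (is_derive_DyP _).2.
  exact (is_deriveN (Ck_is_derive_y (Ck_Dx b2) Uz)).
have S1 := schwarz oU Uz a2; have S2 := schwarz oU Uz b2.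
have [r1 r2] := CR z Uz.
rewrite /Defs.jacobian -/a -/b -tE /GRing.scale [LHS]/=.
(* The Cauchy-Riemann equations, differentiated once, together with [schwarz] make both components
   harmonic. *)
have L1 : Dx (Dx a) z + Dy (Dy a) z = 0 by rewrite axx ayy S2 subrr.
have L2 : Dx (Dx b) z + Dy (Dy b) z = 0.
  by rewrite -axy -S1 ayx addrN.
have -> : Dy (Dy a) z = - Dx (Dx a) z by apply/eqP; rewrite -addr_eq0 addrC L1.
have -> : Dy (Dy b) z = - Dx (Dx b) z by apply/eqP; rewrite -addr_eq0 addrC L2.
rewrite -/a -/b in r1 r2 *; rewrite r1 r2.
move: (Dx (Dx h) (a z, b z)) (Dy (Dx h) (a z, b z)) (Dx (Dy h) (a z, b z)).
move: (Dy (Dy h) (a z, b z)) (Dx h (a z, b z)) (Dy h (a z, b z)).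
move: (Dx (Dx a) z) (Dx (Dx b) z) (Dx b z) (Dy b z).
move=> *; ring.
Qed.

Lemma is_derive_max0 (F : R -> R) (x d : R) : is_derive x 1 F d ->
  (\forall s \near x, F s <= F x) -> d = 0.
Proof.
move=> /is_derive_epsP H /nbhs_ballP[r /= r0 mx]; apply: eps_eq0 => e e0.
have /nbhs_ballP[r' /= r'0 H'] := H e e0.
pose t := Num.min r r' / 2.
have t0 : 0 < t by rewrite divr_gt0// lt_min r0.
have tr : t < Num.min r r' by rewrite ltr_pdivrMr// ltr_pMr ?ltr1n// lt_min r0.
move: tr; rewrite lt_min => /andP[tr tr'].
have nt : `|t| = t by rewrite gtr0_norm.
have := H' t; have := H' (- t).
rewrite /ball/= !sub0r !normrN nt => /(_ tr') h1 /(_ tr') h2.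
have := mx (x + t); have := mx (x - t).
rewrite /ball/= !opprD !opprK !addrA !subrr !add0r normrN nt => /(_ tr) m1 /(_ tr) m2.
move: h1 h2; rewrite ![_ *: 1]mulr1 (addrC t) (addrC (- t)) !ler_norml.
move=> /andP[h1 h1'] /andP[h2 h2'].
have : d * t <= e * t by move: h1'; rewrite mulNr opprK (mulrC t); lra.
have : - e * t <= d * t by move: h2; rewrite mulNr (mulrC t); lra.
by rewrite !ler_pM2r// => -> ->.
Qed.

(** If c were positive, F' would vanish at x and be positive just to the right of it, so F would
    increase there. *)
Lemma is_derive_max2 (F F' : R -> R) (x c : R) :
  (\forall s \near x, is_derive (s : R) (1 : R) F (F' s)) -> is_derive x 1 F' c ->
  (\forall s \near x, F s <= F x) -> c <= 0.
Proof.
move=> nF dF' mx; have F'x := is_derive_max0 (nbhs_singleton nF) mx.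
rewrite leNgt; apply/negP => c0; have c20 : 0 < c / 2 by rewrite divr_gt0.
move: dF' => /is_derive_epsP/(_ _ c20)/nbhs_ballP[r /= r0 H].
move: nF => /nbhs_ballP[r1 /= r10 nF]; move: mx => /nbhs_ballP[r2 /= r20 mx].
pose m := Num.min r (Num.min r1 r2).
have m0 : 0 < m by rewrite !lt_min r0 r10.
pose t := m / 2; have t0 : 0 < t by rewrite divr_gt0.
have tm : t < m by rewrite ltr_pdivrMr// ltr_pMr ?ltr1n.
have m1 : m <= r by rewrite ge_min lexx.
have m2 : m <= r1 by rewrite !ge_min lexx orbT.
have m3 : m <= r2 by rewrite !ge_min lexx !orbT.
have bd s : x <= s <= x + t -> `|x - s| < m.
  by move=> /andP[? ?]; rewrite ltr_norml; apply/andP; split; lra.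
have [s] : exists2 s, s \in `]x, x + t[%R & F (x + t) - F x = F' s * (x + t - x).
  apply: MVT; first by rewrite ltrDl.
    move=> s; rewrite in_itv/= => /andP[/ltW ? /ltW ?]; apply: nF.
    by apply: lt_le_trans m2; apply: bd; apply/andP.
  apply: derivable_within_continuous => s; rewrite in_itv/= => /bd sm.
  by have [] := nF s (lt_le_trans sm m2).
rewrite in_itv/= => /andP[xs st] E.
have := mx (x + t); rewrite /ball/= opprD addrA subrr add0r normrN gtr0_norm//.
move=> /(_ (lt_le_trans tm m3)); apply/negP; rewrite -ltNge -subr_gt0 E.
rewrite (addrC x) addrK mulr_gt0//.
have sx : 0 < s - x by rewrite subr_gt0.
have := H (s - x); rewrite /ball/= sub0r normrN gtr0_norm// => H'.
have {H'} : `|F' ((s - x) *: 1 + x) - F' x - (s - x) * c| <= c / 2 * (s - x).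
  by apply: H'; lra.
rewrite [_ *: 1]mulr1 subrK F'x subr0 ler_norml => /andP[h _].
have : 0 < c / 2 * (s - x) by rewrite mulr_gt0.
by move: h; rewrite (mulrC (s - x)); lra.
Qed.

Lemma near_fst (P : set (plane R)) (x y : R) :
  (\forall w \near ((x, y) : plane R), P w) -> \forall s \near x, P (s, y).
Proof.
move=> /nbhs_ballP[d /= d0 H]; apply/nbhs_ballP; exists d => //= s xs.
by apply: H; apply/ball_planeE; rewrite /= subrr normr0.
Qed.

Lemma near_snd (P : set (plane R)) (x y : R) :
  (\forall w \near ((x, y) : plane R), P w) -> \forall s \near y, P (x, s).
Proof.
move=> /nbhs_ballP[d /= d0 H]; apply/nbhs_ballP; exists d => //= s xs.
by apply: H; apply/ball_planeE; rewrite /= subrr normr0.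
Qed.

Lemma laplacian_max U q z : open U -> U z -> Ck 2 U q ->
  (\forall w \near z, q w <= q z) -> laplacian q z <= 0.
Proof.
case: z => x y oU Uz q2 mx.
have nU : \forall w \near ((x, y) : plane R), U w by exact: (near_open oU Uz).
rewrite /laplacian -[leRHS]addr0; apply: lerD.
  apply: (@is_derive_max2 (fun s => q (s, y)) (fun s => Dx q (s, y)) x).
  - apply: (@near_fst (fun w => is_derive w.1 1 (fun s => q (s, w.2)) (Dx q w)) x y).
  apply: filterS nU => -[u v] Uw.
    exact (is_derive_Dx (Ck_dx q2 Uw)).
  - exact (is_derive_Dx (Ck_dx (Ck_Dx q2) Uz)).
  - exact: (near_fst mx).
apply: (@is_derive_max2 (fun s => q (x, s)) (fun s => Dy q (x, s)) y).
- apply: (@near_snd (fun w => is_derive w.2 1 (fun s => q (w.1, s)) (Dy q w)) x y).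
  apply: filterS nU => -[u v] Uw.
  exact (is_derive_Dy (Ck_dy q2 Uw)).
- exact (is_derive_Dy (Ck_dy (Ck_Dy q2) Uz)).
- exact: (near_snd mx).
Qed.

(** Only earlier points are compared, since a maximum over a time interval may sit at its final
    time. *)
Lemma is_derive_left_max (F : R -> R) (x d : R) : is_derive x 1 F d ->
  (\forall s \near x, s <= x -> F s <= F x) -> 0 <= d.
Proof.
move=> /is_derive_epsP H /nbhs_ballP[r /= r0 mx].
rewrite leNgt; apply/negP => d0.
have e0 : 0 < - d / 2 by rewrite divr_gt0// oppr_gt0.
have /nbhs_ballP[r' /= r'0 H'] := H _ e0.
pose t := Num.min r r' / 2.
have t0 : 0 < t by rewrite divr_gt0// lt_min r0.
have tr : t < Num.min r r' by rewrite ltr_pdivrMr// ltr_pMr ?ltr1n// lt_min r0.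
move: tr; rewrite lt_min => /andP[tr tr'].
have nt : `|t| = t by rewrite gtr0_norm.
have := H' (- t); rewrite /ball/= !sub0r !normrN nt => /(_ tr') h1.
have := mx (x - t).
rewrite /ball/= opprD opprK addrA subrr add0r nt => /(_ tr).
rewrite gerBl (ltW t0) => /(_ isT) m1.
move: h1; rewrite [_ *: 1]mulr1 (addrC (- t)) !ler_norml => /andP[h1 _].
have : t * d < 0 by rewrite nmulr_llt0.
by nra.
Qed.

Lemma Ck1_lipschitz U h z : open U -> U z -> Ck 1 U h ->
  exists M, exists2 d, 0 < d & 0 <= M /\ forall p q, ball z d p -> ball z d q ->
    `|h p - h q| <= M * `|p - q|.
Proof.
move=> oU Uz h1; have [d d0 H] := Ck1_strict oU Uz h1 ltr01.
exists (1 + `|Dx h z| + `|Dy h z|); exists d => //; split.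
  by rewrite !addr_ge0.
move=> p q bp bq; have := H p q bp bq; rewrite mul1r => Hpq.
rewrite -[X in `|X|](subrK (Dx h z * (p.1 - q.1) + Dy h z * (p.2 - q.2))).
apply: le_trans (ler_normD _ _) _.
rewrite !mulrDl mul1r -[leRHS]addrA; apply: lerD => //.
apply: le_trans (ler_normD _ _) _.
by apply: lerD; rewrite normrM ler_wpM2l//;
  [exact (norm_fst (p - q : plane R))|exact (norm_snd (p - q : plane R))].
Qed.

(** The derivative of q (c + t s) + q (c - t s) in t is a difference of gradients paired with s, and
    the gradient of a C^2 function is locally Lipschitz; hence a bound quadratic in s. This
    semiconvexity later gives q plus a multiple of |z|^2 its sub-mean value property. *)
Lemma second_difference U q z : open U -> U z -> Ck 2 U q ->
  exists M, exists2 d, 0 < d & 0 <= M /\ forall c s : plane R,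
    ball z d c -> ball z d (c + s) -> ball z d (c - s) ->
    - (M * (s.1 ^+ 2 + s.2 ^+ 2)) <= q (c + s) + q (c - s) - 2 * q c.
Proof.
move=> oU Uz q2.
have [M1 [d1 d10 [M10 H1]]] := Ck1_lipschitz oU Uz (Ck_Dx q2).
have [M2 [d2 d20 [M20 H2]]] := Ck1_lipschitz oU Uz (Ck_Dy q2).
have /nbhs_ballP[d3 /= d30 H3] : nbhs z U by exact: open_nbhs_nbhs.
have [d d0 [dd1 dd2 dd3]] := min3_exists d10 d20 d30.
exists (2 * (M1 + M2)); exists d => //; split; first by rewrite mulr_ge0// addr_ge0.
move=> c s bc bp bm.
pose N := `|s|.
pose l (k : R) (t : R) : plane R := (c.1 + k * t * s.1, c.2 + k * t * s.2).
have lb k t : (k == 1) || (k == -1) -> 0 <= t <= 1 -> ball z d (l k t).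
  move=> kk /andP[t0 t1].
  have cv (z1 c1 s1 : R) : `|z1 - c1| < d -> `|z1 - (c1 + s1)| < d ->
      `|z1 - (c1 - s1)| < d -> `|z1 - (c1 + k * t * s1)| < d.
    rewrite !ltr_norml => /andP[? ?] /andP[? ?] /andP[? ?].
    have [/eqP ->|/eqP ->] := orP kk; apply/andP; split.
    - by nra.
    - by nra.
    - by nra.
    - by nra.
  move: bc bp bm => [/= c1 c2] [/= p1 p2] [/= m1 m2].
  by apply/ball_planeE; split; apply: cv.
have dl (k t : R) : (k == 1) || (k == -1) -> 0 <= t <= 1 ->
  is_derive t 1 (fun t => q (l k t))
    (Dx q (l k t) * (k * s.1) + Dy q (l k t) * (k * s.2)).
  move=> kk t01; have Ul : U (l k t) by apply/H3/(le_ball dd3)/lb.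
  have dc (x1 y1 : R) : is_derive t (1 : R) (fun t : R => x1 + k * t * y1) (k * y1).
    apply/is_derive_epsP => e e0; apply: filterE => u.
    rewrite [_ *: 1]mulr1 (_ : _ - _ - _ = 0); first by rewrite normr0 mulr_ge0// ltW.
    by move: t01 => _; ring.
  exact (@Ck1_chain R U q R (fun t => c.1 + k * t * s.1) (fun t => c.2 + k * t * s.2)
    t 1 (k * s.1) (k * s.2) oU Ul (Ck_S q2) (dc _ _) (dc _ _)).
have := @mvt_bound R (fun t => q (l 1 t) + q (l (-1) t))
  (fun t => (Dx q (l 1 t) * (1 * s.1) + Dy q (l 1 t) * (1 * s.2)) +
   (Dx q (l (-1) t) * (-1 * s.1) + Dy q (l (-1) t) * (-1 * s.2))) 0 1 0
  (2 * (M1 + M2) * (s.1 ^+ 2 + s.2 ^+ 2)).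
rewrite (subr0 1) mul0r subr0 normr1 mulr1 (min_l ler01) (max_r ler01).
have -> : l 1 1 = c + s by rewrite /l !mul1r.
have -> : l (-1) 1 = c - s by rewrite /l !mulr1 !mulN1r.
have -> : l 1 0 = c by rewrite /l !mulr0 !mul0r !addr0 -surjective_pairing.
have -> : l (-1) 0 = c by rewrite /l !mulr0 !mul0r !addr0 -surjective_pairing.
move=> W; have {W} : `|q (c + s) + q (c - s) - (q c + q c)| <=
   2 * (M1 + M2) * (s.1 ^+ 2 + s.2 ^+ 2); last first.
  by rewrite ler_norml => /andP[h _]; move: h; lra.
have N2 : N ^+ 2 <= s.1 ^+ 2 + s.2 ^+ 2.
  rewrite /N prod_normE; case: (leP `|s.1| `|s.2|) => _;
  by rewrite -normrX ger0_norm ?sqr_ge0 ?lerDl ?lerDr ?sqr_ge0.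
apply: W => t t01.
  exact (is_deriveD (dl 1 t (introT orP (or_introl (eqxx _))) t01)
    (dl (-1) t (introT orP (or_intror (eqxx _))) t01)).
have b1 := lb 1 t (introT orP (or_introl (eqxx _))) t01.
have b2 := lb (-1) t (introT orP (or_intror (eqxx _))) t01.
have nl : `|l 1 t - l (-1) t| <= 2 * N.
  have tN u : `|u| <= N -> `|2 * t * u| <= 2 * N.
    move=> uN; rewrite normrM ger0_norm ?mulr_ge0 ?(andP t01).1//.
    by apply: ler_pM => //; rewrite ?mulr_ge0 ?(andP t01).1// ler_piMr// (andP t01).2.
  rewrite prod_norm_le /=; apply/andP; split.
    have -> : c.1 + 1 * t * s.1 - (c.1 + -1 * t * s.1) = 2 * t * s.1 by ring.
    exact/tN/norm_fst.
  have -> : c.2 + 1 * t * s.2 - (c.2 + -1 * t * s.2) = 2 * t * s.2 by ring.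
  exact/tN/norm_snd.
have -> : Dx q (l 1 t) * (1 * s.1) + Dy q (l 1 t) * (1 * s.2) +
   (Dx q (l (-1) t) * (-1 * s.1) + Dy q (l (-1) t) * (-1 * s.2)) - 0 =
   (Dx q (l 1 t) - Dx q (l (-1) t)) * s.1 + (Dy q (l 1 t) - Dy q (l (-1) t)) * s.2.
  by ring.
have e1 := H1 _ _ (le_ball dd1 b1) (le_ball dd1 b2).
have e2 := H2 _ _ (le_ball dd2 b1) (le_ball dd2 b2).
apply: (@le_trans _ _ (2 * (M1 + M2) * N ^+ 2)); last first.
  by rewrite ler_wpM2l// mulr_ge0// addr_ge0.
apply: le_trans (ler_normD _ _) _; rewrite !normrM.
have -> : 2 * (M1 + M2) * N ^+ 2 = M1 * (2 * N) * N + M2 * (2 * N) * N by ring.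
apply: lerD; apply: ler_pM => //; try exact: norm_fst; try exact: norm_snd.
  by apply: le_trans e1 _; rewrite ler_wpM2l.
by apply: le_trans e2 _; rewrite ler_wpM2l.
Unshelve. all: by end_near. Qed.

End SecondOrder.

(* R and the plane as the measurable types on which Lebesgue measure and area live; plain
   R and R * R do not let the measurable structure be inferred. *)
Notation mR R := (measurableTypeR R).
Notation mplane R := (measurableTypeR R * measurableTypeR R)%type.

(** * Change of variables for holomorphic maps *)

Section PlaneMeasure.
Context {R : realType}.
Implicit Types (U : set (plane R)).

Definition rect (a b c d : R) : set (plane R) :=
  [set` `]a, b]] `*` [set` `]c, d]].

Definition boxc (a b c d : R) : set (plane R) :=
  [set` `[a, b]] `*` [set` `[c, d]].

Lemma rectP a b c d (z : plane R) :
  rect a b c d z <-> (a < z.1 <= b) /\ (c < z.2 <= d).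
Proof. by rewrite /rect /=; split=> -[]; rewrite ?in_itv. Qed.

Lemma boxcP a b c d (z : plane R) :
  boxc a b c d z <-> (a <= z.1 <= b) /\ (c <= z.2 <= d).
Proof. by rewrite /boxc /=; split=> -[]; rewrite ?in_itv. Qed.

Lemma measurable_rect a b c d : measurable (rect a b c d : set (mplane R)).
Proof. by apply: measurableX; exact: measurable_itv. Qed.

Lemma area_rect a b c d : a <= b -> c <= d ->
  area R (rect a b c d) = ((b - a) * (d - c))%:E.
Proof.
move=> ab cd; rewrite /area product_measure1E; [|exact: measurable_itv..].
transitivity (lebesgue_measure `]a, b]%classic * lebesgue_measure `]c, d]%classic)%E.
  by [].
rewrite !lebesgue_measure_itv/= !lte_fin -!EFinD EFinM.
have H (x y : R) : x <= y -> (if x < y then (y - x)%:E else 0) = (y - x)%:E.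
  by rewrite le_eqVlt => /predU1P[->|->//]; rewrite ltxx subrr.
by rewrite !H.
Qed.

(** The closed box is required to lie in U, which supplies compactness, while the piece kept is
    half-open, so that pieces can be cut and tiled without overlap. Rational corners make the family
    countable. *)
Definition rat_rect (U : set (plane R)) (q : rat * rat * (rat * rat)) : set (plane R) :=
  if `[< boxc (ratr q.1.1) (ratr q.1.2) (ratr q.2.1) (ratr q.2.2) `<=` U >]
  then rect (ratr q.1.1) (ratr q.1.2) (ratr q.2.1) (ratr q.2.2) else set0.

Definition nrect (U : set (plane R)) (n : nat) : set (plane R) :=
  if unpickle n is Some q then rat_rect U q else set0.

Lemma nrect_cases U n : nrect U n = set0 \/
  exists a b c d, boxc a b c d `<=` U /\ nrect U n = rect a b c d.
Proof.
rewrite /nrect; case: unpickle => [q|]; last by left.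
rewrite /rat_rect; case: asboolP => H; last by left.
by right; do 4!eexists; split; first exact: H.
Qed.

Lemma rect_boxc a b c d : rect a b c d `<=` boxc a b c d.
Proof.
by move=> z /rectP[/andP[/ltW a1 b1] /andP[/ltW c1 d1]]; apply/boxcP; rewrite a1 c1.
Qed.

Lemma bigcup_nrect U : open U -> U = \bigcup_n nrect U n.
Proof.
move=> oU; apply/seteqP; split; last first.
  move=> z [n _]; have [->//|[a [b [c [d [H ->]]]]]] := nrect_cases U n.
  by move=> /rect_boxc/H.
move=> [x y] Uz.
have /nbhs_ballP[e /= e0 H] : nbhs (x, y) U by exact: open_nbhs_nbhs.
have xl : x - e < x by rewrite ltrBlDr ltrDl.
have xr : x < x + e by rewrite ltrDl.
have yl : y - e < y by rewrite ltrBlDr ltrDl.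
have yr : y < y + e by rewrite ltrDl.
have [a] := rat_in_itvoo xl; have [b] := rat_in_itvoo xr.
have [c] := rat_in_itvoo yl; have [d] := rat_in_itvoo yr.
rewrite !in_itv/= => /andP[d1 d2] /andP[c1 c2] /andP[b1 b2] /andP[a1 a2].
have [q qE] : exists q, q = ((a, b), (c, d)) by eexists.
exists (pickle q); first exact: I.
rewrite /nrect pickleK qE /rat_rect [fst _]/= [snd _]/=.
cbn [fst snd].
case: asboolP => [_|[]].
  by apply/rectP; rewrite /= a2 c2 !ltW.
move=> [u v] /boxcP[/= /andP[u1 u2] /andP[v1 v2]].
by apply: H; apply/ball_planeE; rewrite /= !ltr_norml; split; apply/andP; split; lra.
Qed.

Lemma measurable_nrect U n : measurable (nrect U n : set (mplane R)).
Proof.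
have [->//|[a [b [c [d [H ->]]]]]] := nrect_cases U n.
exact: measurable_rect.
Qed.

Lemma open_measurable_plane U : open U -> measurable (U : set (mplane R)).
Proof.
move=> /bigcup_nrect ->; apply: bigcupT_measurable => n; exact: measurable_nrect.
Qed.

Lemma open_preimage (T : topologicalType) U (g : plane R -> T) (A : set T) : open U ->
  (forall z, U z -> {for z, continuous g}) -> open A -> open (U `&` g @^-1` A).
Proof.
move=> oU cg oA; rewrite openE => z [Uz gz].
apply: filterI; first exact: open_nbhs_nbhs.
by apply: cg => //; exact: open_nbhs_nbhs.
Qed.

Lemma open_continuous_measurable U (g : plane R -> R) : open U ->
  (forall z, U z -> {for z, continuous g}) -> measurable_fun (U : set (mplane R)) g.
Proof.
move=> oU cg; apply: (measurability _ (measurable_realfun.RGenOpens.measurableE R)).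
move=> _ [_ [a [b ->] <-]]; apply: open_measurable_plane.
by apply: open_preimage => //; exact: interval_open.
Qed.

Definition rects : set (set (plane R)) :=
  [set A | exists a b c d, A = rect a b c d].

Lemma rects_setI : setI_closed rects.
Proof.
move=> _ _ [a [b [c [d ->]]]] [a' [b' [c' [d' ->]]]].
exists (Num.max a a'), (Num.min b b'), (Num.max c c'), (Num.min d d').
apply/seteqP; split=> z.
  move=> [/rectP[/andP[? ?] /andP[? ?]] /rectP[/andP[? ?] /andP[? ?]]].
  apply/rectP; rewrite !gt_max !le_min; split; repeat (apply/andP; split) => //.
move=> /rectP[/andP[]]; rewrite !gt_max !le_min.
move=> /andP[? ?] /andP[? ?] /andP[/andP[? ?] /andP[? ?]].
by split; apply/rectP; split; apply/andP; split.
Qed.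

(** Both projections are measurable for the sigma-algebra generated by the rectangles, since a strip
    over an interval is a countable union of rectangles. Hence so is the identity, into the product
    sigma-algebra. *)
Lemma measurable_rectsE : @measurable _ (mplane R) = <<s rects >>.
Proof.
apply/seteqP; split; last first.
  apply: smallest_sub; first exact: sigma_algebra_measurable.
  by move=> _ [a [b [c [d ->]]]]; exact: measurable_rect.
pose T := g_sigma_algebraType rects.
have f1 : measurable_fun [set: T] (fst : T -> mR R).
  apply: (measurability (@ocitv R)) => //.
  move=> _ [_ [[a b] _ <-] <-]; rewrite setTI.
  have -> : fst @^-1` `]a, b]%classic = \bigcup_n (rect a b (- n%:R) n%:R).
    apply/seteqP; split=> [[x y] /= xab|[x y] [n _ /rectP[/= + _]]]; last by rewrite in_itv.
    have [n yn] : exists n : nat, `|y| < n%:R.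
      by eexists; exact: archi_boundP.
    exists n => //; apply/rectP; rewrite in_itv/= in xab; split => //=.
    by move: yn; rewrite ltr_norml => /andP[-> /ltW].
  by apply: bigcupT_measurable => n; apply: sub_sigma_algebra; do 4!eexists.
have f2 : measurable_fun [set: T] (snd : T -> mR R).
  apply: (measurability (@ocitv R)) => //.
  move=> _ [_ [[a b] _ <-] <-]; rewrite setTI.
  have -> : snd @^-1` `]a, b]%classic = \bigcup_n (rect (- n%:R) n%:R a b).
    apply/seteqP; split=> [[x y] /= xab|[x y] [n _ /rectP[/= _ +]]]; last by rewrite in_itv.
    have [n yn] : exists n : nat, `|x| < n%:R.
      by eexists; exact: archi_boundP.
    exists n => //; apply/rectP; rewrite in_itv/= in xab; split => //=.
    by move: yn; rewrite ltr_norml => /andP[-> /ltW].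
  by apply: bigcupT_measurable => n; apply: sub_sigma_algebra; do 4!eexists.
have fid : measurable_fun [set: T] (fun x : T => (x.1, x.2) : mplane R).
  exact: measurable_fun_pair.
move=> A mA; have := fid measurableT A mA; rewrite setTI.
by rewrite (_ : _ @^-1` A = A)//; apply/funext => -[x y].
Qed.

End PlaneMeasure.

(** * Measures with a density and image measures *)

Section Density.
Context d (T : measurableType d) (R : realType) (m : {measure set T -> \bar R}).
Variables (g : T -> \bar R) (mg : measurable_fun [set: T] g).
Hypothesis g0 : forall x, (0 <= g x)%E.

Definition density (A : set T) : \bar R := (\int[m]_(x in A) g x)%E.

Let density0 : density set0 = 0%E.
Proof. by rewrite /density integral_set0. Qed.

Let density_ge0 A : (0 <= density A)%E.
Proof. by apply: integral_ge0 => x _; exact: g0. Qed.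

Let density_sigma_additive : semi_sigma_additive density.
Proof. exact: semi_sigma_additive_nng_induced. Qed.

HB.instance Definition _ := isMeasure.Build _ _ _ density
  density0 density_ge0 density_sigma_additive.

Lemma density_exists : exists nu : {measure set T -> \bar R},
  forall A, nu A = (\int[m]_(x in A) g x)%E.
Proof. by exists density. Qed.

End Density.

Section MeasureTools.
Local Open Scope ereal_scope.

Lemma pushforward_exists d1 d2 (T1 : measurableType d1) (T2 : measurableType d2)
    (R : realType) (m : {measure set T1 -> \bar R}) (f : T1 -> T2) :
  measurable_fun setT f -> exists nu : {measure set T2 -> \bar R},
    nu = pushforward m f :> (set T2 -> \bar R).
Proof.
move=> mf.
by exists (measure_function_pushforward__canonical__measure_function_Measure m mf).
Qed.

Lemma ge0_integral_pushforwardT d1 d2 (T1 : measurableType d1)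
    (T2 : measurableType d2) (R : realType) (m : {measure set T1 -> \bar R})
    (nu : {measure set T2 -> \bar R}) (phi : T1 -> T2) (F : T2 -> \bar R) :
  measurable_fun setT phi -> nu = pushforward m phi :> (set T2 -> \bar R) ->
  measurable_fun setT F -> (forall y, 0 <= F y) ->
  \int[nu]_y F y = \int[m]_x F (phi x).
Proof.
move=> mphi nuE mF F0.
transitivity (\int[measure_function_pushforward__canonical__measure_function_Measure m mphi]_y F y).
  by apply: eq_measure_integral => A _ _; rewrite nuE.
by rewrite ge0_integral_pushforward.
Qed.

Import HBNNSimple.

(** On indicators this is the hypothesis on [nu]; it extends to simple functions by linearity and to
    f by monotone convergence on both sides. Finiteness of g lets the limit pass through the
    product. *)
Lemma ge0_integral_density d (T : measurableType d) (R : realType)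
    (m nu : {measure set T -> \bar R}) (g f : T -> \bar R) :
  measurable_fun setT g -> (forall x, 0 <= g x) ->
  (forall x, g x \is a fin_num) ->
  (forall A, measurable A -> nu A = \int[m]_(x in A) g x) ->
  measurable_fun setT f -> (forall x, 0 <= f x) ->
  \int[nu]_x f x = \int[m]_x (f x * g x).
Proof.
move=> mg g0 gf nuE mf f0.
pose h := nnsfun_approx measurableT mf.
have hf x : (EFin \o h n) x @[n --> \oo] --> f x.
  exact: cvg_nnsfun_approx.
have hnd x : nondecreasing_seq (fun n => (h n x)).
  by move=> a b ab; exact/lefP/nd_nnsfun_approx.
have E1 : \int[nu]_x f x = lim (\int[nu]_x (h n x)%:E @[n --> \oo]).
  rewrite -(monotone_convergence nu measurableT (g' := fun n x => (h n x)%:E)).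
  - by apply: eq_integral => x _; apply/esym/cvg_lim => //; exact: hf.
  - by move=> n; apply/measurable_EFinP.
  - by move=> n x _; rewrite lee_fin.
  - by move=> x _ a b ab; rewrite lee_fin; exact: hnd.
have mhg n : measurable_fun setT (fun x => (h n x)%:E * g x).
  by apply: emeasurable_funM => //; exact/measurable_EFinP.
have E2 : \int[m]_x (f x * g x) = lim (\int[m]_x ((h n x)%:E * g x) @[n --> \oo]).
  rewrite -(monotone_convergence m measurableT (g' := fun n x => (h n x)%:E * g x)) //.
  - apply: eq_integral => x _; apply/esym/cvg_lim => //.

    by apply: cvgeZr; [exact: gf|exact: hf].
  - by move=> n x _; rewrite mule_ge0// lee_fin.
  - by move=> x _ a b ab; rewrite lee_wpmul2r// lee_fin; exact: hnd.
rewrite E1 E2; apply: congr_lim; apply/funext => n.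
transitivity (\int[nu]_x (\sum_(y \in range (h n)) (y * \1_(h n @^-1` [set y]) x)%:E)).
  by apply: eq_integral => x _; rewrite /= fimfunE -fsumEFin.
have mi r : measurable_fun setT (fun x => (r * \1_(h n @^-1` [set r]) x)%:E).
  by apply/measurable_EFinP; exact: measurable_funM.
rewrite ge0_integral_fsum//; last by move=> r x _; exact: nnfun_muleindic_ge0.
transitivity (\int[m]_x (\sum_(y \in range (h n)) (y * \1_(h n @^-1` [set y]) x)%:E * g x)); last first.
  apply: eq_integral => x _; rewrite -ge0_mule_fsuml; last by move=> y; exact: nnfun_muleindic_ge0.
  by rewrite fsumEFin // -(fimfunE _ x).
rewrite ge0_integral_fsum//; last 2 first.
  - by move=> y; apply: emeasurable_funM.
  - by move=> y x _; rewrite mule_ge0// nnfun_muleindic_ge0.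
apply: eq_fsbigr => r; rewrite inE => -[t _ rE].
have r0 : (0 <= r)%R by rewrite -rE.
under eq_integral do rewrite EFinM.
rewrite ge0_integralZl//; last by apply/measurable_EFinP.
under [RHS]eq_integral do rewrite EFinM -muleA.
rewrite ge0_integralZl//; last 2 first.
  - by apply: emeasurable_funM => //; exact/measurable_EFinP.
  - by move=> x _; rewrite mule_ge0.
congr (_ * _); rewrite integral_indic// setIT nuE//.
rewrite integral_mkcond; apply: eq_integral => x _.
by rewrite epatch_indic muleC.
Qed.

End MeasureTools.

(** * Area under affine similarities *)

Section Similarity.
Context {R : realType}.

Lemma measurable_affine (k c : R) :
  measurable_fun [set: mR R] (fun y : mR R => k * y + c : mR R).
Proof.
have : measurable_fun [set: mR R] (fun y : mR R => k * y + c : R).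
  by apply: measurable_funD => //; apply: measurable_funM.
exact.
Qed.

Lemma lebesgue_affine (k c : R) (B : set (mR R)) : k != 0 -> measurable B ->
  (lebesgue_measure ((fun y : R => k * y + c)%R @^-1` B) * (`|k|%R)%:E =
   lebesgue_measure B)%E.
Proof.
move=> k0 mB.
have mf := measurable_affine k c.
have [nu nuE] := pushforward_exists (@lebesgue_measure R) mf.
pose kn : {nonneg R} := NngNum (normr_ge0 k).
have kp : 0 < `|k| by rewrite normr_gt0.
have : lebesgue_measure B = mscale kn nu B.
  apply: lebesgue_measure_unique => // X /ocitvP[->|[[a b] /= ab ->]].
    by rewrite !measure0.
  rewrite /mscale /= nuE /pushforward lebesgue_measure_itv/= lte_fin ab.
  have [kpos|kneg] := ltP 0 k.
    have -> : (fun y => k * y + c) @^-1` `]a, b]%classic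
        = `](a - c) / k, (b - c) / k]%classic.
      apply/seteqP; split=> y; rewrite /= !in_itv/= ltr_pdivrMr// ler_pdivlMr//.
        by move=> /andP[? ?]; apply/andP; split; lra.
      by move=> /andP[? ?]; apply/andP; split; lra.
    rewrite lebesgue_measure_itv/= lte_fin ltr_pM2r ?invr_gt0// ltrD2r ab.
    by rewrite -!EFinD -EFinM gtr0_norm//; congr (_%:E); field.
  have {}kneg : k < 0 by rewrite lt_neqAle k0.
  have -> : (fun y => k * y + c) @^-1` `]a, b]%classic
        = `[(b - c) / k, (a - c) / k[%classic.
    apply/seteqP; split=> y; rewrite /= !in_itv/= ltr_ndivlMr// ler_ndivrMr//.
      by move=> /andP[? ?]; apply/andP; split; lra.
    by move=> /andP[? ?]; apply/andP; split; lra.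
  rewrite lebesgue_measure_itv/= lte_fin ltr_nM2r ?invr_lt0// ltrD2r ab.
  by rewrite -!EFinD -EFinM ltr0_norm//; congr (_%:E); field.
by move=> ->; rewrite /mscale/= nuE /pushforward muleC.
Qed.

(** On each vertical line the map is affine with slope k, so every section of the preimage is scaled
    by 1 / |k|; the product measure integrates the sections. *)
Lemma area_shear (k : R) (m : R -> R) (A : set (mplane R)) : k != 0 ->
  measurable_fun [set: mR R] (m : mR R -> R) -> measurable A ->
  (area R ((fun z => (z.1, k * z.2 + m z.1))%R @^-1` A) * (`|k|%R)%:E = area R A)%E.
Proof.
move=> k0 mm mA; rewrite /area /product_measure1.
rewrite -ge0_integralZr//; last first.
  have mM : measurable_fun [set: mplane R]
      (fun z : mplane R => (z.1, k * z.2 + m z.1) : mplane R).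
    apply: measurable_fun_pair; first exact: measurable_fst.
    have : measurable_fun [set: mplane R] (fun z : mplane R => k * z.2 + m z.1 : R).
      apply: measurable_funD; last exact: measurableT_comp.
      by apply: measurable_funM => //; exact: measurable_snd.
    exact.
  have := mM measurableT A mA; rewrite setTI => mMA.
  exact: (measurable_fun_xsection lebesgue_measure mMA).
apply: eq_integral => x _ /=.
rewrite -[RHS](@lebesgue_affine k (m x))//; last exact: measurable_xsection.
Qed.

Lemma area_swap (A : set (mplane R)) : measurable A ->
  area R ((fun z => (z.2, z.1)) @^-1` A) = area R A.
Proof.
move=> mA.
have mf : measurable_fun [set: mplane R] (fun z : mplane R => (z.2, z.1) : mplane R).
  by apply: measurable_fun_pair; [exact: measurable_snd|exact: measurable_fst].
have [nu nuE] := pushforward_exists (area R) mf.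
transitivity (nu A); first by rewrite nuE.
apply/esym; apply: (product_measure_unique (m' := nu)) => //.
move=> B C mB mC; rewrite nuE /pushforward.
have -> : (fun z => (z.2, z.1)) @^-1` (B `*` C) = C `*` B :> set (mplane R).
  by apply/seteqP; split=> -[x y] [].
exact: (eq_trans (product_measure1E lebesgue_measure lebesgue_measure mC mB) (muleC _ _)).
Qed.

(** Multiplication by the complex number p + i q followed by translation by u + i v. *)
Definition similarity (p q u v : R) (z : plane R) : plane R :=
  (p * z.1 - q * z.2 + u, q * z.1 + p * z.2 + v).

Lemma measurable_similarity p q u v : measurable_fun [set: mplane R] (similarity p q u v : mplane R -> mplane R).
Proof.
have M (a b : R) : measurable_fun [set: mplane R] (fun z : mplane R => a * z.1 + b * z.2).
  by apply: measurable_funD; apply: measurable_funM.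
apply: measurable_fun_pair; apply: measurable_funD => //.
by have := M p (- q); under eq_fun do rewrite mulNr.
Qed.

Lemma area_shear' (k : R) (m : R -> R) (A : set (mplane R)) : k != 0 ->
  measurable_fun [set: mR R] (m : mR R -> R) -> measurable A ->
  (area R ((fun z => (k * z.1 + m z.2, z.2))%R @^-1` A) * (`|k|%R)%:E = area R A)%E.
Proof.
move=> k0 mm mA.
have msw : measurable_fun [set: mplane R] (fun z : mplane R => (z.2, z.1) : mplane R).
  by apply: measurable_fun_pair; [exact: measurable_snd|exact: measurable_fst].
have mswA : measurable ((fun z => (z.2, z.1)) @^-1` A).
  by rewrite -[X in measurable X]setTI; exact: msw.
rewrite -[RHS]area_swap// -(area_shear k0 mm mswA); congr (_ * _)%E.
rewrite -[LHS]area_swap//.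
rewrite -[X in measurable X]setTI.
have mM : measurable_fun [set: mplane R] (fun z : mplane R => (k * z.1 + m z.2, z.2) : mplane R).
  apply: measurable_fun_pair; last exact: measurable_snd.
  apply: measurable_funD.
    by apply: measurable_funM => //; exact: measurable_fst.
  by apply: measurableT_comp => //; exact: measurable_snd.
exact: mM.
Qed.

(** For p nonzero the similarity is a horizontal shear followed by a vertical one. For p = 0 it is a
    swap of the coordinates followed by an affine rescaling of each. *)
Lemma area_similarity (p q u v : R) (A : set (mplane R)) :
  p ^+ 2 + q ^+ 2 != 0 -> measurable A ->
  (area R (similarity p q u v @^-1` A) * (p ^+ 2 + q ^+ 2)%:E = area R A)%E.
Proof.
move=> D0 mA; have D1 : 0 < p ^+ 2 + q ^+ 2 by rewrite lt0r D0 addr_ge0// sqr_ge0.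
have [p0|p0] := eqVneq p 0.
  have q0 : q != 0 by move: D0; rewrite p0 expr0n/= add0r sqrf_eq0.
  have m1 : measurable_fun [set: mR R] (fun _ : R => u) by [].
  have m2 : measurable_fun [set: mR R] (fun _ : R => v) by [].
  have mq0 : - q != 0 by rewrite oppr_eq0.
  have mS : measurable ((fun z : mplane R => (- q * z.1 + u, z.2)) @^-1` A).
    rewrite -[X in measurable X]setTI.
    have : measurable_fun [set: mplane R] (fun z : mplane R => (- q * z.1 + u, z.2) : mplane R).
      apply: measurable_fun_pair; last exact: measurable_snd.
      by apply: measurable_funD => //; apply: measurable_funM => //; exact: measurable_fst.
    exact.
  have mT : measurable ((fun z : mplane R => (z.1, q * z.2 + v)) @^-1`
       ((fun z : mplane R => (- q * z.1 + u, z.2)) @^-1` A)).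
    rewrite -[X in measurable X]setTI.
    have : measurable_fun [set: mplane R] (fun z : mplane R => (z.1, q * z.2 + v) : mplane R).
      apply: measurable_fun_pair; first exact: measurable_fst.
      by apply: measurable_funD => //; apply: measurable_funM => //; exact: measurable_snd.
    exact.
  rewrite -(area_shear' mq0 m1 mA) -(area_shear q0 m2 mS) -(area_swap mT).
  rewrite -muleA -EFinM normrN -normrM p0 expr0n/= add0r -expr2 ger0_norm ?sqr_ge0//.
  congr (area R _ * _)%E; apply/seteqP; split => -[x y] /=;
  by rewrite /similarity /= !mul0r add0r addr0 mulNr.
(* The vertical shear has to produce q x + p y + v from p x - q y + u and y. Solving for the
   coefficient of y gives k, and p k is the determinant. *)
pose k := (p ^+ 2 + q ^+ 2) / p.
have k0 : k != 0 by rewrite mulf_neq0// invr_neq0.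
have m1 : measurable_fun [set: mR R] (fun y : R => - q * y + u).
  exact: measurable_affine.
have m2 : measurable_fun [set: mR R] (fun x : R => q / p * x + (v - q / p * u)).
  exact: measurable_affine.
have mS : measurable ((fun z : mplane R => (z.1, k * z.2 + (q / p * z.1 + (v - q / p * u)))) @^-1` A).
  rewrite -[X in measurable X]setTI.
  have : measurable_fun [set: mplane R] (fun z : mplane R => (z.1, k * z.2 + (q / p * z.1 + (v - q / p * u))) : mplane R).
    apply: measurable_fun_pair; first exact: measurable_fst.
    apply: measurable_funD => //; first by apply: measurable_funM => //; exact: measurable_snd.
    by apply: measurable_funD => //; apply: measurable_funM => //; exact: measurable_fst.
  exact.
rewrite -(area_shear k0 m2 mA) -(area_shear' p0 m1 mS) -muleA -EFinM -normrM.
have -> : p * k = p ^+ 2 + q ^+ 2 by rewrite /k; field.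
rewrite (gtr0_norm D1); congr (area R _ * _)%E.
apply/seteqP; split => -[x y] /=; rewrite /similarity /=.
  suff -> : (p * x - q * y + u, q * x + p * y + v) =
    (p * x + (- q * y + u), k * y + (q / p * (p * x + (- q * y + u)) + (v - q / p * u))) by [].
  by congr pair; rewrite /k; field.
suff -> : (p * x - q * y + u, q * x + p * y + v) =
    (p * x + (- q * y + u), k * y + (q / p * (p * x + (- q * y + u)) + (v - q / p * u))) by [].
by congr pair; rewrite /k; field.
Qed.

End Similarity.

(** * Areas of images of small rectangles under a biholomorphic map *)

Section LocalChangeOfVariables.
Context {R : realType}.

Lemma itv_in_ball (a b c d s : R) : `|c - a| < d -> `|c - b| < d ->
  a < s <= b -> `|c - s| < d.
Proof.
rewrite !ltr_norml => /andP[? ?] /andP[? ?] /andP[? ?]; apply/andP; split; lra.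
Qed.

Lemma itv_ballD (c a w d : R) : `|c - a| < d -> `|c - (a + w)| < d -> w <= 2 * d.
Proof. by rewrite !ltr_norml => /andP[? ?] /andP[? ?]; lra. Qed.

Lemma itv_widen (a b k s m : R) : `|s - m| <= k -> a < s <= b -> a - k < m <= b + k.
Proof. by rewrite ler_norml => /andP[? ?] /andP[? ?]; apply/andP; split; lra. Qed.

Lemma itv_narrow (a b k s m : R) : `|s - m| <= k -> a + k < m <= b - k -> a < s <= b.
Proof. by rewrite ler_norml => /andP[? ?] /andP[? ?]; apply/andP; split; lra. Qed.

Lemma itv_dist (a w m s : R) : a < s <= a + w -> w <= m -> `|s - a| <= m.
Proof. by move=> /andP[? ?] ?; rewrite ler_norml; apply/andP; split; lra. Qed.

Lemma itv_dist_narrow (a w m s k : R) : 0 < k -> a + k < s <= a + w - k ->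
  w <= m -> `|s - a| <= m.
Proof. by move=> ? /andP[? ?] ?; rewrite ler_norml; apply/andP; split; lra. Qed.

Lemma rect_inflate (w l et k : R) : 0 < et <= 1 -> 0 < w -> 0 < l ->
  et * (2 * (w + l) + 4) <= k ->
  (w + 2 * et) * (l + 2 * et) <= w * l + k /\
  w * l - k <= (w - 2 * et) * (l - 2 * et).
Proof. by move=> /andP[? ?] ? ? ?; split; nra. Qed.

Lemma quarter_lt (n r : R) : 0 < n -> 4 * n <= r -> n + 2 * n < r.
Proof. by lra. Qed.

Lemma widen_le (k x y : R) : 0 < k -> 0 < y -> x - k <= x + y + k.
Proof. by lra. Qed.

Lemma narrow_le (k x y : R) : k * 2 <= y -> x + k <= x + y - k.
Proof. by lra. Qed.

Lemma similarity_inv (p q D a b : R) : D = p ^+ 2 + q ^+ 2 -> D != 0 ->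
  D^-1 * (p * (p * a - q * b) + q * (q * a + p * b)) = a /\
  D^-1 * (- q * (p * a - q * b) + p * (q * a + p * b)) = b.
Proof. by move=> -> D0; split; field. Qed.

Lemma tri_lt (a b c m n r : R) : `|a - b| <= m -> `|c - b| <= n -> m + n < r -> `|a - c| < r.
Proof.
move=> ab cb mn; rewrite -[X in `|X|](subrKA b) (le_lt_trans (ler_normD _ _))//.
by rewrite (distrC b); lra.
Qed.

Lemma measurable_pair_on (D : set (mplane R)) (f g : mplane R -> R) :
  measurable D -> measurable_fun D f -> measurable_fun D g ->
  exists h : mplane R -> mplane R, measurable_fun setT h /\
    forall z, D z -> h z = (f z, g z).
Proof.
move=> mD mf mg; exists (fun z => ((f \_ D) z, (g \_ D) z)); split.
  have mf' : measurable_fun setT ((f \_ D) : mplane R -> mR R).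
    have : measurable_fun setT (f \_ D) by apply/(measurable_restrictT _ mD).
    exact.
  have mg' : measurable_fun setT ((g \_ D) : mplane R -> mR R).
    have : measurable_fun setT (g \_ D) by apply/(measurable_restrictT _ mD).
    exact.
  exact: measurable_fun_pair.
by move=> z Dz; rewrite /patch mem_set.
Qed.

Lemma Ck_measurable k (W : set (plane R)) (h : plane R -> R) : open W -> Ck k W h ->
  measurable_fun (W : set (mplane R)) h.
Proof.
by move=> oW hW; apply: open_continuous_measurable oW (Ck_cont hW).
Qed.

Variables (U V : set (plane R)) (tau sigma : plane R -> plane R).
Hypotheses (oU : open U) (oV : open V).
Hypotheses (htau : holomorphic_on U tau) (hsigma : holomorphic_on V sigma).
Hypotheses (UV : forall z, U z -> V (tau z)) (VU : forall z, V z -> U (sigma z)).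
Hypotheses (tauK : forall z, U z -> sigma (tau z) = z)
  (sigmaK : forall z, V z -> tau (sigma z) = z).

Lemma measurable_preimage_on A : measurable (A : set (mplane R)) ->
  measurable (V `&` sigma @^-1` A : set (mplane R)).
Proof.
move=> mA; have mV := open_measurable_plane oV.
have [s1 s2 _] := hsigma.
have m1 : measurable_fun (V : set (mplane R)) (fun z => (sigma z).1).
  exact (Ck_measurable oV (s1 0%N)).
have m2 : measurable_fun (V : set (mplane R)) (fun z => (sigma z).2).
  exact (Ck_measurable oV (s2 0%N)).
have [h [mh hE]] := measurable_pair_on mV m1 m2.
have -> : V `&` sigma @^-1` A = V `&` h @^-1` A.
  by apply/seteqP; split=> z [Vz]; rewrite /= hE// -surjective_pairing.
by apply: measurableI => //; rewrite -[X in measurable X]setTI; exact: mh.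
Qed.

Lemma pullback_measure_exists : exists nu : {measure set (mplane R) -> \bar R},
  forall A, measurable A -> nu A = area R (V `&` sigma @^-1` A).
Proof.
have mV := open_measurable_plane oV.
have [s1 s2 _] := hsigma.
have m1 : measurable_fun (V : set (mplane R)) (fun z => (sigma z).1).
  exact (Ck_measurable oV (s1 0%N)).
have m2 : measurable_fun (V : set (mplane R)) (fun z => (sigma z).2).
  exact (Ck_measurable oV (s2 0%N)).
have [h [mh hE]] := measurable_pair_on mV m1 m2.
have [nu nuE] := pushforward_exists (mrestr (area R) mV) mh.
exists nu => A mA; rewrite nuE /pushforward /mrestr; congr (area R _).
apply/seteqP; split=> z [].
  by move=> + Vz; rewrite /preimage /= hE// -surjective_pairing.
by move=> Vz sA; split => //; rewrite /preimage /= hE// -surjective_pairing.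
Qed.

Lemma jacobianE (W : set (plane R)) (t : plane R -> plane R) z :
  holomorphic_on W t -> W z ->
  Defs.jacobian t z = Dx (fun z => (t z).1) z ^+ 2 + Dx (fun z => (t z).2) z ^+ 2.
Proof.
move=> [_ _ CR] Wz; have [r1 r2] := CR z Wz; rewrite /Defs.jacobian -r1 r2.
by rewrite mulNr opprK !expr2.
Qed.

(** For holomorphic maps the jacobian is the squared modulus of the complex derivative. The
    x-derivative of sigma (tau w) = w says that the two complex derivatives multiply to 1, and
    moduli are multiplicative. *)
Lemma jacobian_inverse z : U z ->
  Defs.jacobian sigma (tau z) * Defs.jacobian tau z = 1.
Proof.
move=> Uz; rewrite (jacobianE hsigma (UV Uz)) (jacobianE htau Uz).
have [ta tb tCR] := htau; have [sa sb sCR] := hsigma.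
have [r1 r2] := tCR z Uz; have [r3 r4] := sCR _ (UV Uz).
have tE w : ((tau w).1, (tau w).2) = tau w by rewrite -surjective_pairing.
have Vz : V ((tau z).1, (tau z).2) by rewrite tE; exact: UV.
have c1 := @Ck1_chain R V (fun z => (sigma z).1) _ (fun z => (tau z).1)
  (fun z => (tau z).2) z (1, 0) _ _ oV Vz (sa 1%N) (Ck_is_derive_x (ta 1%N) Uz) (Ck_is_derive_x (tb 1%N) Uz).
have c2 := @Ck1_chain R V (fun z => (sigma z).2) _ (fun z => (tau z).1)
  (fun z => (tau z).2) z (1, 0) _ _ oV Vz (sb 1%N) (Ck_is_derive_x (ta 1%N) Uz) (Ck_is_derive_x (tb 1%N) Uz).
have e1 : \forall w \near z, (sigma ((tau w).1, (tau w).2)).1 = w.1.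
  by apply: (near_open oU Uz) => w Uw; rewrite tE tauK.
have e2 : \forall w \near z, (sigma ((tau w).1, (tau w).2)).2 = w.2.
  by apply: (near_open oU Uz) => w Uw; rewrite tE tauK.
have d1 := (is_derive_DxP (near_eq_is_derive e1 c1)).2.
have d2 := (is_derive_DxP (near_eq_is_derive e2 c2)).2.
have f1 : Dx (@fst R R) z = 1 := (is_derive_DxP (is_derive_fst z (1, 0))).2.
have f2 : Dx (@snd R R) z = 0 := (is_derive_DxP (is_derive_snd z (1, 0))).2.
rewrite f1 tE r4 in d1; rewrite f2 tE -r3 in d2.
move: d1 d2.
move: (Dx _ (tau z)) (Dx _ (tau z)) (Dx _ z) (Dx _ z) => q' p' q p d1 d2.
have -> : (p' ^+ 2 + q' ^+ 2) * (p ^+ 2 + q ^+ 2) =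
  (p' * p + - q' * q) ^+ 2 + (q' * p + p' * q) ^+ 2 by ring.
by rewrite -d1 -d2 expr1n expr0n addr0.
Qed.

Lemma jacobian_gt0 z : U z -> 0 < Defs.jacobian tau z.
Proof.
move=> Uz; have := jacobian_inverse Uz; rewrite (jacobianE htau Uz).
rewrite lt0r => H; apply/andP; split; last by rewrite addr_ge0// sqr_ge0.
by apply/eqP => E; move: H; rewrite E mulr0 => /eqP; rewrite eq_sym oner_eq0.
Qed.

(** Near tau z0 the map sigma is close to an affine similarity, so the image of a small rectangle
    lies between the preimages under that similarity of a slightly smaller and a slightly larger
    rectangle. The proportions w, l are fixed and only the scale h varies, so errors are measured
    against h^2 and one d serves all positions. *)
Lemma rect_local (w l e : R) z0 : 0 < w -> 0 < l -> 0 < e -> U z0 ->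
  exists2 d, 0 < d & forall (z : plane R) h, 0 < h ->
    ball z0 d z -> ball z0 d (z.1 + w * h, z.2 + l * h) ->
    let S := rect z.1 (z.1 + w * h) z.2 (z.2 + l * h) in
    (area R (V `&` sigma @^-1` S) <=
       ((Defs.jacobian tau z0 + e) * (w * h * (l * h)))%:E)%E /\
    (((Defs.jacobian tau z0 - e) * (w * h * (l * h)))%:E <=
       area R (V `&` sigma @^-1` S))%E.
Proof.
move=> w0 l0 e0 Uz0.
have Vw0 := UV Uz0.
have [ta tb tCR] := htau; have [sa sb sCR] := hsigma.
have [r3 r4] := sCR _ Vw0.
have [K1 [d1 d10 [K10 L1]]] := Ck1_lipschitz oU Uz0 (ta 1%N).
have [K2 [d2 d20 [K20 L2]]] := Ck1_lipschitz oU Uz0 (tb 1%N).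
have jE := jacobian_inverse Uz0; rewrite (jacobianE hsigma Vw0) in jE.
have S1 := Ck1_strict oV Vw0 (sa 1%N); have S2 := Ck1_strict oV Vw0 (sb 1%N).
rewrite r4 in S1; rewrite -r3 in S2.
move: jE S1 S2.
move: (Dx _ (tau z0)) (Dx _ (tau z0)) => q p jE S1 S2.
have [D DE] : exists D, D = p ^+ 2 + q ^+ 2 by eexists.
rewrite -DE in jE.
have D0 : 0 < D.
  rewrite lt0r {2}DE addr_ge0 ?sqr_ge0// andbT; apply/eqP => E; move: jE.
  by rewrite E mul0r => /eqP; rewrite eq_sym oner_eq0.
have JE : Defs.jacobian tau z0 = D^-1.
  by apply: (mulfI (lt0r_neq0 D0)); rewrite jE mulfV// lt0r_neq0.
rewrite JE.
have [C C0 [wC lC]] : exists2 C, 0 < C & w <= C /\ l <= C.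
  by exists (w + l); [rewrite addr_gt0|split; lra].
(* [KL] bounds the inverse of multiplication by p + i q. *)
have [KL KL0 KLE] : exists2 KL, 0 <= KL & forall s t : R, forall m, `|s| <= m -> `|t| <= m ->
    `|D^-1 * (p * s + q * t)| <= KL * m /\ `|D^-1 * (- q * s + p * t)| <= KL * m.
  exists (D^-1 * (`|p| + `|q|)); first by rewrite mulr_ge0 ?addr_ge0// invr_ge0 ltW.
  move=> s t m sm tm; rewrite !normrM (gtr0_norm (_ : 0 < D^-1)) ?invr_gt0//.
  rewrite -!mulrA !ler_pM2l ?invr_gt0//; split.
    rewrite (le_trans (ler_normD _ _))// !normrM mulrDl lerD// ler_wpM2l//.
  rewrite (le_trans (ler_normD _ _))// !normrM normrN mulrDl addrC lerD// ler_wpM2l//.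
have [N N0 [NK1 NK2 NKL]] : exists2 N, 0 < N & [/\ K1 <= N, K2 <= N & KL <= N].
  by exists (K1 + K2 + KL + 1); [lra|split; lra].
(* The rectangle grows or shrinks by a collar of width et h. The last bound keeps the change of area
   at most e D w l h^2, which is e w l h^2 once the similarity has divided areas by D. *)
have [et et0 [et1 etw etl ete]] : exists2 et, 0 < et &
   [/\ et <= 1, 2 * et <= w, 2 * et <= l & et * (2 * (w + l) + 4) <= e * D * (w * l)].
  have q0 : 0 < 2 * (w + l) + 4 by lra.
  have a0 : 0 < w / 2 by lra. have b0 : 0 < l / 2 by lra.
  have c0 : 0 < e * D * (w * l) / (2 * (w + l) + 4).
    by rewrite divr_gt0// !mulr_gt0.
  have [m m0 [ma mb mc]] := min3_exists a0 b0 c0.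
  exists (Num.min 1 m); first by rewrite lt_min ltr01.
  have mm : Num.min 1 m <= m by rewrite ge_min lexx orbT.
  split; first by rewrite ge_min lexx.
  - by lra.
  - by lra.
  - by rewrite -ler_pdivlMr//; apply: le_trans mc.
(* [ep] is the accuracy asked of the derivative of sigma: over a displacement of size N C h the
   error is then at most et h. *)
have ep0 : 0 < et / (N * C) by rewrite divr_gt0// mulr_gt0.
have epE : et / (N * C) * (N * C) = et by rewrite divfK// gt_eqF// mulr_gt0.
move: (et / (N * C)) ep0 epE => ep ep0 epE.
have [d3 d30 {}S1] := S1 _ ep0; have [d4 d40 {}S2] := S2 _ ep0.
have /nbhs_ballP[d5 /= d50 B5] : nbhs (tau z0) V by exact: open_nbhs_nbhs.
have /nbhs_ballP[d6 /= d60 B6] : nbhs z0 U by exact: open_nbhs_nbhs.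
have [r r0 [r_3 r_4 r_5]] := min3_exists d30 d40 d50.
have rN : 0 < r / (4 * N) by rewrite divr_gt0// mulr_gt0.
have [d d0 [dd1 dd2]] : exists2 d, 0 < d & [/\ d <= d1, d <= d2 & d <= d6 /\ d <= r / (4 * N)].
  have [m m0 [? ? ?]] := min3_exists d10 d20 d60.
  exists (Num.min m (r / (4 * N))); first by rewrite lt_min m0.
  have mm : Num.min m (r / (4 * N)) <= m by rewrite ge_min lexx.
  split; [exact: le_trans mm _|exact: le_trans mm _|split].
    exact: le_trans mm _.
  by rewrite ge_min lexx orbT.
move=> [dd6 ddr].
have Nd : 4 * (N * d) <= r by rewrite mulrA mulrC -ler_pdivlMr// mulr_gt0.
exists d => // z h h0 bz bzh; set S := rect _ _ _ _.
have zz1 : `|z0.1 - z.1| < d := bz.1. have zz2 : `|z0.2 - z.2| < d := bz.2.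
have zh1 : `|z0.1 - (z.1 + w * h)| < d := bzh.1.
have zh2 : `|z0.2 - (z.2 + l * h)| < d := bzh.2.
have Sb y : rect z.1 (z.1 + w * h) z.2 (z.2 + l * h) y -> ball z0 d y.
  by move=> /rectP[y1 y2]; apply/ball_planeE; split; [exact: itv_in_ball y1|exact: itv_in_ball y2].
have wh0 : 0 < w * h by rewrite mulr_gt0.
have lh0 : 0 < l * h by rewrite mulr_gt0.
have whd : w * h <= 2 * d := itv_ballD zz1 zh1.
have lhd : l * h <= 2 * d := itv_ballD zz2 zh2.
pose mx := Num.max (w * h) (l * h).
have [m m0 [mw ml mC md]] : exists2 m, 0 < m & [/\ w * h <= m, l * h <= m, m <= C * h & m <= 2 * d].
  exists mx; first by rewrite lt_max wh0.
  by rewrite /mx; split; rewrite ?le_max ?ge_max ?lexx ?orbT// ?whd ?lhd// !ler_pM2r// wC lC.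
have Nm : N * m <= 2 * (N * d) by rewrite mulrCA ler_pM2l.
have epm : ep * (N * m) <= et * h.
  by rewrite -epE -!mulrA ler_pM2l// ler_pM2l// .
have Ub y : ball z0 d y -> U y by move=> /(le_ball dd6); exact: B6.
have Uz : U z by exact: Ub.
have lip y y' : ball z0 d y -> ball z0 d y' -> forall m', `|y - y'| <= m' ->
    `|(tau y).1 - (tau y').1| <= N * m' /\ `|(tau y).2 - (tau y').2| <= N * m'.
  move=> by1 by2 m' ym; split.
    apply: le_trans (L1 _ _ (le_ball dd1 by1) (le_ball dd1 by2)) _.
    by apply: ler_pM.
  apply: le_trans (L2 _ _ (le_ball dd2 by1) (le_ball dd2 by2)) _.
  by apply: ler_pM.
have tb0 y : ball z0 d y -> `|(tau z0).1 - (tau y).1| <= N * d /\ `|(tau z0).2 - (tau y).2| <= N * d.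
  move=> byy; apply: lip => //; first exact: ballxx.
  by case: byy => /ltW ? /ltW ?; rewrite prod_norm_le; apply/andP.
have [tz1 tz2] := tb0 _ bz.
have Nd0 : 0 < N * d by rewrite mulr_gt0.
have bt (x : plane R) : `|x.1 - (tau z).1| <= 2 * (N * d) -> `|x.2 - (tau z).2| <= 2 * (N * d) ->
    ball (tau z0) r x.
  have Ndr : N * d + 2 * (N * d) < r by exact: quarter_lt.
  move=> x1 x2; apply/ball_planeE.
  split; [apply: tri_lt tz1 _ Ndr; exact: x1|apply: tri_lt tz2 _ Ndr; exact: x2].
have btz : ball (tau z0) r (tau z).
  by apply: bt; rewrite subrr normr0 mulr_ge0// ltW.
set t := tau z in tz1 tz2 bt lip btz *.
have tK : sigma t = z by exact: tauK.
(* The affine map with the derivative of sigma at tau z0, normalised to send t = tau z to z. *)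
pose M := similarity p q (z.1 - (p * t.1 - q * t.2)) (z.2 - (q * t.1 + p * t.2)).
have key (x : plane R) : `|x.1 - t.1| <= N * m -> `|x.2 - t.2| <= N * m ->
   [/\ V x, `|(sigma x).1 - (M x).1| <= et * h & `|(sigma x).2 - (M x).2| <= et * h].
  move=> x1 x2.
  have bx : ball (tau z0) r x by apply: bt; [exact: le_trans Nm|exact: le_trans Nm].
  have xt : ep * `|x - t| <= et * h.
    by apply: le_trans epm; rewrite ler_pM2l// prod_norm_le x1 x2.
  split; first exact: B5 (le_ball r_5 bx).
    have := S1 _ _ (le_ball r_3 bx) (le_ball r_3 btz); rewrite tK => H.
    apply: le_trans xt; apply: le_trans H; rewrite le_eqVlt; apply/orP; left.
    by apply/eqP; congr (`|_|); rewrite /M /similarity /=; ring.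
  have := S2 _ _ (le_ball r_4 bx) (le_ball r_4 btz); rewrite tK => H.
  apply: le_trans xt; apply: le_trans H; rewrite le_eqVlt; apply/orP; left.
  by apply/eqP; congr (`|_|); rewrite /M /similarity /=; ring.
have et01 : 0 < et <= 1 by rewrite et0.
have [ri1 ri2] := rect_inflate et01 w0 l0 ete.
have eth0 : 0 < et * h by rewrite mulr_gt0.
have mM A : measurable (A : set (mplane R)) -> measurable (M @^-1` A : set (mplane R)).
  move=> mA; have := @measurable_similarity R p q (z.1 - (p * t.1 - q * t.2)) (z.2 - (q * t.1 + p * t.2)) measurableT A mA.
  by rewrite setTI.
have areaM a b c k : a <= b -> c <= k ->
    area R (M @^-1` (rect a b c k)) = ((b - a) * (k - c) * D^-1)%:E.
  move=> ab ck; have D1 : p ^+ 2 + q ^+ 2 != 0 by rewrite -DE gt_eqF.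
  have := area_similarity (z.1 - (p * t.1 - q * t.2)) (z.2 - (q * t.1 + p * t.2)) D1 (measurable_rect a b c k).
  rewrite area_rect// -DE => E.
  by rewrite (EFinM _ D^-1) -E -muleA -EFinM mulfV ?mule1// gt_eqF.
have mS : measurable (S : set (mplane R)) := measurable_rect _ _ _ _.
have wh2 : et * h * 2 <= w * h by rewrite mulrAC ler_pM2r// mulrC.
have lh2 : et * h * 2 <= l * h by rewrite mulrAC ler_pM2r// mulrC.
split.
  have sub : V `&` sigma @^-1` S `<=`
    M @^-1` rect (z.1 - et * h) (z.1 + w * h + et * h) (z.2 - et * h) (z.2 + l * h + et * h).
    move=> x [Vx]; rewrite /preimage /= => Sx; have by_ := Sb _ Sx.
    move/rectP : (Sx) => [y1 y2].
    have ym : `|sigma x - z| <= m.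
      rewrite prod_norm_le; apply/andP; split; first exact: itv_dist y1 mw.
      exact: itv_dist y2 ml.
    have [] := lip _ _ by_ bz _ ym; rewrite sigmaK// => x1 x2.
    have [_ k1 k2] := key x x1 x2.
    by apply/rectP; split; [exact: itv_widen k1 y1|exact: itv_widen k2 y2].
  apply: le_trans (le_measure (area R) _ _ sub) _; rewrite ?inE.
  - exact: measurable_preimage_on.
  - by apply: mM; exact: measurable_rect.
  rewrite [X in (X <= _)%E](areaM _ _ _ _ (widen_le _ eth0 wh0) (widen_le _ eth0 lh0)); rewrite lee_fin ler_pdivrMr//.
  have -> : (D^-1 + e) * (w * h * (l * h)) * D = (w * l + e * D * (w * l)) * (h * h).
    by field; rewrite gt_eqF.
  have -> : (z.1 + w * h + et * h - (z.1 - et * h)) * (z.2 + l * h + et * h - (z.2 - et * h))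
     = ((w + 2 * et) * (l + 2 * et)) * (h * h) by ring.
  by rewrite ler_pM2r ?mulr_gt0.
(* Here a point is located first, through the inverse of the linear part; only then does [key] apply
   to it and place it in V. *)
have sub : M @^-1` rect (z.1 + et * h) (z.1 + w * h - et * h) (z.2 + et * h) (z.2 + l * h - et * h)
    `<=` V `&` sigma @^-1` S.
  move=> x /rectP[y1 y2].
  have s1 : `|p * (x.1 - t.1) - q * (x.2 - t.2)| <= m.
    have -> : p * (x.1 - t.1) - q * (x.2 - t.2) = (M x).1 - z.1 by rewrite /M /similarity /=; ring.
    exact: itv_dist_narrow eth0 y1 mw.
  have s2 : `|q * (x.1 - t.1) + p * (x.2 - t.2)| <= m.
    have -> : q * (x.1 - t.1) + p * (x.2 - t.2) = (M x).2 - z.2 by rewrite /M /similarity /=; ring.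
    exact: itv_dist_narrow eth0 y2 ml.
  have [] := KLE _ _ _ s1 s2.
  have -> : D^-1 * (p * (p * (x.1 - t.1) - q * (x.2 - t.2)) + q * (q * (x.1 - t.1) + p * (x.2 - t.2))) = x.1 - t.1.
    exact: (similarity_inv _ _ DE (lt0r_neq0 D0)).1.
  have -> : D^-1 * (- q * (p * (x.1 - t.1) - q * (x.2 - t.2)) + p * (q * (x.1 - t.1) + p * (x.2 - t.2))) = x.2 - t.2.
    exact: (similarity_inv _ _ DE (lt0r_neq0 D0)).2.
  move=> x1 x2.
  have KN : KL * m <= N * m by rewrite ler_pM2r.
  have [Vx k1 k2] := key x (le_trans x1 KN) (le_trans x2 KN); split => //.
  by apply/rectP; split; [exact: itv_narrow k1 y1|exact: itv_narrow k2 y2].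
apply: le_trans (le_measure (area R) _ _ sub); rewrite ?inE; last 2 first.
- by apply: mM; exact: measurable_rect.
- exact: measurable_preimage_on.
rewrite [X in (_ <= X)%E](areaM _ _ _ _ (narrow_le _ wh2) (narrow_le _ lh2)); rewrite lee_fin ler_pdivlMr//.
have -> : (D^-1 - e) * (w * h * (l * h)) * D = (w * l - e * D * (w * l)) * (h * h).
  by field; rewrite gt_eqF.
have -> : (z.1 + w * h - et * h - (z.1 + et * h)) * (z.2 + l * h - et * h - (z.2 + et * h))
   = ((w - 2 * et) * (l - 2 * et)) * (h * h) by ring.
by rewrite ler_pM2r ?mulr_gt0.
Qed.

End LocalChangeOfVariables.

(** * Subdivision of rectangles *)

Section RectAdditivity.
Context {R : realType}.

Lemma compact_boxc (a b c d : R) : compact (boxc a b c d).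
Proof. by apply: compact_setX; exact: segment_compact. Qed.

Lemma rect_empty (a b c d : R) : (b <= a) || (d <= c) -> rect a b c d = set0.
Proof.
move=> H; apply/seteqP; split=> // z /rectP[/andP[? ?] /andP[? ?]].
by case/orP: H => ?; lra.
Qed.

Lemma rect_splitx (m : {measure set (mplane R) -> \bar R}) (a b k c d : R) :
  a <= k <= b -> m (rect a b c d) = (m (rect a k c d) + m (rect k b c d))%E.
Proof.
move=> /andP[ak kb]; rewrite -measureU; first last.
- apply/seteqP; split=> // z [/rectP[/andP[? ?] _] /rectP[/andP[? ?] _]]; lra.
- exact: measurable_rect.
- exact: measurable_rect.
congr (m _); apply/seteqP; split=> z.
  move=> /rectP[/andP[? ?] ?]; have [?|?] := leP z.1 k; [left|right];
  by apply/rectP; split => //; apply/andP; split.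
by move=> [/rectP[/andP[? ?] ?]|/rectP[/andP[? ?] ?]]; apply/rectP; split => //;
  apply/andP; split; lra.
Qed.

Lemma rect_splity (m : {measure set (mplane R) -> \bar R}) (a b c k d : R) :
  c <= k <= d -> m (rect a b c d) = (m (rect a b c k) + m (rect a b k d))%E.
Proof.
move=> /andP[ak kb]; rewrite -measureU; first last.
- apply/seteqP; split=> // z [/rectP[_ /andP[? ?]] /rectP[_ /andP[? ?]]]; lra.
- exact: measurable_rect.
- exact: measurable_rect.
congr (m _); apply/seteqP; split=> z.
  move=> /rectP[? /andP[? ?]]; have [?|?] := leP z.2 k; [left|right];
  by apply/rectP; split => //; apply/andP; split.
by move=> [/rectP[? /andP[? ?]]|/rectP[? /andP[? ?]]]; apply/rectP; split => //;
  apply/andP; split; lra.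
Qed.

Definition cell (w l : R) (z : plane R) (h : R) : set (plane R) :=
  rect z.1 (z.1 + w * h) z.2 (z.2 + l * h).

Lemma cell_split4 (m : {measure set (mplane R) -> \bar R}) (w l h : R) z :
  0 <= w -> 0 <= l -> 0 <= h ->
  m (cell w l z (2 * h)%R) =
  (m (cell w l z h) + m (cell w l (z.1, z.2 + l * h)%R h) +
   (m (cell w l (z.1 + w * h, z.2)%R h) + m (cell w l (z.1 + w * h, z.2 + l * h)%R h)))%E.
Proof.
move=> w0 l0 h0; have wh : 0 <= w * h by rewrite mulr_ge0.
have lh : 0 <= l * h by rewrite mulr_ge0.
have w2 : z.1 + w * (2 * h) = z.1 + w * h + w * h by ring.
have l2 : z.2 + l * (2 * h) = z.2 + l * h + l * h by ring.
rewrite /cell /= w2 l2 (@rect_splitx m z.1 _ (z.1 + w * h)); last first.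
  by apply/andP; split; lra.
by congr adde; apply: rect_splity; apply/andP; split; lra.
Qed.

Lemma lerDl' (x y : R) : 0 <= y -> x <= x + y.
Proof. by rewrite lerDl. Qed.

(** Both sides are additive over the four quarters of a cell, so the inequality passes from all
    cells of the n-th dyadic subdivision to the whole. Only subcells of the given cell are
    quantified over, as the comparison is available only inside it. *)
Lemma cell_bisect (m1 m2 m3 : {measure set (mplane R) -> \bar R}) (k : {nonneg R}) (w l : R) :
  0 <= w -> 0 <= l ->
  forall n h z, 0 <= h ->
  (forall z' : plane R, z.1 <= z'.1 -> z'.1 + w * (h / 2 ^+ n) <= z.1 + w * h ->
     z.2 <= z'.2 -> z'.2 + l * (h / 2 ^+ n) <= z.2 + l * h ->
     (m1 (cell w l z' (h / 2 ^+ n)) <=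
      m2 (cell w l z' (h / 2 ^+ n)) + k%:num%:E * m3 (cell w l z' (h / 2 ^+ n)))%E) ->
  (m1 (cell w l z h) <= m2 (cell w l z h) + k%:num%:E * m3 (cell w l z h))%E.
Proof.
move=> w0 l0; elim=> [|n IH] h z h0 H.
  by have := H z; rewrite expr0 divr1 => /(_ (lexx _) (lexx _) (lexx _) (lexx _)).
have h2 : h / 2 ^+ n.+1 = h / 2 / 2 ^+ n by rewrite exprS invfM mulrA.
have [r rE] : exists r, r = h / 2 by eexists.
have hh : h = 2 * r by rewrite rE; field.
have hh0 : 0 <= r by rewrite rE divr_ge0.
rewrite h2 -rE in H.
have wh : 0 <= w * r by rewrite mulr_ge0.
have lh : 0 <= l * r by rewrite mulr_ge0.
have whE : w * h = w * r + w * r by rewrite hh; ring.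
have lhE : l * h = l * r + l * r by rewrite hh; ring.
have {}IH z' : z.1 <= z'.1 -> z'.1 <= z.1 + w * r ->
    z.2 <= z'.2 -> z'.2 <= z.2 + l * r ->
   (m1 (cell w l z' r) <=
      m2 (cell w l z' r) + k%:num%:E * m3 (cell w l z' r))%E.
  move=> a1 a2 a3 a4; apply: IH => // y b1 b2 b3 b4; apply: H.
  - exact: le_trans a1 b1.
  - by apply: le_trans b2 _; rewrite whE addrA lerD2r.
  - exact: le_trans a3 b3.
  - by apply: le_trans b4 _; rewrite lhE addrA lerD2r.
rewrite hh !cell_split4//; clear H rE h2 whE lhE.
set A := cell w l z _; set B := cell w l (z.1, _) _.
set C := cell w l (_, z.2) _; set D := cell w l (z.1 + _, _) _.
have HA := IH z (lexx _) (lerDl' _ wh) (lexx _) (lerDl' _ lh).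
have HB := IH (z.1, z.2 + l * r) (lexx _) (lerDl' _ wh) (lerDl' _ lh) (lexx _).
have HC := IH (z.1 + w * r, z.2) (lerDl' _ wh) (lexx _) (lexx _) (lerDl' _ lh).
have HD := IH (z.1 + w * r, z.2 + l * r) (lerDl' _ wh) (lexx _) (lerDl' _ lh) (lexx _).
rewrite -/A in HA; rewrite -/B in HB; rewrite -/C in HC; rewrite -/D in HD.
apply: le_trans (leeD (leeD HA HB) (leeD HC HD)) _.
rewrite le_eqVlt; apply/orP; left; apply/eqP.
rewrite !ge0_muleDr ?adde_ge0//.
rewrite (addeACA (m2 A) _ (m2 B)) (addeACA (m2 C) _ (m2 D)) (addeACA (m2 A + m2 B)%E).
done.
Qed.

End RectAdditivity.

(** * From rectangles to all measurable functions *)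

Section ChangeOfVariables.
Context {R : realType}.
Variables (U V : set (plane R)) (tau sigma : plane R -> plane R).
Hypotheses (oU : open U) (oV : open V).
Hypotheses (htau : holomorphic_on U tau) (hsigma : holomorphic_on V sigma).
Hypotheses (UV : forall z, U z -> V (tau z)) (VU : forall z, V z -> U (sigma z)).
Hypotheses (tauK : forall z, U z -> sigma (tau z) = z)
  (sigmaK : forall z, V z -> tau (sigma z) = z).

Let J (z : plane R) : R := Defs.jacobian tau z.

Lemma Ck_jacobian k : Ck k U (Defs.jacobian tau).
Proof.
have [ta tb _] := htau.
exact (CkB oU (CkM oU (Ck_Dx (ta k.+1)) (Ck_Dy (tb k.+1)))
   (CkM oU (Ck_Dy (ta k.+1)) (Ck_Dx (tb k.+1)))).
Qed.

Let g (z : mplane R) : \bar R := ((J \_ U) z)%:E.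

Let mg : measurable_fun [set: mplane R] g.
Proof.
apply/measurable_EFinP; apply/(measurable_restrictT _ (open_measurable_plane oU)).
exact (Ck_measurable oU (Ck_jacobian 0)).
Qed.

Let gU z : U z -> g z = (J z)%:E.
Proof. by move=> Uz; rewrite /g /patch mem_set. Qed.

Let g0 z : (0 <= g z)%E.
Proof.
rewrite /g lee_fin /patch; case: ifPn => // /set_mem Uz.
exact: ltW (jacobian_gt0 oU oV htau hsigma UV tauK Uz).
Qed.

Section Measures.
Variables (nu mu : {measure set (mplane R) -> \bar R}).
Hypothesis nuE : forall A, measurable A -> nu A = area R (V `&` sigma @^-1` A).
Hypothesis muE : forall A, mu A = (\int[area R]_(z in A) g z)%E.

Lemma mu_rect_bounds a b c d m M : a <= b -> c <= d ->
  (forall z, rect a b c d z -> U z /\ m <= J z <= M) ->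
  ((m * ((b - a) * (d - c)))%:E <= mu (rect a b c d))%E /\
  (mu (rect a b c d) <= (M * ((b - a) * (d - c)))%:E)%E.
Proof.
move=> ab cd H; have mS := @measurable_rect R a b c d.
rewrite muE; split.
  have [m0|m0] := leP m 0.
    apply: (@le_trans _ _ 0%E); last by apply: integral_ge0.
    by rewrite lee_fin mulr_le0_ge0// mulr_ge0// subr_ge0.
  rewrite EFinM -area_rect// -integral_cst//; apply: ge0_le_integral => //.
  - by move=> z _; rewrite /cst lee_fin ltW.
  - exact: measurable_funTS.
  - by move=> z /H[Uz /andP[h1 _]]; rewrite /cst gU// lee_fin.
rewrite EFinM -area_rect// -integral_cst//; apply: ge0_le_integral => //.
- exact: measurable_funTS.
- by move=> z /H[Uz /andP[_ h1]]; rewrite /cst gU// lee_fin.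
Qed.

(** Half of e pays for [rect_local], the other half for the oscillation of the jacobian over the
    cell. *)
Lemma local_comparison (w l e : R) z0 : 0 < w -> 0 < l -> 0 < e -> U z0 ->
  exists2 d, 0 < d & forall (z : plane R) h, 0 < h ->
    ball z0 d z -> ball z0 d (z.1 + w * h, z.2 + l * h) ->
    (nu (cell w l z h) <= mu (cell w l z h) + e%:E * area R (cell w l z h))%E /\
    (mu (cell w l z h) <= nu (cell w l z h) + e%:E * area R (cell w l z h))%E.
Proof.
move=> w0 l0 e0 Uz0; have e20 : 0 < e / 2 by rewrite divr_gt0.
have [d1 d10 H1] := rect_local oU oV htau hsigma UV tauK sigmaK w0 l0 e20 Uz0.
have /cvgrPdist_le/(_ _ e20) : {for z0, continuous J} by exact: (Ck_cont (Ck_jacobian 0)).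
move=> /nbhs_ballP[d2 /= d20 H2].
have /nbhs_ballP[d3 /= d30 H3] : nbhs z0 U by exact: open_nbhs_nbhs.
have [d d0 [dd1 dd2 dd3]] := min3_exists d10 d20 d30.
exists d => // z h h0 bz bzh.
have zz1 : `|z0.1 - z.1| < d := bz.1. have zz2 : `|z0.2 - z.2| < d := bz.2.
have zh1 : `|z0.1 - (z.1 + w * h)| < d := bzh.1.
have zh2 : `|z0.2 - (z.2 + l * h)| < d := bzh.2.
have wh : z.1 <= z.1 + w * h by rewrite lerDl mulr_ge0// ltW.
have lh : z.2 <= z.2 + l * h by rewrite lerDl mulr_ge0// ltW.
have [n1 n2] := H1 z h h0 (le_ball dd1 bz) (le_ball dd1 bzh).
have Sb y : cell w l z h y -> U y /\ J z0 - e / 2 <= J y <= J z0 + e / 2.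
  move=> /rectP[y1 y2]; have by_ : ball z0 d y.
    by apply/ball_planeE; split; [exact: itv_in_ball y1|exact: itv_in_ball y2].
  split; first exact: H3 (le_ball dd3 by_).
  have := H2 _ (le_ball dd2 by_); rewrite /= distrC ler_norml => /andP[? ?].
  by apply/andP; split; lra.
have [m1 m2] := mu_rect_bounds wh lh Sb.
rewrite nuE; last exact: measurable_rect.
have aE : area R (cell w l z h) = (w * h * (l * h))%:E.
  by rewrite /cell area_rect//; congr (_%:E); ring.
rewrite aE -EFinM.
have cE : (z.1 + w * h - z.1) * (z.2 + l * h - z.2) = w * h * (l * h) by ring.
rewrite cE in m1 m2.
set a := w * h * (l * h) in m1 m2 n1 n2 *.
have E1 : (J z0 + e / 2) * a = (J z0 - e / 2) * a + e * a by field.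
split.
  apply: le_trans n1 _; rewrite -/(J z0) E1 EFinD.
  exact: leeD.
apply: le_trans m2 _; rewrite E1 EFinD.
exact: leeD.
Qed.

(** Compactness of the closed box gives one dyadic scale at which the local comparison holds at
    every position; [cell_bisect] adds the subcells up, and e is arbitrary. *)
Lemma cell_comparison (w l : R) z : 0 < w -> 0 < l ->
  boxc z.1 (z.1 + w) z.2 (z.2 + l) `<=` U ->
  nu (cell w l z 1) = mu (cell w l z 1).
Proof.
move=> w0 l0 KU.
have aE : area R (cell w l z 1) = (w * l)%:E.
  rewrite /cell !mulr1 area_rect ?lerDl ?(ltW w0) ?(ltW l0)//.
  by congr (_%:E); ring.
suff H e : 0 < e ->
    (nu (cell w l z 1) <= mu (cell w l z 1) + e%:E * area R (cell w l z 1))%E /\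
    (mu (cell w l z 1) <= nu (cell w l z 1) + e%:E * area R (cell w l z 1))%E.
  have wl0 : 0 < w * l by rewrite mulr_gt0.
  apply/eqP; rewrite eq_le; apply/andP; split; apply/lee_addgt0Pr => e e0;
  have ewl : 0 < e / (w * l) by rewrite divr_gt0.
    by have := (H _ ewl).1; rewrite aE -EFinM divfK// gt_eqF.
  by have := (H _ ewl).2; rewrite aE -EFinM divfK// gt_eqF.
move=> e0.
have cK := @compact_boxc R z.1 (z.1 + w) z.2 (z.2 + l).
pose P (n : nat) (y : plane R) := 
    (nu (cell w l y (1 / 2 ^+ n)) <= mu (cell w l y (1 / 2 ^+ n)) + e%:E * area R (cell w l y (1 / 2 ^+ n)))%E /\
    (mu (cell w l y (1 / 2 ^+ n)) <= nu (cell w l y (1 / 2 ^+ n)) + e%:E * area R (cell w l y (1 / 2 ^+ n)))%E.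
have [N _ HN] : \forall n \near \oo, boxc z.1 (z.1 + w) z.2 (z.2 + l) `<=` P n.
  have /compact_near_coveringP := cK; apply => z0 Kz0.
  have [d d0 Hd] := local_comparison w0 l0 e0 (KU _ Kz0).
  have dh : 0 < d / 2 by rewrite divr_gt0.
  have wld : 0 < d / 2 / (w + l) by rewrite divr_gt0// addr_gt0.
  (* Half of d locates the lower left corner; the scale, small against w + l, keeps the opposite
     corner within the other half. *)
  exists (ball z0 (d / 2), [set n : nat | 1 / 2 ^+ n < d / 2 / (w + l)]).
    split; first exact: nbhsx_ballx.
    have := @cvg_geometric R 1 (1 / 2); rewrite ger0_norm// => /(_ _)/cvgrPdist_lt.
    move=> /(_ _ _ wld) []; first by lra.
    move=> N _ H; exists N => // n Nn; have := H n Nn.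
    rewrite /= sub0r normrN /geometric /= !mul1r exprVn.
    by rewrite ger0_norm// invr_ge0 exprn_ge0.
  move=> [y n] [/= by_ ny]; apply: Hd; first by rewrite divr_gt0// exprn_gt0.
    by apply: le_ball by_; rewrite ler_pdivrMr// ler_pMr// ler1n.
  move: ny; rewrite ltr_pdivlMr ?addr_gt0//.
  have : 0 < 1 / 2 ^+ n :> R by rewrite divr_gt0// exprn_gt0.
  move: (1 / 2 ^+ n) => h h0; rewrite mulrDr => hd.
  have : 0 < h * w by rewrite mulr_gt0.
  have : 0 < h * l by rewrite mulr_gt0.
  move: by_ => [/=]; rewrite /ball/= !ltr_norml => /andP[? ?] /andP[? ?] ? ?.
  by apply/ball_planeE; rewrite /= !ltr_norml; split; apply/andP; split; lra.
have HP := HN N (leqnn N).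
have bx (y : plane R) : z.1 <= y.1 -> y.1 + w * (1 / 2 ^+ N) <= z.1 + w * 1 ->
    z.2 <= y.2 -> y.2 + l * (1 / 2 ^+ N) <= z.2 + l * 1 ->
    boxc z.1 (z.1 + w) z.2 (z.2 + l) y.
  have : 0 < 1 / 2 ^+ N :> R by rewrite divr_gt0// exprn_gt0.
  move: (1 / 2 ^+ N) => h h0 ? + ? +; rewrite !mulr1.
  have : 0 < w * h by rewrite mulr_gt0.
  have : 0 < l * h by rewrite mulr_gt0.
  by move=> *; apply/boxcP; split; apply/andP; split; lra.
split.
  apply: (@cell_bisect R nu mu (area R) (NngNum (ltW e0)) w l (ltW w0) (ltW l0) N) => //.
  by move=> y y1 y2 y3 y4; exact: (HP y (bx y y1 y2 y3 y4)).1.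
apply: (@cell_bisect R mu nu (area R) (NngNum (ltW e0)) w l (ltW w0) (ltW l0) N) => //.
by move=> y y1 y2 y3 y4; exact: (HP y (bx y y1 y2 y3 y4)).2.
Qed.

Lemma rect_comparison a b c d : boxc a b c d `<=` U ->
  nu (rect a b c d) = mu (rect a b c d).
Proof.
move=> KU; have [ba|ab] := leP b a; first by rewrite rect_empty ?ba// !measure0.
have [dc|cd] := leP d c; first by rewrite rect_empty ?dc ?orbT// !measure0.
have := @cell_comparison (b - a) (d - c) (a, c); rewrite /cell /= !mulr1 !subrKC.
by apply => //; rewrite subr_gt0.
Qed.

Lemma mu_rect_fin a b c d : boxc a b c d `<=` U -> (mu (rect a b c d) < +oo)%E.
Proof.
move=> KU; have [ba|ab] := leP b a; first by rewrite rect_empty ?ba// !measure0.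
have [dc|cd] := leP d c; first by rewrite rect_empty ?dc ?orbT// !measure0.
have [k _ Hk] : exists2 k, k \in boxc a b c d & forall t, t \in boxc a b c d -> J t <= J k.
  apply: compact_EVT_max.
  - by exists (a, c); apply/boxcP; rewrite /= !lexx !ltW.
  - exact: compact_boxc.
  - apply: continuous_in_subspaceT => z /set_mem Kz.
    exact: (Ck_cont (Ck_jacobian 0)) (KU _ Kz).
have [|_ H] := @mu_rect_bounds a b c d 0 (J k) (ltW ab) (ltW cd).
  move=> z /rect_boxc Kz; have Uz := KU _ Kz; split => //; apply/andP; split.
    exact: ltW (jacobian_gt0 oU oV htau hsigma UV tauK Uz).
  by apply: Hk; rewrite inE.
by apply: le_lt_trans H _; rewrite ltry.
Qed.

(** Rectangles are stable under intersection and generate the measurable sets, so two measures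
    agreeing on them, finite on this piece, agree on its measurable subsets. *)
Lemma nrect_comparison n (A : set (mplane R)) : measurable A ->
  nu (nrect U n `&` A) = mu (nrect U n `&` A).
Proof.
move=> mA; have [->|[a [b [c [d [KU ->]]]]]] := nrect_cases U n.
  by rewrite set0I !measure0.
have mQ := @measurable_rect R a b c d.
suff : mrestr nu mQ A = mrestr mu mQ A by rewrite /mrestr setIC.
apply: (@measure_unique _ R (mplane R) rects (fun k => rect (- k%:R) k%:R (- k%:R) k%:R)
  measurable_rectsE (@rects_setI R)) => //.
- by move=> k; do 4!eexists.
- apply/seteqP; split=> // z _.
  exists (Num.Def.archi_bound (`|z.1| + `|z.2|)) => //.
  have : `|z.1| + `|z.2| < (Num.Def.archi_bound (`|z.1| + `|z.2|))%:R.
    by apply: archi_boundP; rewrite addr_ge0.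
  move: (_%:R) => k Hk; have H1 : `|z.1| < k by apply: le_lt_trans Hk; rewrite lerDl.
  have H2 : `|z.2| < k by apply: le_lt_trans Hk; rewrite lerDr.
  move: H1 H2; rewrite !ltr_norml => /andP[? ?] /andP[? ?].
  by apply/rectP; split; apply/andP; split => //; exact: ltW.
- move=> _ [a' [b' [c' [d' ->]]]].
  rewrite /= /mrestr.
  have -> : rect a' b' c' d' `&` rect a b c d =
      rect (Num.max a' a) (Num.min b' b) (Num.max c' c) (Num.min d' d).
    apply/seteqP; split=> z.
      move=> [/rectP[/andP[? ?] /andP[? ?]] /rectP[/andP[? ?] /andP[? ?]]].
      apply/rectP; rewrite !gt_max !le_min; split; repeat (apply/andP; split) => //.
    move=> /rectP[/andP[]]; rewrite !gt_max !le_min.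
    move=> /andP[? ?] /andP[? ?] /andP[/andP[? ?] /andP[? ?]].
    by split; apply/rectP; split; apply/andP; split.
  apply: rect_comparison => z /boxcP[]; rewrite !ge_max !le_min.
  move=> /andP[/andP[? ?] /andP[? ?]] /andP[/andP[? ?] /andP[? ?]].
  by apply: KU; apply/boxcP; split; apply/andP; split.
- move=> k; rewrite /mrestr; apply: (@le_lt_trans _ _ (nu (rect a b c d))).
    rewrite /= /mrestr; apply: le_measure; rewrite ?inE;
    [apply: measurableI; exact: measurable_rect|exact: measurable_rect|exact: subIsetr].
  by rewrite rect_comparison// mu_rect_fin.
Qed.

(** The plane is covered by the countably many rectangles of U, where the measures agree, and by the
    complement of U (index 0), which is null for both: the density vanishes there and sigma takes
    its values on V in U. *)
Lemma pullback_measureE (A : set (mplane R)) : measurable A -> nu A = mu A.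
Proof.
move=> mA; have mU := open_measurable_plane oU.
apply: (@g_sigma_algebra_measure_unique_cover _ R (mplane R) (@measurable _ (mplane R))
  _ (fun n => if n is n'.+1 then nrect U n' else ~` U)) => //.
- by case=> [|n]; [exact: measurableC|exact: measurable_nrect].
- apply/seteqP; split=> // z _; have [Uz|nUz] := pselect (U z); last by exists 0%N.
  by move: Uz; rewrite {1}(bigcup_nrect oU) => -[n _ nz]; exists n.+1.
- move=> n B sB; have {sB} mB : measurable B.
    by apply: sB => //; split => //; exact: sigma_algebra_measurable.
  case: n => [|n]; last exact: nrect_comparison.
  have -> : mu (~` U `&` B) = 0%E.
    rewrite muE; apply: integral0_eq => z [nUz _].
    by rewrite /g /patch memNset.
  rewrite nuE; last by apply: measurableI => //; exact: measurableC.
  rewrite [X in area R X](_ : _ = set0) ?measure0//.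
  by apply/seteqP; split=> // z [Vz []]; have := VU Vz.
- exact: sub_sigma_algebra.
Qed.

End Measures.

(** The left side integrates G o tau against the measure with the jacobian as density, hence against
    the image under sigma of area on V. Pulling back along sigma leaves G (tau (sigma z)) = G z. *)
Theorem change_of_variables (G : mplane R -> \bar R) :
  measurable_fun (V : set (mplane R)) G -> (forall z, V z -> (0 <= G z)%E) ->
  (\int[area R]_(z in U) (G (tau z) * (Defs.jacobian tau z)%:E) =
   \int[area R]_(z in V) G z)%E.
Proof.
move=> mG G0.
have mU := open_measurable_plane oU; have mV := open_measurable_plane oV.
have [nu nuE] := pullback_measure_exists oV hsigma.
have [mu muE] := density_exists (area R) mg g0.
have numu := pullback_measureE nuE muE.
have mV' := mV.
(* [h] and [h'] are measurable on the whole plane and stand in for sigma and tau, as image measures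
   are formed for total maps. *)
have [h [mh hE]] : exists h : mplane R -> mplane R, measurable_fun setT h /\
    forall z, V z -> h z = sigma z.
  have [s1 s2 _] := hsigma.
  have [h [mh hE]] := measurable_pair_on mV (Ck_measurable oV (s1 0%N)) (Ck_measurable oV (s2 0%N)).
  by exists h; split => // z Vz; rewrite hE// -surjective_pairing.
have [h' [mh' hE']] : exists h : mplane R -> mplane R, measurable_fun setT h /\
    forall z, U z -> h z = tau z.
  have [s1 s2 _] := htau.
  have [h'' [mh'' hE'']] := measurable_pair_on mU (Ck_measurable oU (s1 0%N)) (Ck_measurable oU (s2 0%N)).
  by exists h''; split => // z Uz; rewrite hE''// -surjective_pairing.
have [push pushE] := pushforward_exists (mrestr (area R) mV) mh.
pose GV := G \_ V.
have mGV : measurable_fun setT GV by apply/(measurable_restrictT _ mV).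
have GV0 z : (0 <= GV z)%E.
  by rewrite /GV /patch; case: ifPn => // /set_mem; exact: G0.
have mF : measurable_fun [set: mplane R] (fun z => GV (h' z)).
  exact: measurableT_comp.
transitivity (\int[area R]_z (GV (h' z) * g z))%E.
  rewrite integral_mkcond; apply: eq_integral => z _; rewrite /patch.
  case: ifPn => [/set_mem Uz|/negP nUz].
    by rewrite gU// hE'// /GV /patch mem_set//; exact: UV.
  by rewrite /g /patch memNset ?mule0// => Uz; apply: nUz; rewrite inE.
rewrite -(@ge0_integral_density _ _ _ (area R) mu g)//.
transitivity (\int[push]_z (GV (h' z)))%E.
  apply: eq_measure_integral => A mA _; rewrite -numu// nuE// pushE /pushforward /mrestr.
  congr (area R _); apply/seteqP; split=> z.
    by move=> [Vz]; rewrite /preimage /= => sA; split => //; rewrite /preimage /= hE.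
  by move=> [+ Vz]; rewrite /preimage /= hE.
transitivity (\int[mrestr (area R) mV]_z GV (h' (h z)))%E.
  exact (ge0_integral_pushforwardT mh pushE mF (fun y => GV0 _)).
transitivity (\int[area R]_z (GV (h' (h z)) * (\1_V z)%:E))%E.
  apply: ge0_integral_density.
  - by apply/measurable_EFinP; exact: measurable_indic.
  - by move=> z; rewrite lee_fin.
  - by move=> z; rewrite fin_numE.
  - move=> A mA; rewrite integral_indic// /mrestr setIC; reflexivity.
  - exact: (measurableT_comp mF mh).
  - by move=> z; exact: GV0.
rewrite [RHS]integral_mkcond; apply: eq_integral => z _.
rewrite /patch indicE; case: (boolP (z \in V)) => [/set_mem|] Vz; last by rewrite mule0.
rewrite mule1.
by rewrite /= hE// hE' ?sigmaK// /GV /patch ?mem_set//; exact: VU.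
Qed.

End ChangeOfVariables.

(** * Green's formula in the plane *)

Section CompactSupport.
Context {R : realType}.
Implicit Types (U K : set (plane R)).

Lemma integral_derivative_compact (F f : R -> R) (M : R) : 0 <= M ->
  (forall s : R, is_derive s 1 F (f s)) -> continuous f ->
  (forall s : R, M < `|s| -> F s = 0) -> (forall s : R, M < `|s| -> f s = 0) ->
  (\int[@lebesgue_measure R]_s (f s)%:E = 0)%E.
Proof.
move=> M0 dF cf F0 f0.
have ab : - (M + 1) < M + 1 by lra.
have cF s : {for s, continuous F}.
  by apply/differentiable_continuous/derivable1_diffP; have [] := dF s.
transitivity (\int[@lebesgue_measure R]_(s in `[(- (M + 1))%R, (M + 1)%R]) (f s)%:E)%E.
  rewrite [RHS]integral_mkcond; apply: eq_integral => s _; rewrite /patch.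
  case: ifPn => // /negP sM; rewrite f0//.
  rewrite ltNge; apply/negP => sM'; apply: sM; rewrite inE /= in_itv/=.
  by move: sM'; rewrite ler_norml => /andP[? ?]; apply/andP; split; lra.
rewrite (@continuous_FTC2 _ f F)//.
- rewrite !F0 ?subee//.
  + by rewrite normrN ger0_norm; lra.
  + by rewrite ger0_norm; lra.
- exact: continuous_subspaceT.
- split.
  + by move=> s _; have [] := dF s.
  + exact: cvg_at_right_filter (cF _).
  + exact: cvg_at_left_filter (cF _).
- by move=> s _; rewrite derive1E; have [] := dF s.
Qed.

Lemma measurable_continuous_plane (h : plane R -> R) : continuous h ->
  measurable_fun [set: mplane R] h.
Proof. by move=> ch; apply: (open_continuous_measurable openT) => z _; exact: ch. Qed.

Lemma continuous_boxc_bounded (h : plane R -> R) a b c d :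
  (forall z, boxc a b c d z -> {for z, continuous h}) ->
  exists M, forall z, boxc a b c d z -> `|h z| <= M.
Proof.
move=> ch; have [[z0 Kz0]|nK] := pselect (boxc a b c d !=set0); last first.
  by exists 0 => z Kz; case: nK; exists z.
have [k _ Hk] : exists2 k, k \in boxc a b c d & forall t, t \in boxc a b c d -> `|h t| <= `|h k|.
  apply: (compact_EVT_max (f := fun z => `|h z|)); first by exists z0.
    exact: compact_boxc.
  apply: continuous_in_subspaceT => z /set_mem Kz.
  by apply: continuous_comp (ch z Kz) _; exact: norm_continuous.
by exists `|h k| => z Kz; apply: Hk; rewrite inE.
Qed.

Lemma integrable_compact_support (h : plane R -> R) (M : R) : continuous h ->
  (forall z : plane R, M < `|z| -> h z = 0) ->
  (area R).-integrable [set: mplane R] (fun z => (h z)%:E).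
Proof.
move=> ch h0; pose B : set (mplane R) := rect (- (`|M| + 1)) (`|M| + 1) (- (`|M| + 1)) (`|M| + 1).
have mB : measurable B by exact: measurable_rect.
have mh := measurable_continuous_plane ch.
have [C HC] := @continuous_boxc_bounded h (- (`|M| + 1)) (`|M| + 1) (- (`|M| + 1)) (`|M| + 1) (fun z _ => ch z).
have iB : (area R).-integrable B (fun z => (h z)%:E).
  apply: measurable_bounded_integrable => //.
  - have M0 := normr_ge0 M.
    have HM : - (`|M| + 1) <= `|M| + 1 by lra.
    by rewrite [X in (X < _)%E](area_rect HM HM) ltry.
  - exact: measurable_funTS.
  - exists C; split; first exact: num_real.
    move=> x Cx z Bz; apply: le_trans (ltW Cx); apply: HC.
    exact: rect_boxc Bz.
have /(integrable_mkcond _ mB) := iB.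
apply: eq_integrable => // z _; rewrite /patch; case: ifPn => // /negP nB.
rewrite h0// ltNge; apply/negP => zM; apply: nB; rewrite inE.
have MM := ler_norm M.
move: zM; rewrite prod_norm_le !ler_norml => /andP[/andP[? ?] /andP[? ?]].
by apply/rectP; split; apply/andP; split; lra.
Qed.

Lemma near_norm_gt (z : plane R) (M : R) : M < `|z| -> \forall w \near z, M < `|w|.
Proof.
move=> Mz; apply/nbhs_ballP; exists (`|z| - M); first by rewrite /= subr_gt0.
move=> w; rewrite -ball_normE /= => H.
have := ler_normD (z - w) w; rewrite subrK; lra.
Qed.

Lemma Dx_support0 (W : plane R -> R) (z : plane R) (M : R) :
  (forall z : plane R, M < `|z| -> W z = 0) -> M < `|z| -> Dx W z = 0.
Proof.
move=> W0 Mz; have nz : \forall w \near z, W w = 0.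
  by apply: filterS (near_norm_gt Mz) => w; exact: W0.
have E : \forall w \near z, W w = (cst 0 : plane R -> R) w by exact: nz.
rewrite (nbhs_singleton (near_Dx E)); exact: (is_derive_DxP (is_derive_cst _ _ _)).2.
Qed.

Lemma Dy_support0 (W : plane R -> R) (z : plane R) (M : R) :
  (forall z : plane R, M < `|z| -> W z = 0) -> M < `|z| -> Dy W z = 0.
Proof.
move=> W0 Mz; have nz : \forall w \near z, W w = 0.
  by apply: filterS (near_norm_gt Mz) => w; exact: W0.
have E : \forall w \near z, W w = (cst 0 : plane R -> R) w by exact: nz.
rewrite (nbhs_singleton (near_Dy E)); exact: (is_derive_DyP (is_derive_cst _ _ _)).2.
Qed.

Lemma integral_Dx0 (W : plane R -> R) (M : R) : Ck 1 setT W -> 0 <= M ->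
  (forall z : plane R, M < `|z| -> W z = 0) ->
  (\int[area R]_z (Dx W z)%:E = 0)%E.
Proof.
move=> W1 M0 W0.
have cW : continuous (Dx W) by move=> z; exact: (Ck_cont (Ck_Dx W1)).
have W0' (z : plane R) : M < `|z| -> Dx W z = 0 by exact: Dx_support0.
have iW := integrable_compact_support cW W0'.
rewrite -(integral21_prod_meas1 iW) (eq_integral (cst 0%E)) ?integral0//.
move=> y _ /=.
have n1 (s : R) : M < `|s| -> M < `|(s, y)|.
  by move=> Ms; rewrite (lt_le_trans Ms)//; exact: (norm_fst (s, y)).
apply: (@integral_derivative_compact (fun s => W (s, y)) (fun s => Dx W (s, y)) M) => //.
- by move=> s; exact (is_derive_Dx (Ck_dx W1 I)).
- move=> s; apply: (@continuous_comp _ _ _ (fun s => (s, y)) (Dx W)); last exact: cW.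
  by apply: continuous_pair; [exact: cvg_id|exact: cst_continuous].
- by move=> s /n1; exact: W0.
- by move=> s /n1; exact: W0'.
Qed.

Lemma integral_Dy0 (W : plane R -> R) (M : R) : Ck 1 setT W -> 0 <= M ->
  (forall z : plane R, M < `|z| -> W z = 0) ->
  (\int[area R]_z (Dy W z)%:E = 0)%E.
Proof.
move=> W1 M0 W0.
have cW : continuous (Dy W) by move=> z; exact: (Ck_cont (Ck_Dy W1)).
have W0' (z : plane R) : M < `|z| -> Dy W z = 0 by exact: Dy_support0.
have iW := integrable_compact_support cW W0'.
rewrite -(integral12_prod_meas1 iW) (eq_integral (cst 0%E)) ?integral0//.
move=> x _ /=.
have n1 (s : R) : M < `|s| -> M < `|(x, s)|.
  by move=> Ms; rewrite (lt_le_trans Ms)//; exact: (norm_snd (x, s)).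
apply: (@integral_derivative_compact (fun s => W (x, s)) (fun s => Dy W (x, s)) M) => //.
- by move=> s; exact (is_derive_Dy (Ck_dy W1 I)).
- move=> s; apply: (@continuous_comp _ _ _ (fun s => (x, s)) (Dy W)); last exact: cW.
  by apply: continuous_pair; [exact: cst_continuous|exact: cvg_id].
- by move=> s /n1; exact: W0.
- by move=> s /n1; exact: W0'.
Qed.

Lemma compact_norm_bound K : compact K ->
  exists2 M : R, 0 <= M & forall z : plane R, K z -> `|z| <= M.
Proof.
move=> /compact_bounded[M [_ HM]]; exists (`|M| + 1); first by rewrite addr_ge0.
move=> z Kz; apply: (HM (`|M| + 1)) => //.
by rewrite (le_lt_trans (ler_norm M))// ltrDl.
Qed.

Lemma near_compl K (z : plane R) : closed K -> ~ K z -> \forall w \near z, ~ K w.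
Proof.
move=> cK nK; apply: open_nbhs_nbhs; split => //.
exact: closed_openC.
Qed.

(** A point outside U is outside the closed set K, so the extension vanishes near it; near a point
    of U it is h. *)
Lemma Ck_zero_extension k U K h : open U -> closed K -> K `<=` U ->
  Ck k U h -> (forall z, U z -> ~ K z -> h z = 0) ->
  Ck k setT (fun z => if `[< U z >] then h z else 0).
Proof.
move=> oU cK KU hk h0; apply/Ck_pt => z _.
have [Uz|nUz] := pselect (U z).
  have /Ck_pt/(_ z Uz) := hk; apply: Ck_near.
  by apply: (near_open oU Uz) => w Uw; rewrite asboolT.
have nK : ~ K z by move=> /KU.
have : Ck k [set z] (fun _ : plane R => 0 : R).
  by apply: (Ck_mono (U := setT)) => //; exact: Ck_cst openT.
apply: Ck_near; apply: filterS (near_compl cK nK) => w nKw.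
by case: asboolP => // Uw; rewrite h0.
Qed.

Lemma integrable_zero_extension U K h : open U -> compact K -> K `<=` U ->
  Ck 0 U h -> (forall z, U z -> ~ K z -> h z = 0) ->
  (area R).-integrable (U : set (mplane R)) (fun z => (h z)%:E).
Proof.
move=> oU cK KU h0 hz; have mU := open_measurable_plane oU.
have clK : closed K by apply: compact_closed => //; exact: norm_hausdorff.
have := Ck_zero_extension oU clK KU h0 hz => -[ch _].
have [M M0 HM] := compact_norm_bound cK.
apply/(integrable_mkcond _ mU).
have iE : (area R).-integrable [set: mplane R]
    (fun z => (if `[< U z >] then h z else 0)%:E).
  apply: (integrable_compact_support (M := M)); first by move=> z; exact: ch.
  move=> z Mz; case: asboolP => // Uz; apply: hz => // Kz.
  by have := HM z Kz; rewrite leNgt Mz.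
apply: eq_integrable iE => // z _; rewrite /patch /=.
by case: asboolP => Uz; [rewrite mem_set|rewrite memNset].
Qed.

Lemma integral_add0 (D : set (mplane R)) (f g : mplane R -> R) : measurable D ->
  (area R).-integrable D (fun z => (f z)%:E) ->
  (area R).-integrable D (fun z => (g z)%:E) ->
  (\int[area R]_(z in D) (f z)%:E = 0)%E -> (\int[area R]_(z in D) (g z)%:E = 0)%E ->
  (\int[area R]_(z in D) ((f z)%:E + (g z)%:E) = 0)%E.
Proof. by move=> mD fi gi f0 g0; rewrite integralD// f0 g0 adde0. Qed.

Lemma integral_sub0 (D : set (mplane R)) (f g : mplane R -> R) : measurable D ->
  (area R).-integrable D (fun z => (f z)%:E) ->
  (area R).-integrable D (fun z => (g z)%:E) ->
  (\int[area R]_(z in D) ((f z)%:E - (g z)%:E) = 0)%E ->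
  (\int[area R]_(z in D) (f z)%:E = \int[area R]_(z in D) (g z)%:E)%E.
Proof.
move=> mD fi gi; rewrite integralB_EFin//.
move: (integrable_fin_num mD fi) (integrable_fin_num mD gi).
move=> /fineK <- /fineK <-; rewrite -EFinB => -[/subr0_eq ->].
by [].
Qed.

(** The difference of the integrands is the divergence of chi grad q - q grad chi. This field is
    supported in K because chi is, so after extension by 0 each of its two partial derivatives
    integrates to 0 over the plane. *)
Lemma green_plane U K chi q : open U -> compact K -> K `<=` U ->
  Ck 2 U chi -> Ck 2 U q -> (forall z, U z -> ~ K z -> chi z = 0) ->
  (\int[area R]_(z in U) (chi z * laplacian q z)%:E =
   \int[area R]_(z in U) (q z * laplacian chi z)%:E)%E.
Proof.
move=> oU cK KU c2 q2 c0.
have mU := open_measurable_plane oU.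
have clK : closed K by apply: compact_closed => //; exact: norm_hausdorff.
have [M M0 HM] := compact_norm_bound cK.
have c0near z : U z -> ~ K z -> \forall w \near z, chi w = (cst 0 : plane R -> R) w.
  move=> Uz nK; have nU : \forall w \near z, U w by exact: (near_open (P := U) oU Uz).
  by apply: filterS2 nU (near_compl clK nK) => w Uw nKw; rewrite c0.
have d0 (w : plane R) v : 'D_v (cst 0 : plane R -> R) w = 0 by exact: derive_cst.
have cx0n z : U z -> ~ K z -> \forall w \near z, Dx chi w = (cst 0 : plane R -> R) w.
  move=> Uz nK; apply: filterS (near_Dx (c0near z Uz nK)) => w ->.
  exact: (is_derive_DxP (is_derive_cst _ _ _)).2.
have cy0n z : U z -> ~ K z -> \forall w \near z, Dy chi w = (cst 0 : plane R -> R) w.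
  move=> Uz nK; apply: filterS (near_Dy (c0near z Uz nK)) => w ->.
  exact: (is_derive_DyP (is_derive_cst _ _ _)).2.
have cx0 z : U z -> ~ K z -> Dx chi z = 0 by move=> Uz nK; exact: (nbhs_singleton (cx0n z Uz nK)).
have cy0 z : U z -> ~ K z -> Dy chi z = 0 by move=> Uz nK; exact: (nbhs_singleton (cy0n z Uz nK)).
have cxx0 z : U z -> ~ K z -> Dx (Dx chi) z = 0.
  move=> Uz nK; rewrite (nbhs_singleton (near_Dx (cx0n z Uz nK))).
  exact: (is_derive_DxP (is_derive_cst _ _ _)).2.
have cyy0 z : U z -> ~ K z -> Dy (Dy chi) z = 0.
  move=> Uz nK; rewrite (nbhs_singleton (near_Dy (cy0n z Uz nK))).
  exact: (is_derive_DyP (is_derive_cst _ _ _)).2.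
have Ux : Ck 1 U (fun z => chi z * Dx q z - q z * Dx chi z).
  exact (CkB oU (CkM oU (Ck_S c2) (Ck_Dx q2)) (CkM oU (Ck_S q2) (Ck_Dx c2))).
have Uy : Ck 1 U (fun z => chi z * Dy q z - q z * Dy chi z).
  exact (CkB oU (CkM oU (Ck_S c2) (Ck_Dy q2)) (CkM oU (Ck_S q2) (Ck_Dy c2))).
have wx0 z : U z -> ~ K z -> chi z * Dx q z - q z * Dx chi z = 0.
  by move=> Uz nK; rewrite cx0// c0// mul0r mulr0 subrr.
have wy0 z : U z -> ~ K z -> chi z * Dy q z - q z * Dy chi z = 0.
  by move=> Uz nK; rewrite cy0// c0// mul0r mulr0 subrr.
have Wx := Ck_zero_extension oU clK KU Ux wx0.
have Wy := Ck_zero_extension oU clK KU Uy wy0.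
have far h (z : plane R) : (forall z, U z -> ~ K z -> h z = 0) -> M < `|z| ->
    (if `[< U z >] then h z else 0) = 0 :> R.
  move=> H Mz; case: asboolP => // Uz; apply: H => // Kz.
  by have := HM z Kz; rewrite leNgt Mz.
have Ix := integral_Dx0 Wx M0 (fun z => far _ z wx0).
have Iy := integral_Dy0 Wy M0 (fun z => far _ z wy0).
have ux z : U z -> Dx (fun z => if `[< U z >] then chi z * Dx q z - q z * Dx chi z else 0) z
    = chi z * Dx (Dx q) z - q z * Dx (Dx chi) z.
  move=> Uz; have E : \forall w \near z,
     chi w * Dx q w - q w * Dx chi w = (if `[< U w >] then chi w * Dx q w - q w * Dx chi w else 0).
    by apply: (near_open oU Uz) => w Uw; rewrite asboolT.
  rewrite -(nbhs_singleton (near_Dx E)).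
  have dcx := Ck_is_derive_x c2 Uz; have dqx := Ck_is_derive_x q2 Uz.
  have dcxx := Ck_is_derive_x (Ck_Dx c2) Uz; have dqxx := Ck_is_derive_x (Ck_Dx q2) Uz.
  rewrite (is_derive_DxP (is_deriveB (is_deriveM dcx dqxx) (is_deriveM dqx dcxx))).2.
  move: (Dx (Dx chi) z) (Dx (Dx q) z) (Dx chi z) (Dx q z) => *; rewrite /GRing.scale /=; ring.
have uy z : U z -> Dy (fun z => if `[< U z >] then chi z * Dy q z - q z * Dy chi z else 0) z
    = chi z * Dy (Dy q) z - q z * Dy (Dy chi) z.
  move=> Uz; have E : \forall w \near z,
     chi w * Dy q w - q w * Dy chi w = (if `[< U w >] then chi w * Dy q w - q w * Dy chi w else 0).
    by apply: (near_open oU Uz) => w Uw; rewrite asboolT.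
  rewrite -(nbhs_singleton (near_Dy E)).
  have dcx := Ck_is_derive_y c2 Uz; have dqx := Ck_is_derive_y q2 Uz.
  have dcxx := Ck_is_derive_y (Ck_Dy c2) Uz; have dqxx := Ck_is_derive_y (Ck_Dy q2) Uz.
  rewrite (is_derive_DyP (is_deriveB (is_deriveM dcx dqxx) (is_deriveM dqx dcxx))).2.
  move: (Dy (Dy chi) z) (Dy (Dy q) z) (Dy chi z) (Dy q z) => *; rewrite /GRing.scale /=; ring.
have onU h h' : (forall z, U z -> h z = h' z) -> (forall z, ~ U z -> h z = 0) ->
    (\int[area R]_z (h z)%:E = \int[area R]_(z in U) (h' z)%:E)%E.
  move=> H H0; rewrite [RHS]integral_mkcond; apply: eq_integral => z _; rewrite /patch.
  by case: ifPn => [/set_mem Uz|/negP nU]; [rewrite H|rewrite H0// => Uz; apply: nU; rewrite inE].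
have outx z : ~ U z -> Dx (fun z => if `[< U z >] then chi z * Dx q z - q z * Dx chi z else 0) z = 0.
  move=> nU; have nK : ~ K z by move=> /KU.
  have E : \forall w \near z, (if `[< U w >] then chi w * Dx q w - q w * Dx chi w else 0) = (cst 0 : plane R -> R) w.
    by apply: filterS (near_compl clK nK) => w nKw; case: asboolP => // Uw; rewrite wx0.
  rewrite (nbhs_singleton (near_Dx E)); exact: (is_derive_DxP (is_derive_cst _ _ _)).2.
have outy z : ~ U z -> Dy (fun z => if `[< U z >] then chi z * Dy q z - q z * Dy chi z else 0) z = 0.
  move=> nU; have nK : ~ K z by move=> /KU.
  have E : \forall w \near z, (if `[< U w >] then chi w * Dy q w - q w * Dy chi w else 0) = (cst 0 : plane R -> R) w.
    by apply: filterS (near_compl clK nK) => w nKw; case: asboolP => // Uw; rewrite wy0.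
  rewrite (nbhs_singleton (near_Dy E)); exact: (is_derive_DyP (is_derive_cst _ _ _)).2.
rewrite (onU _ _ ux outx) in Ix; rewrite (onU _ _ uy outy) in Iy.
have ia : (area R).-integrable (U : set (mplane R)) (fun z => (chi z * laplacian q z)%:E).
  apply: (integrable_zero_extension oU cK KU).
    exact (CkM oU (Ck_S (Ck_S c2)) (CkD oU (Ck_Dx (Ck_Dx q2)) (Ck_Dy (Ck_Dy q2)))).
  by move=> z Uz nK; rewrite c0// mul0r.
have ib : (area R).-integrable (U : set (mplane R)) (fun z => (q z * laplacian chi z)%:E).
  apply: (integrable_zero_extension oU cK KU).
    exact (CkM oU (Ck_S (Ck_S q2)) (CkD oU (Ck_Dx (Ck_Dx c2)) (Ck_Dy (Ck_Dy c2)))).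
  by move=> z Uz nK; rewrite /laplacian cxx0// cyy0// addr0 mulr0.
have ixx : (area R).-integrable (U : set (mplane R)) (fun z => (chi z * Dx (Dx q) z - q z * Dx (Dx chi) z)%:E).
  apply: (integrable_zero_extension oU cK KU).
    exact (CkB oU (CkM oU (Ck_S (Ck_S c2)) (Ck_Dx (Ck_Dx q2))) (CkM oU (Ck_S (Ck_S q2)) (Ck_Dx (Ck_Dx c2)))).
  by move=> z Uz nK; rewrite c0// cxx0// mul0r mulr0 subrr.
have iyy : (area R).-integrable (U : set (mplane R)) (fun z => (chi z * Dy (Dy q) z - q z * Dy (Dy chi) z)%:E).
  apply: (integrable_zero_extension oU cK KU).
    exact (CkB oU (CkM oU (Ck_S (Ck_S c2)) (Ck_Dy (Ck_Dy q2))) (CkM oU (Ck_S (Ck_S q2)) (Ck_Dy (Ck_Dy c2)))).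
  by move=> z Uz nK; rewrite c0// cyy0// mul0r mulr0 subrr.
have Z : (\int[area R]_(z in U) ((chi z * laplacian q z)%:E - (q z * laplacian chi z)%:E) = 0)%E.
  transitivity (\int[area R]_(z in U) ((chi z * Dx (Dx q) z - q z * Dx (Dx chi) z)%:E +
   (chi z * Dy (Dy q) z - q z * Dy (Dy chi) z)%:E))%E.
    apply: eq_integral => z _ /=; rewrite -EFinB -EFinD /laplacian; congr (_%:E).
    by move: (Dx (Dx chi) z) (Dx (Dx q) z) (Dy (Dy chi) z) (Dy (Dy q) z) => *; ring.
  exact (integral_add0 mU ixx iyy Ix Iy).
exact (integral_sub0 mU ia ib Z).
Qed.

End CompactSupport.

(** * Smooth Green kernels *)

Section FlatFunctions.
Context {R : realType}.
Implicit Types (p : {poly R}) (t : R).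

Lemma expr_le_expR k : exists2 C : R, 0 <= C & forall y, 0 <= y -> y ^+ k <= C * expR y.
Proof.
case: k => [|k].
  by exists 1 => // y y0; rewrite expr0 mul1r; have := expR_ge1Dx y; lra.
exists (k.+1)`!%:R => // y y0.
have f0 : 0 < (k.+1)`!%:R :> R by rewrite ltr0n fact_gt0.
rewrite mulrC -ler_pdivrMr//.
by apply: le_trans (expR_ge1Dxn k y0); rewrite lerDr.
Qed.

(** The extra power is there for the induction: a factor X of the polynomial is traded for one more
    power of y. *)
Lemma poly_le_expR p k : exists2 C : R, 0 <= C &
  forall y, 0 <= y -> `|p.[y]| * y ^+ k <= C * expR y.
Proof.
elim/poly_ind: p k => [|p c IH] k.
  by exists 0 => // y _; rewrite horner0 normr0 !mul0r.
have [C1 C10 H1] := IH k.+1; have [C2 C20 H2] := expr_le_expR k.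
exists (C1 + `|c| * C2); first by rewrite addr_ge0// mulr_ge0.
move=> y y0; rewrite hornerMXaddC mulrDl.
have yk : 0 <= y ^+ k by rewrite exprn_ge0.
apply: le_trans (ler_wpM2r yk (ler_normD _ _)) _; rewrite mulrDl; apply: lerD.
  by rewrite normrM (ger0_norm y0) -mulrA -exprS; exact: H1.
by rewrite -mulrA ler_wpM2l//; exact: H2.
Qed.

(* Every function p(1/t) exp(-1/t), extended by 0 to t <= 0, has a derivative of
   the same form, hence is smooth. *)
Definition flat p t : R := if 0 < t then p.[t^-1] * expR (- t^-1) else 0.

(** The chain rule in s = 1/t: the derivative of p(s) exp(-s) in t is s^2 (p(s) - p'(s)) exp(-s). *)
Definition flat_deriv p : {poly R} := 'X^2 * (p - p^`()).

Lemma flat_le0 p t : t <= 0 -> flat p t = 0.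
Proof. by move=> t0; rewrite /flat ltNge t0. Qed.

Lemma is_derive_flat p t : is_derive t 1 (flat p) (flat (flat_deriv p) t).
Proof.
have [t0|t0|->] := ltgtP t 0.
- rewrite (flat_le0 _ (ltW t0)).
  have nt : \forall s \near t, cst 0 s = flat p s.
    by near=> s; rewrite /= flat_le0//; apply: ltW; near: s; exact: lt_nbhsl.
  by apply: (near_eq_is_derive nt); exact: is_derive_cst.
- have nt : \forall s \near t, p.[s^-1] * expR (- s^-1) = flat p s.
    near=> s; rewrite /flat ifT//; near: s; exact: lt_nbhsr.
  apply: (near_eq_is_derive nt).
  have di := is_derive_inv (lt0r_neq0 t0).
  have dp : is_derive t^-1 1 (horner p) (p^`()).[t^-1].
    split; first exact: derivable_horner.
    by rewrite derivE derive1E.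
  have de : is_derive (- t^-1) 1 (@expR R) (expR (- t^-1)) by exact: is_derive_expR.
  have d1 := is_derive_comp1 dp di.
  have d2 := is_derive_comp1 (q := fun w : R => - w^-1) de (is_deriveN di).
  apply: (is_derive_eq (is_deriveM d1 d2)).
  rewrite /flat t0 /flat_deriv hornerM hornerXn hornerD hornerN /GRing.scale/=.
  by rewrite expr2; ring.
rewrite flat_le0//; apply/is_derive_epsP => e e0.
(* The power 2 bounds the function by C s^2 near 0, so the difference quotient there tends to 0. *)
have [C C0 HC] := poly_le_expR p 2.
have eC : 0 < e / (C + 1) by rewrite divr_gt0// ltr_wpDl.
near=> s; rewrite [_ *: 1]mulr1 addr0 mulr0 (flat_le0 _ (lexx 0)) !subr0.
have [s0|s0] := leP s 0; first by rewrite flat_le0// normr0 mulr_ge0// ltW.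
have sC : s < e / (C + 1).
  suff : `|s| < e / (C + 1) by rewrite gtr0_norm.
  near: s; apply/nbhs_ballP; exists (e / (C + 1)) => //= s.
  by rewrite /ball/= sub0r normrN.
rewrite /flat s0 normrM (gtr0_norm (expR_gt0 _)) (gtr0_norm s0) expRN.
have := HC s^-1; rewrite invr_ge0 => /(_ (ltW s0)).
rewrite exprVn ler_pdivrMr ?exprn_gt0// => H.
rewrite ler_pdivrMr ?expR_gt0//; apply: le_trans H _.
rewrite -mulrA (mulrC (expR _)) mulrA ler_wpM2r ?expR_ge0// expr2 mulrA ler_wpM2r ?(ltW s0)//.
have : s * (C + 1) < e by rewrite -ltr_pdivlMr// ltr_wpDl.
by have := s0; nra.
Unshelve. all: by end_near. Qed.

Fixpoint flat_poly p n : {poly R} :=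
  if n is n'.+1 then flat_deriv (flat_poly p n') else p.

Lemma Ck_flat p k (U : set (plane R)) q : open U -> Ck k U q ->
  Ck k U (fun z => flat p (q z)).
Proof.
move=> oU Cq.
apply: (@Ck_comp1 R k U setT (fun n => flat (flat_poly p n)) 0 q oU) => // n s _.
exact: is_derive_flat.
Qed.

Lemma flat1_gt0 t : (0 < flat 1 t) = (0 < t).
Proof. by rewrite /flat; case: ifPn => t0; rewrite ?ltxx// hornerC mul1r expR_gt0. Qed.

Lemma flat1_ge0 t : 0 <= flat 1 t.
Proof. by rewrite /flat; case: ifPn => // t0; rewrite hornerC mul1r expR_ge0. Qed.

(* A smooth convex function vanishing on t <= 0 and with slope at most 1. *)
Definition smooth_pos t : R := t * flat 1 t.

Lemma is_derive_smooth_pos t : is_derive t 1 smooth_pos (flat (1 + 'X) t).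
Proof.
apply: (is_derive_eq (is_deriveM (is_derive_id t 1) (is_derive_flat 1 t))).
rewrite /flat /flat_deriv /GRing.scale/=; case: ifPn => t0; last by rewrite !mul0r mulr0 addr0.
rewrite derivC subr0 mulr1 hornerXn hornerD hornerX !hornerC expr2.
by field; rewrite gt_eqF.
Qed.

Lemma is_derive_smooth_pos' t : is_derive t 1 (flat (1 + 'X)) (flat 'X^3 t).
Proof.
apply: (is_derive_eq (is_derive_flat _ _)); congr (flat _ t).
by rewrite /flat_deriv derivD derivC derivX add0r addrC addKr -exprSr.
Qed.

Lemma Ck_smooth_pos k (U : set (plane R)) q : open U -> Ck k U q ->
  Ck k U (fun z => smooth_pos (q z)).
Proof. by move=> oU Cq; exact (CkM oU Cq (Ck_flat 1 oU Cq)). Qed.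

Lemma smooth_pos_ge0 t : 0 <= smooth_pos t.
Proof.
rewrite /smooth_pos /flat; case: ifPn => t0; last by rewrite mulr0.
by rewrite hornerC mul1r mulr_ge0// ?expR_ge0// ltW.
Qed.

Lemma smooth_pos_eq0 t : t <= 0 -> smooth_pos t = 0.
Proof. by move=> t0; rewrite /smooth_pos flat_le0// mulr0. Qed.

(** The upper bound is 1 + y <= exp y at y = 1/t. *)
Lemma smooth_pos_slope t : 0 <= flat (1 + 'X) t <= 1.
Proof.
rewrite /flat; case: ifPn => t0; last by rewrite lexx ler01.
rewrite hornerD hornerC hornerX expRN.
have ti : 0 <= t^-1 by rewrite invr_ge0 ltW.
rewrite mulr_ge0 ?invr_ge0 ?expR_ge0 ?addr_ge0//=.
by rewrite ler_pdivrMr ?expR_gt0// mul1r expR_ge1Dx.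
Qed.

Lemma flatX3_ge0 t : 0 <= flat 'X^3 t.
Proof.
rewrite /flat; case: ifPn => // t0.
by rewrite hornerXn mulr_ge0// ?expR_ge0// exprn_ge0// invr_ge0 ltW.
Qed.

End FlatFunctions.

(** * Truncated logarithmic potentials *)

Section GreenKernel.
Context {R : realType}.
Variables (c : plane R) (e r : R).
Hypotheses (e0 : 0 < e) (r0 : 0 < r).

Definition sqdist (z : plane R) : R := (z.1 - c.1) ^+ 2 + (z.2 - c.2) ^+ 2.

Lemma sqdist_ge0 (z : plane R) : 0 <= sqdist z.
Proof. by rewrite addr_ge0// sqr_ge0. Qed.

Lemma Ck_sqdist k : Ck k setT sqdist.
Proof.
have oT := @openT (plane R).
have X := CkB oT (@Ck_fst R k setT oT) (Ck_cst k c.1 oT).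
have Y := CkB oT (@Ck_snd R k setT oT) (Ck_cst k c.2 oT).
apply: (Ck_congr oT _ (CkD oT (CkM oT X X) (CkM oT Y Y))) => z _.
by rewrite /sqdist !expr2.
Qed.

Lemma is_derive_sqdist (z v : plane R) : is_derive z v sqdist
  (2 * (z.1 - c.1) * v.1 + 2 * (z.2 - c.2) * v.2).
Proof.
have dx := is_deriveB (is_derive_fst z v) (is_derive_cst c.1 z v).
have dy := is_deriveB (is_derive_snd z v) (is_derive_cst c.2 z v).
have D := is_deriveD (is_deriveM dx dx) (is_deriveM dy dy).
rewrite (_ : sqdist = ((@fst R R \- cst c.1) * (@fst R R \- cst c.1) +
   (@snd R R \- cst c.2) * (@snd R R \- cst c.2))); last first.
  by apply/funext => w; rewrite /sqdist !expr2.
by apply: (is_derive_eq D); rewrite ?fctE /GRing.scale /=; ring.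
Qed.

Definition sq_reg (z : plane R) : R := sqdist z + e ^+ 2.

Lemma sq_reg_gt0 (z : plane R) : 0 < sq_reg z.
Proof. by rewrite ltr_wpDl ?sqdist_ge0// exprn_gt0. Qed.

Lemma Ck_sq_reg k : Ck k setT sq_reg.
Proof. exact (CkD openT (Ck_sqdist k) (Ck_cst k _ openT)). Qed.

Lemma Ck_sq_regV k : Ck k setT (fun z => (sq_reg z)^-1).
Proof. by apply: (CkV openT) (Ck_sq_reg k) => z _; rewrite gt_eqF// sq_reg_gt0. Qed.

Lemma is_derive_sq_reg (z v : plane R) : is_derive z v sq_reg
  (2 * (z.1 - c.1) * v.1 + 2 * (z.2 - c.2) * v.2).
Proof.
apply: (is_derive_eq (is_deriveD (is_derive_sqdist z v) (is_derive_cst (e ^+ 2) z v))).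
by rewrite addr0.
Qed.

(* Its laplacian is - 4 e^2 / (sqdist c z + e^2)^2, a smoothed point mass at c; it
   vanishes on the circle of radius r. *)
Definition log_pot (z : plane R) : R := ln (r ^+ 2 + e ^+ 2) - ln (sq_reg z).

Lemma is_derive_log_pot (z v : plane R) : is_derive z v log_pot
  (- ((2 * (z.1 - c.1) * v.1 + 2 * (z.2 - c.2) * v.2) * (sq_reg z)^-1)).
Proof.
have dl := is_derive_comp1 (is_derive1_ln (sq_reg_gt0 z)) (is_derive_sq_reg z v).
apply: (is_derive_eq (is_deriveB (is_derive_cst (ln (r ^+ 2 + e ^+ 2)) z v) dl)).
by rewrite sub0r mulrC.
Qed.

Lemma log_pot_x (z : plane R) : is_derive z (1, 0) log_pot (- (2 * (z.1 - c.1) * (sq_reg z)^-1)).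
Proof. by apply: (is_derive_eq (is_derive_log_pot _ _)); rewrite /= mulr1 mulr0 addr0. Qed.

Lemma log_pot_y (z : plane R) : is_derive z (0, 1) log_pot (- (2 * (z.2 - c.2) * (sq_reg z)^-1)).
Proof. by apply: (is_derive_eq (is_derive_log_pot _ _)); rewrite /= mulr0 mulr1 add0r. Qed.

Lemma Ck_log_pot k : Ck k setT log_pot.
Proof.
have oT := @openT (plane R).
apply: Ck_S; apply: (CkS_intro oT (hx := fun z => - (2 * (z.1 - c.1) * (sq_reg z)^-1))
  (hy := fun z => - (2 * (z.2 - c.2) * (sq_reg z)^-1))).
- move=> z _; apply: (@continuous_comp _ _ _ sq_reg (fun s => ln (r ^+ 2 + e ^+ 2) - ln s)).
    exact: (Ck_cont (Ck_sq_reg 0)).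
  apply: continuousB; first exact: cst_continuous.
  by apply: continuous_ln; exact: sq_reg_gt0.
- by move=> z _; exact: log_pot_x.
- by move=> z _; exact: log_pot_y.
- exact (CkN oT (CkM oT (CkZ 2 oT (CkB oT (Ck_fst _ oT) (Ck_cst _ _ oT))) (Ck_sq_regV _))).
- exact (CkN oT (CkM oT (CkZ 2 oT (CkB oT (Ck_snd _ oT) (Ck_cst _ _ oT))) (Ck_sq_regV _))).
Qed.

(** Truncating the potential by a convex increasing function confines it to the disc of radius r,
    and the Laplacian only gains a nonnegative term from the truncation. *)
Definition green_kernel (z : plane R) : R := smooth_pos (log_pot z).

Lemma Ck_green_kernel k : Ck k setT green_kernel.
Proof. exact (Ck_smooth_pos openT (Ck_log_pot k)). Qed.

Lemma green_kernel_ge0 (z : plane R) : 0 <= green_kernel z.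
Proof. exact: smooth_pos_ge0. Qed.

Lemma log_pot_le0 (z : plane R) : (log_pot z <= 0) = (r ^+ 2 <= sqdist z).
Proof.
have A0 : 0 < r ^+ 2 + e ^+ 2 by rewrite addr_gt0// exprn_gt0.
by rewrite /log_pot subr_le0 ler_ln ?posrE ?sq_reg_gt0// /sq_reg lerD2r.
Qed.

Lemma green_kernel_support (z : plane R) : r ^+ 2 <= sqdist z -> green_kernel z = 0.
Proof. by rewrite -log_pot_le0; exact: smooth_pos_eq0. Qed.

(** The second derivative of [smooth_pos] times the squared gradient of [log_pot]; [kernel_in] below
    is its first derivative times minus the Laplacian of [log_pot]. *)
Definition kernel_out (z : plane R) : R :=
  flat 'X^3 (log_pot z) * (4 * sqdist z / sq_reg z ^+ 2).

Definition kernel_in (z : plane R) : R :=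
  flat (1 + 'X) (log_pot z) * (4 * e ^+ 2 / sq_reg z ^+ 2).

Lemma laplacian_green_kernel (z : plane R) :
  laplacian green_kernel z = kernel_out z - kernel_in z.
Proof.
have gx (w : plane R) : is_derive w (1, 0) green_kernel
    (flat (1 + 'X) (log_pot w) * - (2 * (w.1 - c.1) * (sq_reg w)^-1)).
  exact (is_derive_comp1 (is_derive_smooth_pos _) (log_pot_x w)).
have gy (w : plane R) : is_derive w (0, 1) green_kernel
    (flat (1 + 'X) (log_pot w) * - (2 * (w.2 - c.2) * (sq_reg w)^-1)).
  exact (is_derive_comp1 (is_derive_smooth_pos _) (log_pot_y w)).
have Ex : \forall w \near z, Dx green_kernel w =
    flat (1 + 'X) (log_pot w) * - (2 * (w.1 - c.1) * (sq_reg w)^-1).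
  by apply: filterE => w; exact: (is_derive_DxP (gx w)).2.
have Ey : \forall w \near z, Dy green_kernel w =
    flat (1 + 'X) (log_pot w) * - (2 * (w.2 - c.2) * (sq_reg w)^-1).
  by apply: filterE => w; exact: (is_derive_DyP (gy w)).2.
rewrite /laplacian (nbhs_singleton (near_Dx Ex)) (nbhs_singleton (near_Dy Ey)).
have n0 := lt0r_neq0 (sq_reg_gt0 z).
have fx := is_derive_comp1 (is_derive_smooth_pos' (log_pot z)) (log_pot_x z).
have fy := is_derive_comp1 (is_derive_smooth_pos' (log_pot z)) (log_pot_y z).
have ix := is_derive_comp1 (is_derive_inv n0) (is_derive_sq_reg z (1, 0)).
have iy := is_derive_comp1 (is_derive_inv n0) (is_derive_sq_reg z (0, 1)).
have lx := is_deriveB (is_derive_fst z (1, 0)) (is_derive_cst c.1 z (1, 0)).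
have ly := is_deriveB (is_derive_snd z (0, 1)) (is_derive_cst c.2 z (0, 1)).
have Hx := is_deriveM fx (is_deriveN (is_deriveM (is_deriveM (is_derive_cst (2 : R) z (1, 0)) lx) ix)).
have Hy := is_deriveM fy (is_deriveN (is_deriveM (is_deriveM (is_derive_cst (2 : R) z (0, 1)) ly) iy)).
have -> := (is_derive_DxP Hx).2; have -> := (is_derive_DyP Hy).2.
rewrite !fctE /kernel_out /kernel_in /GRing.scale /=.
have sE : sqdist z = (z.1 - c.1) ^+ 2 + (z.2 - c.2) ^+ 2 by [].
have eE : e ^+ 2 = sq_reg z - sqdist z by rewrite /sq_reg addrC addKr.
rewrite eE sE; move: n0.
move: (sq_reg z) (z.1 - c.1) (z.2 - c.2) (flat _ (log_pot z)) (flat _ _) => S x y f1 f2 n0.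
by field.
Qed.

End GreenKernel.

Lemma area_sigma_finite (R : realType) : sigma_finite [set: mplane R] (area R).
Proof.
exists (fun n => rect (- n%:R) n%:R (- n%:R) n%:R).
  apply/seteqP; split => // z _.
  have := @archi_boundP R (`|z.1| + `|z.2|) (addr_ge0 (normr_ge0 _) (normr_ge0 _)).
  set n := Num.bound _ => Hn; exists n => //; apply/rectP.
  have [a0 b0] := (normr_ge0 z.1, normr_ge0 z.2).
  have /ltr_normlP[a1 a2] : `|z.1| < n%:R by lra.
  have /ltr_normlP[b1 b2] : `|z.2| < n%:R by lra.
  by split; apply/andP; split; lra.
move=> n; split; first exact: measurable_rect.
have nn : - n%:R <= n%:R :> R by rewrite (le_trans _ (ler0n _ _))// oppr_le0 ler0n.
by rewrite (area_rect nn nn) ltry.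
Qed.

(* The library's sigma-finite instance on product measures is shadowed by the one on
   products of finite measures, so it has to be redeclared for Fubini's theorem. *)
Definition area_sf (R : realType) : set (mplane R) -> \bar R := area R.

HB.instance Definition _ (R : realType) := Measure.copy (@area_sf R) (area R).

HB.instance Definition _ (R : realType) :=
  @Measure_isSigmaFinite.Build _ (mplane R) R (@area_sf R) (@area_sigma_finite R).

Lemma ge0_integral_invariant d1 d2 (T1 : measurableType d1) (T2 : measurableType d2)
    (R : realType) (m : {measure set T1 -> \bar R}) (n : {measure set T2 -> \bar R})
    (phi : T1 -> T2) (F : T2 -> \bar R) :
  measurable_fun setT phi -> (forall A, measurable A -> m (phi @^-1` A) = n A) ->
  measurable_fun setT F -> (forall y, 0 <= F y)%E ->
  (\int[m]_x F (phi x) = \int[n]_y F y)%E.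
Proof.
move=> mphi inv mF F0; have [nu nuE] := pushforward_exists m mphi.
rewrite -(ge0_integral_pushforwardT mphi nuE mF F0).
by apply: eq_measure_integral => A mA _; rewrite nuE /pushforward inv.
Qed.

(** * Averages over rotations *)

Section RadialAverage.
Context {R : realType}.
Local Notation leb := (@lebesgue_measure R).

Lemma integral_translate (G : mR R -> \bar R) (c : R) (A : set (mR R)) :
  measurable A -> measurable_fun setT G -> (forall s, (0 <= G s)%E) ->
  (\int[leb]_(s in (fun s : R => s + c)%R @^-1` A) G (s + c)%R = \int[leb]_(s in A) G s)%E.
Proof.
move=> mA mG G0.
have mt : measurable_fun [set: mR R] (fun s : mR R => s + c : mR R)%R by exact: measurable_funD.
have mtA : measurable ((fun s : mR R => (s + c)%R : mR R) @^-1` A).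
  by rewrite -[X in measurable X]setTI; exact: mt.
have inv (B : set (mR R)) : measurable B ->
    leb ((fun s : mR R => s + c : mR R)%R @^-1` B) = leb B.
  move=> mB; have := lebesgue_affine c (oner_neq0 R) mB.
  rewrite normr1 mule1 => <-; congr (leb _).
  by apply/funext => s /=; rewrite mul1r.
rewrite integral_mkcond [RHS]integral_mkcond.
rewrite -(@ge0_integral_invariant _ _ (mR R) (mR R) R leb leb (fun s : mR R => s + c : mR R)%R (G \_ A) mt inv).
- by apply: eq_integral => s _; rewrite /patch /=.
- by apply/(measurable_restrictT _ mA); exact: (measurable_funS _ _ mG).
- by move=> s; rewrite /patch; case: ifP.
Qed.

(** Translation by a moves the window to [a, 2 pi + a], and periodicity brings the part beyond 2 pi
    back to [0, a]. Half-open intervals keep the pieces disjoint. *)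
Lemma integral_period (G : mR R -> \bar R) (a : R) : 0 <= a <= 2 * pi ->
  measurable_fun setT G -> (forall s, (0 <= G s)%E) ->
  (forall s, G (s + 2 * pi)%R = G s) ->
  (\int[leb]_(s in `[0%R, (2 * pi)%R]) G (s + a)%R = \int[leb]_(s in `[0%R, (2 * pi)%R]) G s)%E.
Proof.
move=> /andP[a0 a2] mG G0 Gp.
have mI (b c : R) : measurable (`[b, c[%classic : set (mR R)) by exact: measurable_itv.
have Ico (F : mR R -> \bar R) (b c : R) : measurable_fun setT F -> b <= c ->
    (\int[leb]_(s in `[b, c]) F s = \int[leb]_(s in `[b, c[) F s)%E.
  by move=> mF bc; rewrite integral_itv_bndo_bndc//; exact: (measurable_funS _ _ mF).
have pi0 : 0 <= 2 * pi :> R by rewrite mulr_ge0// pi_ge0.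
have mGa : measurable_fun setT (fun s : mR R => G (s + a)%R).
  by apply: (measurableT_comp mG); exact: measurable_funD.
rewrite !Ico//.
have T (c b d : R) : (\int[leb]_(s in `[b, d[) G (s + c)%R =
    \int[leb]_(s in `[(b + c)%R, (d + c)%R[) G s)%E.
  rewrite -(integral_translate c (mI _ _) mG G0); congr integral.
  by apply/seteqP; split => s /=; rewrite !in_itv /= lerD2r ltrD2r.
have S (F : mR R -> \bar R) (b c d : R) : measurable_fun setT F -> (forall s, (0 <= F s)%E) -> b <= c <= d ->
    (\int[leb]_(s in `[b, d[) F s = \int[leb]_(s in `[b, c[) F s + \int[leb]_(s in `[c, d[) F s)%E.
  move=> mF F0 /andP[bc cd]; rewrite -ge0_integral_setU//.
  - by rewrite -(@itv_bndbnd_setU _ _ (BLeft b) (BLeft c) (BLeft d))// bnd_simp.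
  - by exact: (measurable_funS _ _ mF).
  - by apply/disj_setPS => s [] /=; rewrite !in_itv/= => /andP[_ sc] /andP[cs _]; lra.
rewrite T add0r (S G a (2 * pi) (2 * pi + a))//; last by rewrite a2 lerDl.
rewrite [RHS](S G 0 a (2 * pi))//; last by rewrite a0.
rewrite addeC; congr (_ + _)%E.
rewrite -{1}[2 * pi]add0r (addrC (2 * pi)) -(T (2 * pi) 0 a).
by apply: eq_integral => s _; exact: Gp.
Qed.

Lemma polar_angle (x y : R) : x ^+ 2 + y ^+ 2 = 1 ->
  exists2 a : R, 0 <= a <= 2 * pi & x = cos a /\ y = sin a.
Proof.
move=> xy.
have x1 : -1 <= x <= 1 by have := sqr_ge0 y; nra.
have := acos_ge0 x1; have := acos_lepi x1 => a1 a0.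
have p0 := pi_ge0 R.
have sE : Num.sqrt (1 - x ^+ 2) = `|y| by rewrite -xy addrC addKr sqrtr_sqr.
have [y0|y0] := leP 0 y.
  exists (acos x); first by lra.
  by rewrite acosK ?in_itv//= sin_acos// sE ger0_norm.
exists (2 * pi - acos x); first by lra.
have c2 : cos (2 * pi - acos x) = cos (acos x).
  by rewrite -(cosN (acos x)) -[RHS]cosD2pi addrC mulr_natl.
have s2 : sin (2 * pi - acos x) = - sin (acos x).
  by rewrite -(sinN (acos x)) -[RHS]sinD2pi addrC mulr_natl.
by rewrite c2 s2 acosK ?in_itv//= sin_acos// sE ltr0_norm// opprK.
Qed.

Lemma area_isometry (p q u v : R) (F : mplane R -> \bar R) : p ^+ 2 + q ^+ 2 = 1 ->
  measurable_fun setT F -> (forall z, (0 <= F z)%E) ->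
  (\int[area R]_z F (similarity p q u v z) = \int[area R]_z F z)%E.
Proof.
move=> pq mF F0.
apply: (@ge0_integral_invariant _ _ (mplane R) (mplane R) R (area R) (area R)) => //.
  exact: measurable_similarity.
move=> A mA; have := @area_similarity R p q u v A; rewrite pq mule1; apply => //.
Qed.

Lemma polar_coordinates (z : plane R) : exists2 rho : R, 0 <= rho &
  rho ^+ 2 = sqdist 0 z /\
  exists2 a : R, 0 <= a <= 2 * pi & z.1 = rho * cos a /\ z.2 = rho * sin a.
Proof.
rewrite /sqdist !subr0 /=.
have s0 : 0 <= z.1 ^+ 2 + z.2 ^+ 2 by rewrite addr_ge0// sqr_ge0.
exists (Num.sqrt (z.1 ^+ 2 + z.2 ^+ 2)); first exact: sqrtr_ge0.
split; first exact: sqr_sqrtr.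
have := sqr_sqrtr s0; move: (Num.sqrt _) => rho rE.
have [r0|r0] := eqVneq rho 0.
  exists 0; first by rewrite lexx mulr_ge0// pi_ge0.
  rewrite r0 expr0n in rE; move/esym/eqP: rE.
  by rewrite paddr_eq0 ?sqr_ge0// !sqrf_eq0 r0 !mul0r => /andP[/eqP-> /eqP->].
have [a a2 [ca sa]] : exists2 a : R, 0 <= a <= 2 * pi & z.1 / rho = cos a /\ z.2 / rho = sin a.
  by apply: polar_angle; rewrite !expr_div_n -mulrDl -rE divff// expf_neq0.
by exists a => //; rewrite -ca -sa !(mulrC rho) !divfK.
Qed.

(* Averaging over all rotations about c turns the circle means into an area mean. *)
Lemma radial_submean (W : mplane R -> \bar R) (eta : R -> R) (c : plane R) :
  measurable_fun setT W -> (forall z, (0 <= W z)%E) ->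
  measurable_fun [set: mR R] eta -> (forall s, 0 <= eta s) -> W c \is a fin_num ->
  (forall rho : R, (0 <= rho)%R -> eta (rho ^+ 2)%R != 0%R ->
    \int[leb]_(s in `[0%R, (2 * pi)%R]) W (c.1 + rho * cos s, c.2 + rho * sin s)%R
      <= (2 * pi)%:E * W c)%E ->
  (\int[area R]_z (W z * (eta (sqdist c z))%:E) <=
     W c * \int[area R]_z (eta (sqdist c z))%:E)%E.
Proof.
move=> mW W0 meta eta0 Wcf H.
have msq (b : plane R) : measurable_fun [set: mplane R] (fun z => eta (sqdist b z)).
  apply: (measurableT_comp meta).
  by apply: measurable_continuous_plane => z; exact: (Ck_cont (Ck_sqdist b 0)).
have mF : measurable_fun [set: mplane R] (fun z => W z * (eta (sqdist c z))%:E)%E.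
  by apply: emeasurable_funM => //; exact/measurable_EFinP.
have F0 (z : mplane R) : (0 <= W z * (eta (sqdist c z))%:E)%E.
  by rewrite mule_ge0// lee_fin.
have pi2 : 0 < 2 * pi :> R by rewrite mulr_gt0// pi_gt0.
pose S (t : R) (z : plane R) := similarity (cos t) (sin t) c.1 c.2 z.
have sqS t z : sqdist c (S t z) = sqdist 0 z.
  rewrite /sqdist /S /similarity /= !addrK !subr0.
  have := cos2Dsin2 t; move: (cos t) (sin t) => C D CD.
  rewrite (_ : _ + _ = (C ^+ 2 + D ^+ 2) * (z.1 ^+ 2 + z.2 ^+ 2)); last by ring.
  by rewrite CD mul1r.
have rot t : (\int[area R]_z (W z * (eta (sqdist c z))%:E) =
    \int[area R]_z (W (S t z) * (eta (sqdist 0 z))%:E))%E.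
  rewrite -(area_isometry c.1 c.2 (cos2Dsin2 t) mF F0).
  by apply: eq_integral => z _; rewrite -/(S t z) sqS.
have Me : (\int[area R]_z (eta (sqdist c z))%:E = \int[area R]_z (eta (sqdist 0 z))%:E)%E.
  have mE : measurable_fun [set: mplane R] (fun z => (eta (sqdist c z))%:E).
    exact/measurable_EFinP.
  rewrite -(area_isometry c.1 c.2 (cos2Dsin2 0) mE); last by move=> z; rewrite lee_fin.
  by apply: eq_integral => z _; rewrite -/(S 0 z) sqS.
pose I := `[0%R, (2 * pi)%R]%classic : set (mR R).
have mI : measurable I by exact: measurable_itv.
(* The function of angle and point to be integrated in both orders. At a fixed angle, invariance of
   area under rotation gives the area integral ([lhs]); at a fixed point, the integral over the
   angle is a circle mean ([inner]). *)
pose g (q : mR R * mplane R) : \bar R := (W (S q.1 q.2) * (eta (sqdist 0 q.2))%:E * (\1_I q.1)%:E)%E.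
have mS : measurable_fun [set: mR R * mplane R] (fun q => S q.1 q.2 : mplane R).
  have m1 : measurable_fun [set: mR R * mplane R] (fun q => q.2.1) by exact: measurableT_comp.
  have m2 : measurable_fun [set: mR R * mplane R] (fun q => q.2.2) by exact: measurableT_comp.
  have mc : measurable_fun [set: mR R * mplane R] (fun q => cos q.1 : mR R).
    by apply: (measurableT_comp (f := cos)) => //; apply: continuous_measurable_fun; exact: continuous_cos.
  have ms : measurable_fun [set: mR R * mplane R] (fun q => sin q.1 : mR R).
    by apply: (measurableT_comp (f := sin)) => //; apply: continuous_measurable_fun; exact: continuous_sin.
  apply: measurable_fun_pair.
    by apply: measurable_funD => //; apply: measurable_funB; apply: measurable_funM.
  by apply: measurable_funD => //; apply: measurable_funD; apply: measurable_funM.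
have mg : measurable_fun setT g.
  apply: emeasurable_funM; last by apply/measurable_EFinP; apply: measurableT_comp => //; exact: measurable_indic.
  apply: emeasurable_funM; first exact: (measurableT_comp mW mS).
  by apply/measurable_EFinP; apply: (measurableT_comp (msq 0)).
have g0 q : (0 <= g q)%E by rewrite /g !mule_ge0// ?lee_fin//.
have intI (a b : \bar R) : (0 <= a)%E -> (0 <= b)%E ->
    (a * b * \int[leb]_t (\1_I t)%:E = (2 * pi)%:E * (a * b))%E.
  move=> a0 b0.
  have E : (\int[leb]_t (\1_I t)%:E = (2 * pi)%:E)%E.
    transitivity (leb I); last by rewrite /I lebesgue_measure_itv/= lte_fin pi2 oppr0 adde0.
    by rewrite integral_indic// setIT.
  by rewrite E muleC.
have m1I : measurable_fun setT (fun t : mR R => (\1_I t)%:E : \bar R).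
  by apply/measurable_EFinP; exact: measurable_indic.
have lhs : (\int[leb]_t \int[area R]_z g (t, z) =
    (2 * pi)%:E * \int[area R]_z (W z * (eta (sqdist c z))%:E))%E.
  rewrite (eq_integral (fun t : mR R => (\int[area R]_z (W z * (eta (sqdist c z))%:E)) * (\1_I t)%:E)%E).
    rewrite ge0_integralZl//; last by apply: integral_ge0.
    by rewrite -[X in (X * _)%E]mule1 intI ?mule1//; apply: integral_ge0.
  move=> t _; rewrite (rot t) -ge0_integralZr//.
  - apply: emeasurable_funM; last by apply/measurable_EFinP.
    apply: (measurableT_comp mW); exact: measurable_similarity.
  - by move=> z _; rewrite mule_ge0// lee_fin.
have inner z : (\int[leb]_t g (t, z) <= (2 * pi)%:E * (W c * (eta (sqdist 0 z))%:E))%E.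
  have [e0|en0] := eqVneq (eta (sqdist 0 z)) 0.
    rewrite e0 !mule0 integral0_eq// => t _.
    by rewrite /g /= e0 mule0 mul0e.
  rewrite (eq_integral (fun t : mR R => ((eta (sqdist 0 z))%:E * (W (S t z) * (\1_I t)%:E))%E)); last first.
    by move=> t _; rewrite /g /= (muleC (W _)) muleA.
  have mWS : measurable_fun [set: mR R] (fun t => W (S t z)).
    have mSz : measurable_fun [set: mR R] (fun t => S t z : mplane R).
      exact: (@measurable_fun_pair1 _ _ _ _ _ _ _ z mS).
    exact (measurableT_comp mW mSz).
  rewrite ge0_integralZl ?lee_fin//; last 2 first.
  - exact: emeasurable_funM.
  - by move=> t _; rewrite mule_ge0// lee_fin.
  rewrite (muleC (W c)) muleCA lee_pmul2l ?lte_fin ?lt_neqAle ?eta0 1?eq_sym ?en0//.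
  rewrite (eq_integral ((fun t : mR R => W (S t z)) \_ I)); last first.
    move=> t _; rewrite /patch indicE; case: ifP => tI; first by rewrite mule1.
    by rewrite mule0.
  rewrite -integral_mkcond /I.
  (* In polar coordinates a rotation of z shifts its angle by a, and the shift disappears by
     periodicity. *)
  have [rho rho0 [rE [a /andP[a0 a2] [z1 z2]]]] : exists2 rho : R, 0 <= rho &
      rho ^+ 2 = sqdist 0 z /\
      exists2 a : R, 0 <= a <= 2 * pi & z.1 = rho * cos a /\ z.2 = rho * sin a.
    exact: polar_coordinates.
  rewrite -rE in en0.
  pose G (s : mR R) := W (c.1 + rho * cos s, c.2 + rho * sin s)%R.
  rewrite (eq_integral (fun t : mR R => G (t + a)%R)); last first.
    move=> t _; congr (W _); rewrite /S /similarity /= z1 z2 cosD sinD.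
    by congr pair; ring.
  rewrite (@integral_period G).
  - exact: H.
  - by rewrite a0.
  - have mc : measurable_fun [set: mR R] (fun s => c.1 + rho * cos s : mR R).
      apply: measurable_funD => //; apply: measurable_funM => //.
      by apply: continuous_measurable_fun; exact: continuous_cos.
    have ms : measurable_fun [set: mR R] (fun s => c.2 + rho * sin s : mR R).
      apply: measurable_funD => //; apply: measurable_funM => //.
      by apply: continuous_measurable_fun; exact: continuous_sin.
    exact (measurableT_comp mW (measurable_fun_pair mc ms)).
  - by move=> s; exact: W0.
  - move=> s; rewrite /G mulr_natl; congr (W (c.1 + rho * _, c.2 + rho * _)).
      exact: cosD2pi.
    exact: sinD2pi.
have rhs : (\int[area R]_z \int[leb]_t g (t, z) <=
    (2 * pi)%:E * (W c * \int[area R]_z (eta (sqdist c z))%:E))%E.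
  rewrite Me -ge0_integralZl//; last 2 first.
  - exact/measurable_EFinP.
  - by move=> z _; rewrite lee_fin.
  rewrite -ge0_integralZl//; last 3 first.
  - by apply: emeasurable_funM => //; exact/measurable_EFinP.
  - by move=> z _; rewrite mule_ge0// lee_fin.
  - by rewrite lee_fin ltW.
  apply: ge0_le_integral => //.
  - by move=> z _; apply: integral_ge0.
  - by have := @measurable_fun_fubini_tonelli_G _ _ (mR R) (mplane R) R leb g mg g0.
  - by apply: emeasurable_funM => //; apply: emeasurable_funM => //; exact/measurable_EFinP.
rewrite -(@lee_pmul2l _ (2 * pi)%:E)// -lhs (le_trans _ rhs)//.
by rewrite le_eqVlt; apply/orP; left; apply/eqP; exact (@fubini_tonelli _ _ (mR R) (mplane R) R leb (@area_sf R) g mg g0).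
Qed.

End RadialAverage.

(** * Mass bounds uniform in the smoothing parameter *)

Section KernelEstimates.
Context {R : realType}.
Local Notation leb := (@lebesgue_measure R).
Implicit Types (c z : plane R) (e r : R).

(** A primitive is atan ((x - b) / e), whose values lie between - pi / 2 and pi / 2. *)
Lemma cauchy_mass (b e r : R) : 0 < e -> 0 < r ->
  (\int[leb]_(x in `[(b - r)%R, (b + r)%R]) (e / ((x - b) ^+ 2 + e ^+ 2))%:E <= pi%:E)%E.
Proof.
move=> e0 r0.
have q0 (x : R) : 0 < (x - b) ^+ 2 + e ^+ 2 by rewrite ltr_wpDl ?sqr_ge0// exprn_gt0.
have dF (x : R) : is_derive x 1 (fun x : R => atan ((x - b) / e)) (e / ((x - b) ^+ 2 + e ^+ 2)).
  have d1 : is_derive x 1 (fun x : R => (x - b) / e) e^-1.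
    rewrite (_ : (fun x : R => (x - b) / e) = (e^-1 *: (id - cst b)))%R; last first.
      by apply/funext => s; rewrite !fctE /GRing.scale/= mulrC.
    have D := is_deriveZ e^-1 (is_deriveB (is_derive_id x (1 : R)) (is_derive_cst b x (1 : R))).
    by apply: (is_derive_eq D); rewrite subr0 /GRing.scale/= mulr1.
  have d2 := is_derive_comp1 (q := fun x : R => (x - b) / e) (is_derive1_atan ((x - b) / e)) d1.
  apply: (is_derive_eq d2).
  have e1 : e != 0 by rewrite gt_eqF.
  rewrite expr_div_n -{1}(divff (expf_neq0 2 e1)) -mulrDl invf_div (addrC (e ^+ 2)).
  have := lt0r_neq0 (q0 x); move: (_ + _) => Q Q0.
  by field; rewrite e1 Q0.
have cF (x : R) : {for x, continuous (fun x : R => atan ((x - b) / e))}.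
  apply: differentiable_continuous; apply/derivable1_diffP; exact: (@ex_derive _ _ _ _ _ _ _ (dF x)).
rewrite (@continuous_FTC2 _ _ (fun x : R => atan ((x - b) / e))).
- rewrite -EFinB lee_fin.
  have := @atan_ltpi2 R ((b + r - b) / e); have := @atan_gtNpi2 R ((b - r - b) / e).
  by move: (atan _) (atan _) => s t; lra.
- by lra.
- apply: continuous_subspaceT => x.
  apply: (@continuousM _ _ (cst e) (fun x : R => ((x - b) ^+ 2 + e ^+ 2)^-1)); first exact: cst_continuous.
  apply: (@continuousV _ _ (fun x : R => (x - b) ^+ 2 + e ^+ 2)); first by rewrite gt_eqF.
  apply: continuousD; last exact: cst_continuous.
  apply: (@continuous_comp _ _ _ (fun x : R => x - b) (fun y => y ^+ 2)).
    by apply: continuousB; [exact: cvg_id|exact: cst_continuous].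
  exact: exprn_continuous.
- split.
  + by move=> x _; exact: (@ex_derive _ _ _ _ _ _ _ (dF x)).
  + by apply: cvg_at_right_filter; exact: cF.
  + by apply: cvg_at_left_filter; exact: cF.
- by move=> x _; rewrite derive1E; exact: (@derive_val _ _ _ _ _ _ _ (dF x)).
Qed.

(** The Cauchy density, up to the factor pi, cut off to an interval: a product of two of them
    dominates the smoothed point mass. *)
Definition cauchy (b e r x : R) : R := e / ((x - b) ^+ 2 + e ^+ 2) * \1_(`[b - r, b + r]%classic) x.

Lemma cauchy_ge0 b e r x : 0 < e -> 0 <= cauchy b e r x.
Proof. by move=> e0; rewrite /cauchy !mulr_ge0 ?invr_ge0 ?addr_ge0 ?sqr_ge0// ltW. Qed.

Lemma measurable_cauchy b e r : 0 < e -> measurable_fun [set: mR R] (cauchy b e r).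
Proof.
move=> e0; apply: measurable_funM; last exact: measurable_indic.
apply: continuous_measurable_fun => x.
apply: (@continuousM _ _ (cst e) (fun x : R => ((x - b) ^+ 2 + e ^+ 2)^-1)); first exact: cst_continuous.
apply: (@continuousV _ _ (fun x : R => (x - b) ^+ 2 + e ^+ 2)).
  by rewrite gt_eqF// ltr_wpDl ?sqr_ge0// exprn_gt0.
apply: continuousD; last exact: cst_continuous.
apply: (@continuous_comp _ _ _ (fun x : R => x - b) (fun y => y ^+ 2)).
  by apply: continuousB; [exact: cvg_id|exact: cst_continuous].
exact: exprn_continuous.
Qed.

Lemma integral_cauchy b e r : 0 < e -> 0 < r ->
  (\int[leb]_x (cauchy b e r x)%:E <= pi%:E)%E.
Proof.
move=> e0 r0; apply: le_trans (cauchy_mass b e0 r0).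
rewrite [leRHS]integral_mkcond le_eqVlt; apply/orP; left; apply/eqP.
apply: eq_integral => x _; rewrite /cauchy /patch indicE.
by case: ifP => _; rewrite ?mulr1 ?mulr0.
Qed.

Lemma sq_reg_ge0 c e z : 0 <= sq_reg c e z.
Proof. by rewrite addr_ge0 ?sqdist_ge0 ?sqr_ge0. Qed.

Lemma kernel_in_ge0 c e r z : 0 <= kernel_in c e r z.
Proof.
have /andP[h _] := smooth_pos_slope (log_pot c e r z).
by rewrite mulr_ge0// divr_ge0 ?exprn_ge0 ?sq_reg_ge0// mulr_ge0 ?sqr_ge0.
Qed.

Lemma kernel_out_ge0 c e r z : 0 <= kernel_out c e r z.
Proof.
by rewrite mulr_ge0 ?flatX3_ge0// divr_ge0 ?exprn_ge0 ?sq_reg_ge0// mulr_ge0 ?sqdist_ge0.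
Qed.

Lemma kernel_in_support c e r z : 0 < e -> 0 < r -> r ^+ 2 <= sqdist c z -> kernel_in c e r z = 0.
Proof.
move=> e0 r0; rewrite -(log_pot_le0 c e0 r0) => h.
by rewrite /kernel_in flat_le0// mul0r.
Qed.

Lemma kernel_out_support c e r z : 0 < e -> 0 < r -> r ^+ 2 <= sqdist c z -> kernel_out c e r z = 0.
Proof.
move=> e0 r0; rewrite -(log_pot_le0 c e0 r0) => h.
by rewrite /kernel_out flat_le0// mul0r.
Qed.

Lemma kernel_in_le c e r z : kernel_in c e r z <= 4 * e ^+ 2 / sq_reg c e z ^+ 2.
Proof.
have /andP[_ h] := smooth_pos_slope (log_pot c e r z).
by rewrite /kernel_in ler_piMl// divr_ge0 ?exprn_ge0 ?sq_reg_ge0// mulr_ge0 ?sqr_ge0.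
Qed.

Lemma Ck_kernel_in c e r k : 0 < e -> Ck k setT (kernel_in c e r).
Proof.
move=> e0; have oT := @openT (plane R).
have C1 := Ck_flat (1 + 'X) oT (Ck_log_pot c r e0 k).
have C2 := Ck_sq_regV c e0 k.
apply: (Ck_congr oT _ (CkM oT C1 (CkZ (4 * e ^+ 2) oT (CkM oT C2 C2)))) => z _.
by rewrite /kernel_in expr2 invfM.
Qed.

(** With E = e^2 this is (X + E) (Y + E) <= (X + Y + E)^2. *)
Lemma cauchy_product (X Y e : R) : 0 <= X -> 0 <= Y -> 0 < e ->
  e ^+ 2 / (X + Y + e ^+ 2) ^+ 2 <= e / (X + e ^+ 2) * (e / (Y + e ^+ 2)).
Proof.
move=> X0 Y0 e0; have E0 : 0 < e ^+ 2 by rewrite exprn_gt0.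
rewrite mulrACA -invfM -expr2; move: (e ^+ 2) E0 => E E0.
rewrite ler_wpM2l ?(ltW E0)// lef_pV2 ?posrE ?mulr_gt0 ?exprn_gt0 ?ltr_wpDl ?addr_ge0//.
by rewrite expr2 ler_pM ?addr_ge0 ?(ltW E0)//; lra.
Qed.

(** On the disc the kernel is at most 4 times a product of two Cauchy densities in the coordinates,
    each of mass at most pi, whatever e and r. *)
Lemma kernel_in_mass c e r : 0 < e -> 0 < r ->
  (\int[area R]_z (kernel_in c e r z)%:E <= (4 * pi ^+ 2)%:E)%E.
Proof.
move=> e0 r0.
have m1 : measurable_fun [set: mplane R] (fun z => cauchy c.1 e r z.1).
  by apply: (measurableT_comp (measurable_cauchy _ _ e0)).
have m2 : measurable_fun [set: mplane R] (fun z => cauchy c.2 e r z.2).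
  by apply: (measurableT_comp (measurable_cauchy _ _ e0)).
have mk : measurable_fun [set: mplane R] (kernel_in c e r).
  by apply: measurable_continuous_plane => z; exact: (Ck_cont (Ck_kernel_in c r 0 e0)).
apply: (@le_trans _ _ (\int[area R]_z (4 * (cauchy c.1 e r z.1 * cauchy c.2 e r z.2))%:E)%E).
  apply: ge0_le_integral => //.
  - by move=> z _; rewrite lee_fin kernel_in_ge0.
  - exact/measurable_EFinP.
  - by apply/measurable_EFinP; apply: measurable_funM => //; exact: measurable_funM.
  move=> z _; rewrite lee_fin.
  have [zr|zr] := leP (r ^+ 2) (sqdist c z).
    by rewrite kernel_in_support// mulr_ge0// mulr_ge0// cauchy_ge0.
  apply: le_trans (kernel_in_le c e r z) _.
  move: zr; rewrite /sq_reg /sqdist => zr.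
  have in_box (x y : R) : x ^+ 2 + y ^+ 2 < r ^+ 2 -> `|x| <= r.
    move=> h; rewrite -(ler_sqr (normr_ge0 x)) ?nnegrE ?(ltW r0)// real_normK ?num_real//.
    by have := sqr_ge0 y; lra.
  have := in_box _ _ zr; rewrite addrC in zr; have := in_box _ _ zr.
  rewrite !ler_norml => /andP[y1 y2] /andP[x1 x2].
  rewrite /cauchy !indicE !mem_set/=; [|by rewrite in_itv/=; lra..].
  rewrite !mulr1.
  have q0 (x : R) : 0 < x ^+ 2 + e ^+ 2 by rewrite ltr_wpDl ?sqr_ge0// exprn_gt0.
  have := q0 (z.1 - c.1); have := q0 (z.2 - c.2).
  rewrite -mulrA ler_wpM2l//.
  by apply: cauchy_product => //; exact: sqr_ge0.
have mc b : measurable_fun [set: mR R] (fun x => (cauchy b e r x)%:E).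
  by apply/measurable_EFinP; exact: measurable_cauchy.
have c0 b (x : R) : (0 <= (cauchy b e r x)%:E)%E by rewrite lee_fin cauchy_ge0.
have pi0 : (0 <= pi%:E :> \bar R)%E by rewrite lee_fin pi_ge0.
rewrite (@fubini_tonelli1 _ _ (mR R) (mR R) R leb leb (fun z => (4 * (cauchy c.1 e r z.1 * cauchy c.2 e r z.2))%:E)); last 2 first.
- by apply/measurable_EFinP; apply: measurable_funM => //; exact: measurable_funM.
- by move=> z; rewrite lee_fin mulr_ge0// mulr_ge0// cauchy_ge0.
apply: (@le_trans _ _ (\int[leb]_x ((4 * pi)%:E * (cauchy c.1 e r x)%:E))%E).
  apply: ge0_le_integral => //.
  - by move=> x _; apply: integral_ge0 => y _; rewrite lee_fin mulr_ge0// mulr_ge0// cauchy_ge0.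
  - have mF : measurable_fun [set: mplane R] (fun z => (4 * (cauchy c.1 e r z.1 * cauchy c.2 e r z.2))%:E).
      by apply/measurable_EFinP; apply: measurable_funM => //; exact: measurable_funM.
    have F0 (z : mplane R) : (0 <= (4 * (cauchy c.1 e r z.1 * cauchy c.2 e r z.2))%:E)%E.
      by rewrite lee_fin mulr_ge0// mulr_ge0// cauchy_ge0.
    by have := @measurable_fun_fubini_tonelli_F _ _ (mR R) (mR R) R leb _ mF F0.
  - by apply: emeasurable_funM => //; exact: mc.
  move=> x _; rewrite /fubini_F /=.
  rewrite (eq_integral (fun y : mR R => ((4 * cauchy c.1 e r x)%:E * (cauchy c.2 e r y)%:E)%E)); last first.
    by move=> y _; rewrite -EFinM mulrA.
  rewrite ge0_integralZl//; last by rewrite lee_fin mulr_ge0// cauchy_ge0.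
  have -> : ((4 * pi)%:E * (cauchy c.1 e r x)%:E = (4 * cauchy c.1 e r x)%:E * pi%:E)%E.
    by rewrite -!EFinM; congr EFin; ring.
  by apply: lee_wpmul2l; [rewrite lee_fin mulr_ge0// cauchy_ge0|exact: integral_cauchy].
rewrite ge0_integralZl//; last by rewrite lee_fin mulr_ge0// pi_ge0.
rewrite expr2 mulrA [leRHS]EFinM.
by apply: lee_wpmul2l; [rewrite lee_fin mulr_ge0 ?pi_ge0|exact: integral_cauchy].
Qed.

Lemma smooth_pos_le (s t : R) : 0 < s -> s <= t -> smooth_pos s <= smooth_pos t.
Proof.
move=> s0 st; have t0 := lt_le_trans s0 st.
rewrite /smooth_pos /flat s0 t0 !hornerC !mul1r ler_pM ?(ltW s0) ?expR_ge0//.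
by rewrite ler_expR lerN2 lef_pV2.
Qed.

Lemma small_square (a b e r : R) : 0 < e -> e <= r / 2 -> - (r / 4) <= a <= r / 4 ->
  - (r / 4) <= b <= r / 4 -> 2 * (a ^+ 2 + b ^+ 2 + e ^+ 2) <= r ^+ 2 + e ^+ 2.
Proof.
move=> e0 er /andP[a1 a2] /andP[b1 b2].
have A : a ^+ 2 <= (r / 4) ^+ 2 by rewrite -subr_ge0 subr_sqr mulr_ge0; lra.
have B : b ^+ 2 <= (r / 4) ^+ 2 by rewrite -subr_ge0 subr_sqr mulr_ge0; lra.
have E : e ^+ 2 <= (r / 2) ^+ 2 by rewrite -subr_ge0 subr_sqr mulr_ge0; lra.
move: A B E; rewrite !expr_div_n; move: (a ^+ 2) (b ^+ 2) (e ^+ 2) (r ^+ 2) (sqr_ge0 r) => A B E Q; lra.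
Qed.

(** On the square of half-side r / 4 around c, the condition e <= r / 2 gives 2 (|z - c|^2 + e^2) <=
    r^2 + e^2, so the potential is at least ln 2 there, independently of e. The square has side r /
    2, whence the constant. *)
Lemma green_kernel_mass c r : 0 < r -> exists2 m, 0 < m & forall e, 0 < e -> e <= r / 2 ->
  (m%:E <= \int[area R]_z (green_kernel c e r z)%:E)%E.
Proof.
move=> r0; exists (smooth_pos (ln 2) * (r / 2 * (r / 2))).
  have l2 : 0 < ln 2 :> R by rewrite ln_gt0// ltr1n.
  by rewrite !mulr_gt0 ?flat1_gt0 ?divr_gt0.
move=> e e0 er.
have mk : measurable_fun [set: mplane R] (green_kernel c e r).
  by apply: measurable_continuous_plane => z; exact: (Ck_cont (Ck_green_kernel c r e0 0)).
pose B := rect (c.1 - r / 4) (c.1 + r / 4) (c.2 - r / 4) (c.2 + r / 4) : set (mplane R).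
have mB : measurable B by exact: measurable_rect.
apply: (@le_trans _ _ (\int[area R]_(z in B) (green_kernel c e r z)%:E)%E); last first.
  apply: ge0_subset_integral => //; first exact/measurable_EFinP.
  by move=> z _; rewrite lee_fin green_kernel_ge0.
apply: (@le_trans _ _ (\int[area R]_(z in B) (cst (smooth_pos (ln 2))%:E z))%E).
  rewrite integral_cst//.
  have ab (b : R) : b - r / 4 <= b + r / 4 by lra.
  rewrite [X in (_ <= _ * X)%E](area_rect (ab c.1) (ab c.2)) -EFinM lee_fin.
  by rewrite (_ : (c.1 + _ - _) * _ = r / 2 * (r / 2))//; field.
have l2 : 0 < ln 2 :> R by rewrite ln_gt0// ltr1n.
apply: ge0_le_integral => //.
- by move=> z _; rewrite lee_fin smooth_pos_ge0.
- by apply/measurable_EFinP; exact: (measurable_funS measurableT _ mk).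
move=> z /rectP[/andP[z1 z2] /andP[z3 z4]].
rewrite lee_fin smooth_pos_le// /log_pot.
have S0 := sq_reg_gt0 c e0 z.
have H : 2 * sq_reg c e z <= r ^+ 2 + e ^+ 2.
  rewrite /sq_reg /sqdist.
  have a1 : -(r / 4) <= z.1 - c.1 <= r / 4 by lra.
  have a2 : -(r / 4) <= z.2 - c.2 <= r / 4 by lra.
  exact: small_square.
rewrite lerBrDr -lnM ?posrE ?ler_ln ?posrE//; first by rewrite mulr_gt0.
by rewrite addr_gt0 ?exprn_gt0.
Qed.
End KernelEstimates.

(** * Concentration at the pole and functions touched from above *)

Section Concentration.
Context {R : realType}.
Local Notation leb := (@lebesgue_measure R).
Implicit Types (V : set (plane R)).

Lemma usc_measurable V (v : plane R -> \bar R) : open V -> (forall z, V z -> usc_at v z) ->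
  measurable_fun (V : set (mplane R)) v.
Proof.
move=> oV uv; apply: (measurability _ (ErealGenInftyO.measurableE R)).
move=> /= _ [_ [a ->]] <-; apply: open_measurable_plane.
rewrite openE => z [Vz]; rewrite /= in_itv/= => va.
rewrite /interior; have nV : \forall w \near z, V w by exact: open_nbhs_nbhs.
by apply: filterS2 nV (uv z Vz a va) => w Vw wa; split=> //=; rewrite in_itv.
Qed.

Definition disc (c : plane R) (r : R) : set (plane R) := [set z | sqdist c z < r ^+ 2].

Lemma open_disc c r : open (disc c r).
Proof.
have -> : disc c r = setT `&` sqdist c @^-1` [set s | s < r ^+ 2] by rewrite setTI.
apply: open_preimage; [exact: openT| |exact: open_lt].
by move=> z _; exact: (Ck_cont (Ck_sqdist c 0)).
Qed.

Lemma closed_disc_box (c z : plane R) (r : R) : 0 < r -> sqdist c z <= r ^+ 2 ->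
  `|z.1 - c.1| <= r /\ `|z.2 - c.2| <= r.
Proof.
move=> r0; rewrite /sqdist => h; have [a b] := (sqr_ge0 (z.1 - c.1), sqr_ge0 (z.2 - c.2)).
split; rewrite -(ler_sqr (normr_ge0 _)) ?nnegrE ?(ltW r0)// real_normK ?num_real//; lra.
Qed.

Lemma area_disc c r : 0 < r -> (area R (disc c r) <= (16 * r ^+ 2)%:E)%E.
Proof.
move=> r0.
have ab (b : R) : b - 2 * r <= b + 2 * r by lra.
have := area_rect (ab c.1) (ab c.2).
rewrite (_ : (_ - _) * _ = 16 * r ^+ 2); last by ring.
move=> <-; apply: le_measure; rewrite ?inE.
- by apply: open_measurable_plane; exact: open_disc.
- exact: measurable_rect.
move=> z /ltW zr; have [] := closed_disc_box r0 zr.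
rewrite !ler_norml => /andP[? ?] /andP[? ?]; apply/rectP.
by split; apply/andP; split; lra.
Qed.

Lemma kernel_in_far (c z : plane R) (e r rho : R) : 0 < e -> 0 < rho -> rho ^+ 2 <= sqdist c z ->
  kernel_in c e r z <= 4 * e ^+ 2 / rho ^+ 4.
Proof.
move=> e0 p0 h; apply: le_trans (kernel_in_le c e r z) _.
have p2 : 0 < rho ^+ 2 by rewrite exprn_gt0.
have s0 := sq_reg_gt0 c e0 z.
apply: ler_wpM2l; first by rewrite mulr_ge0 ?sqr_ge0.
rewrite lef_pV2 ?posrE ?exprn_gt0//.
rewrite (exprM rho 2 2) ler_sqr ?nnegrE ?ltW//.
by apply: le_lt_trans h _; rewrite /sq_reg ltrDl exprn_gt0.
Qed.

(** Close to c the oscillation of Q is small and the mass of the kernel is bounded; at distance at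
    least rho the kernel itself is O(e^2), and Q - Q c is bounded. *)
Lemma kernel_in_concentrates (c : plane R) (r K : R) (Q : plane R -> R) : 0 < r ->
  measurable_fun (disc c r : set (mplane R)) Q -> {for c, continuous Q} ->
  (forall z, disc c r z -> `|Q z - Q c| <= K) ->
  forall eps, 0 < eps -> exists2 e1, 0 < e1 & forall e, 0 < e -> e <= e1 ->
    (\int[area R]_(z in disc c r) (`|Q z - Q c| * kernel_in c e r z)%:E <= eps%:E)%E.
Proof.
move=> r0 mQ cQ QK eps eps0.
have K0 : 0 <= K by apply: le_trans (QK c _); rewrite ?normr_ge0// /disc/= /sqdist !subrr expr0n/= addr0 exprn_gt0.
have pi2 : 0 < 4 * pi ^+ 2 :> R by rewrite mulr_gt0// exprn_gt0// pi_gt0.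
(* 4 pi^2 is the bound on the mass from [kernel_in_mass]. *)
have [d d0 dE] : exists2 d, 0 < d & d * (4 * pi ^+ 2) = eps / 2.
  by exists (eps / 2 / (4 * pi ^+ 2)); rewrite ?divfK ?gt_eqF// !divr_gt0.
have [rho rho0 Hrho] : exists2 rho, 0 < rho & forall z, sqdist c z < rho ^+ 2 -> `|Q z - Q c| <= d.
  have /cvgrPdist_le /(_ d d0) /nbhs_ballP [t /= t0 Ht] := cQ.
  exists (t / 2); first by rewrite divr_gt0.
  move=> z /ltW zt; rewrite distrC; apply: Ht; apply/ball_planeE.
  have t2 : 0 < t / 2 by rewrite divr_gt0.
  have [h1 h2] := closed_disc_box t2 zt.
  by rewrite (distrC c.1) (distrC c.2); split; lra.
(* The bound e1 <= 1 lets e^2 be replaced by e1; 16 r^2 bounds the area of the disc. *)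
have [e1 e10 [e11 He1]] : exists2 e1, 0 < e1 & e1 <= 1 /\ K * (4 * e1 / rho ^+ 4) * (16 * r ^+ 2) <= eps / 2.
  have p4 : 0 < rho ^+ 4 by rewrite exprn_gt0.
  have r2 : 0 < r ^+ 2 by rewrite exprn_gt0.
  have [N N0 NE] : exists2 N, 0 < N & K * (4 / rho ^+ 4) * (16 * r ^+ 2) <= N.
    exists (K * (4 / rho ^+ 4) * (16 * r ^+ 2) + 1); last by rewrite lerDl.
    by rewrite ltr_wpDl// !mulr_ge0// ?invr_ge0 ltW.
  have [d1 d10 [d11 d12 _]] := min3_exists (@ltr01 R) (divr_gt0 (divr_gt0 eps0 (@ltr0Sn R 1)) N0) (@ltr01 R).
  exists d1 => //; split => //.
  rewrite (_ : K * _ * _ = d1 * (K * (4 / rho ^+ 4) * (16 * r ^+ 2))); last by ring.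
  apply: le_trans (ler_wpM2l (ltW d10) NE) _.
  by rewrite -ler_pdivlMr.
exists e1 => // e e0 ee1.
have mD : measurable (disc c r : set (mplane R)) by apply: open_measurable_plane; exact: open_disc.
have mk : measurable_fun (disc c r : set (mplane R)) (kernel_in c e r).
  apply: (measurable_funS measurableT) => //.
  by apply: measurable_continuous_plane => z; exact: (Ck_cont (Ck_kernel_in c r 0 e0)).
pose N := K * (4 * e ^+ 2 / rho ^+ 4).
have N0 : 0 <= N by rewrite mulr_ge0// divr_ge0 ?exprn_ge0 ?(ltW rho0)// mulr_ge0 ?sqr_ge0.
apply: (@le_trans _ _ (\int[area R]_(z in disc c r) (d%:E * (kernel_in c e r z)%:E + cst N%:E z))%E).
  apply: ge0_le_integral => //.
  - by move=> z _; rewrite lee_fin mulr_ge0 ?kernel_in_ge0.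
  - apply/measurable_EFinP; apply: measurable_funM => //.
    by apply: measurableT_comp => //; apply: measurable_funB.
  - apply: emeasurable_funD => //; apply: emeasurable_funM => //; exact/measurable_EFinP.
  move=> z zr; rewrite /cst -EFinM -EFinD lee_fin.
  have k0 := kernel_in_ge0 c e r z.
  have [h|h] := ltP (sqdist c z) (rho ^+ 2).
    by apply: ler_wpDr => //; rewrite ler_wpM2r// Hrho.
  apply: ler_wpDl; first by rewrite mulr_ge0// ltW.
  by rewrite ler_pM// ?QK// kernel_in_far.
have mke : measurable_fun (disc c r : set (mplane R)) (fun z => (kernel_in c e r z)%:E).
  exact/measurable_EFinP.
have ke0 (z : mplane R) : disc c r z -> (0 <= (kernel_in c e r z)%:E)%E by rewrite lee_fin kernel_in_ge0.
have f1 (z : mplane R) : disc c r z -> (0 <= d%:E * (kernel_in c e r z)%:E)%E.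
  by move=> zr; rewrite mule_ge0 ?ke0// lee_fin ltW.
have f2 : measurable_fun (disc c r : set (mplane R)) (fun z => d%:E * (kernel_in c e r z)%:E)%E.
  exact: emeasurable_funM.
have f3 (z : mplane R) : disc c r z -> (0 <= cst N%:E z)%E by rewrite lee_fin.
rewrite (ge0_integralD _ mD f1 f2 f3)//.
have -> : eps = eps / 2 + eps / 2 by rewrite -splitr.
rewrite EFinD; apply: leeD.
  rewrite -dE EFinM (ge0_integralZl _ mD mke ke0) ?lee_fin ?(ltW d0)//.
  apply: lee_wpmul2l; first by rewrite lee_fin (ltW d0).
  apply: le_trans (kernel_in_mass c e0 r0).
  apply: ge0_subset_integral => //.
    by apply/measurable_EFinP; apply: measurable_continuous_plane => z; exact: (Ck_cont (Ck_kernel_in c r 0 e0)).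
  by move=> z _; rewrite lee_fin kernel_in_ge0.
rewrite integral_cst//.
apply: (@le_trans _ _ (N%:E * (16 * r ^+ 2)%:E)%E).
  by apply: lee_wpmul2l; [rewrite lee_fin|exact: area_disc].
rewrite -EFinM lee_fin; apply: le_trans He1.
apply: ler_wpM2r; first by rewrite mulr_ge0 ?sqr_ge0.
apply: ler_wpM2l => //; apply: ler_wpM2r; first by rewrite invr_ge0 exprn_ge0 ?(ltW rho0).
apply: ler_wpM2l => //; rewrite expr2 -[leRHS]mulr1.
by rewrite ler_pM// ?(ltW e0)//; exact: le_trans e11.
Qed.

Lemma emeasurable_patch (D : set (mplane R)) (h : mplane R -> \bar R) : measurable D ->
  measurable_fun D h -> measurable_fun setT (h \_ D).
Proof. by move=> mD mh; apply/(measurable_restrictT _ mD). Qed.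

(** Radial averages are taken of nonnegative functions, so the sub-mean value inequality for f <= C
    is turned into an upper bound for C - f. Integrability is recovered on the way: f is bounded
    above, and an infinite negative part would contradict the finite lower bound v0. *)
Lemma integral_deficit (f : mR R -> \bar R) (C v0 : R) :
  measurable_fun (`[0%R, (2 * pi)%R]%classic : set (mR R)) f ->
  (forall s, `[0%R, (2 * pi)%R]%classic s -> (f s <= C%:E)%E) ->
  (v0%:E <= ((2 * pi)^-1)%:E * \int[leb]_(s in `[0%R, (2 * pi)%R]) f s)%E ->
  (\int[leb]_(s in `[0%R, (2 * pi)%R]) (C%:E - f s) <= (2 * pi * (C - v0))%:E)%E.
Proof.
move=> mf fC v0f.
have pi2 : 0 < 2 * pi :> R by rewrite mulr_gt0// pi_gt0.
pose I := `[0%R, (2 * pi)%R]%classic : set (mR R).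
have mI : measurable I by exact: measurable_itv.
have lI : leb I = (2 * pi)%:E by rewrite /I lebesgue_measure_itv/= lte_fin pi2 oppr0 adde0.
have iC (k : R) : (\int[leb]_(s in I) cst k%:E s = (k * (2 * pi))%:E)%E.
  by rewrite EFinM -lI; exact: integral_cst.
have intf : leb.-integrable I f.
  have P : (\int[leb]_(s in I) f^\+ s < +oo)%E.
    apply: (@le_lt_trans _ _ (\int[leb]_(s in I) cst `|C|%:E s)%E).
      apply: ge0_le_integral => //; first exact: measurable_funepos.
      move=> s Is; rewrite funeposE /cst ge_max lee_fin normr_ge0 andbT.
      by apply: le_trans (fC s Is) _; rewrite lee_fin ler_norm.
    by rewrite iC ltry.
  have N : (\int[leb]_(s in I) f^\- s < +oo)%E.
    rewrite ltNge; apply/negP; rewrite leye_eq => /eqP N.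
    move: v0f; rewrite -/I integralE N; move: P; case: (\int[leb]_(s in I) f^\+ s)%E => [x| |] // _.
      by rewrite /= mulrNy gtr0_sg ?invr_gt0// mul1e.
    by rewrite /= mulrNy gtr0_sg ?invr_gt0// mul1e.
  apply/integrableP; split => //.
  rewrite (eq_integral (fun s => f^\+ s + f^\- s)%E); last first.
    by move=> s _; rewrite -[RHS]/((f^\+ \+ f^\-)%E s) -fune_abse.
  rewrite ge0_integralD//.
  - exact: lte_add_pinfty.
  - exact: measurable_funepos.
  - exact: measurable_funeneg.
have intC : leb.-integrable I (cst C%:E).
  apply/integrableP; split; first exact: measurable_cst.
  by rewrite (eq_integral (cst `|C|%:E)) ?iC ?ltry.
rewrite -/I.
have -> : (\int[leb]_(s in I) (C%:E - f s) = (2 * pi)%:E * C%:E - \int[leb]_(s in I) f s)%E.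
  have := integralB mI intC intf; rewrite iC mulrC EFinM; exact.
move: v0f; rewrite -/I.
have : (\int[leb]_(s in I) f s)%E \is a fin_num by exact: integrable_fin_num.
case: (\int[leb]_(s in I) f s)%E => // x _.
by rewrite -!EFinM !lee_fin ler_pdivlMl// => h; rewrite mulrBr lerD2l lerN2.
Qed.

Lemma sqdist_circle (c : plane R) (rho s : R) :
  sqdist c (c.1 + rho * cos s, c.2 + rho * sin s) = rho ^+ 2.
Proof.
rewrite /sqdist /= (addrC c.1) (addrC c.2) !addrK !exprMn -mulrDr cos2Dsin2 mulr1//.
Qed.

Lemma integral_circle_cst (K : R) :
  (\int[leb]_(s in `[0%R, (2 * pi)%R]) cst K%:E s <= (2 * pi)%:E * K%:E)%E.
Proof.
pose I := `[0%R, (2 * pi)%R]%classic : set (mR R).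
have mI : measurable I by exact: measurable_itv.
have lI : leb I = (2 * pi)%:E.
  by rewrite /I lebesgue_measure_itv/= lte_fin mulr_gt0 ?pi_gt0// oppr0 adde0.
by rewrite -lI muleC le_eqVlt; apply/orP; left; apply/eqP; exact: integral_cst.
Qed.

(** On small circles the mean of C - v is at most its value K at c, so its integral against the
    radial kernel is at most K times the mass. Splitting C - v into K - (Q - Q c) and the gap
    between Q and v, the first part cancels up to the integral of |Q - Q c|, which concentration
    makes small. *)
Lemma viscosity_plane V (v : plane R -> \bar R) (c : plane R) (Q : plane R -> R) (r K v0 : R) :
  open V -> psh_on V v -> 0 < r -> closed_disc c r `<=` V -> v c = v0%:E ->
  (forall z, V z -> {for z, continuous Q}) ->
  (forall z, closed_disc c r z -> `|Q z - Q c| <= K) ->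
  (forall z, closed_disc c r z -> (v z <= (v0 + (Q z - Q c))%:E)%E) ->
  forall eps, 0 < eps -> exists2 e1, 0 < e1 & forall e, 0 < e -> e <= e1 ->
    (\int[area R]_(z in disc c r)
       (((v0 + (Q z - Q c))%:E - v z) * (kernel_in c e r z)%:E) <= eps%:E)%E.
Proof.
move=> oV [uv sv] r0 dV vc cQ QK vQ eps eps0.
have cc : closed_disc c r c by rewrite /closed_disc/= !subrr expr0n/= addr0 sqr_ge0.
have K0 : 0 <= K by apply: le_trans (QK c cc); rewrite normr_ge0.
have dc z : disc c r z -> closed_disc c r z by move=> /ltW.
have mD : measurable (disc c r : set (mplane R)) by apply: open_measurable_plane; exact: open_disc.
have mC : measurable (closed_disc c r : set (mplane R)).
  have -> : closed_disc c r = ~` (~` closed_disc c r) by rewrite setCK.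
  apply: measurableC; apply: open_measurable_plane.
  have -> : ~` closed_disc c r = setT `&` sqdist c @^-1` [set s | r ^+ 2 < s].
    by rewrite setTI; apply/seteqP; split => z /=; rewrite /closed_disc/= -/(sqdist c z) ltNge => /negP.
  apply: open_preimage; [exact: openT| |exact: open_gt].
  by move=> z _; exact: (Ck_cont (Ck_sqdist c 0)).
have mV := open_measurable_plane oV.
have mv : measurable_fun (V : set (mplane R)) v.
  by apply: usc_measurable => // z Vz; exact: (uv z Vz).2.
have mQ : measurable_fun (V : set (mplane R)) Q by exact: open_continuous_measurable.
have mQd : measurable_fun (disc c r : set (mplane R)) Q.
  by apply: (measurable_funS mV) mQ => z /dc /dV.
have [e1 e10 He1] := kernel_in_concentrates r0 mQd (cQ c (dV _ cc)) (fun z zd => QK z (dc z zd)) eps0.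
exists e1 => // e e0 ee1; apply: le_trans (He1 e e0 ee1).
(* An upper bound for v on the disc, through Q; at the centre C - v equals K. *)
pose C := v0 + K.
have vC z : closed_disc c r z -> (v z <= C%:E)%E.
  move=> zc; apply: le_trans (vQ z zc) _; rewrite lee_fin lerD2l.
  by apply: le_trans (QK z zc); exact: ler_norm.
pose W : mplane R -> \bar R := ((fun z => C%:E - v z) \_ (closed_disc c r))%E.
have WE z : closed_disc c r z -> W z = (C%:E - v z)%E by move=> zc; rewrite /W /patch mem_set.
have W0 z : (0 <= W z)%E.
  rewrite /W /patch; case: ifPn => // /set_mem zc.
  by rewrite sube_ge0 ?vC ?orbT.
have mW : measurable_fun setT W.
  apply: emeasurable_patch => //; apply: emeasurable_funB => //.
  exact: (measurable_funS mV dV mv).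
have Wc : W c = K%:E by rewrite WE// vc -EFinB /C addrAC subrr add0r.
(* The kernel depends on z only through its squared distance to c; [eta] is that profile, read along
   a horizontal ray. *)
pose eta s := kernel_in c e r (c.1 + Num.sqrt s, c.2).
have radial z w : sqdist c z = sqdist c w -> kernel_in c e r z = kernel_in c e r w.
  by move=> h; rewrite /kernel_in /log_pot /sq_reg h.
have sq_eta s : 0 <= s -> sqdist c (c.1 + Num.sqrt s, c.2) = s.
  by move=> s0; rewrite /sqdist /= addrAC subrr add0r subrr expr0n addr0 sqr_sqrtr.
have etaE z : eta (sqdist c z) = kernel_in c e r z.
  by apply: radial; rewrite sq_eta// sqdist_ge0.
have meta : measurable_fun [set: mR R] eta.
  apply: continuous_measurable_fun => s.
  apply: (@continuous_comp _ _ _ (fun s : R => ((c.1 + Num.sqrt s, c.2) : plane R)) (kernel_in c e r)).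
    apply: continuous_pair; last exact: cst_continuous.
    by apply: continuousD; [exact: cst_continuous|exact: sqrt_continuous].
  exact: (Ck_cont (Ck_kernel_in c r 0 e0)).
have circ : (\int[area R]_z (W z * (kernel_in c e r z)%:E) <=
     W c * \int[area R]_z (kernel_in c e r z)%:E)%E.
  under eq_integral => z _ do rewrite -etaE.
  under [in leRHS]eq_integral => z _ do rewrite -etaE.
  apply: radial_submean => //; first by move=> s; exact: kernel_in_ge0.
    by rewrite Wc.
  move=> rho rho0 erho; rewrite Wc.
  have rr : rho ^+ 2 < r ^+ 2.
    rewrite ltNge; apply/negP => h; move/eqP: erho; apply.
    by apply: kernel_in_support => //; rewrite sq_eta ?sqr_ge0.
  have cs s : sqdist c (c.1 + rho * cos s, c.2 + rho * sin s) = rho ^+ 2.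
    exact: sqdist_circle.
  have cd s : closed_disc c r (c.1 + rho * cos s, c.2 + rho * sin s).
    by rewrite /closed_disc/= -/(sqdist c (_, _)) cs ltW.
  move: rho0; rewrite le_eqVlt => /predU1P[<-|rho0].
    rewrite (eq_integral (cst K%:E)); last first.
      by move=> s _; rewrite !mul0r !addr0 -surjective_pairing Wc.
    exact: integral_circle_cst.
  rewrite (eq_integral (fun s : mR R => C%:E - v (c.1 + rho * cos s, c.2 + rho * sin s)%R)%E); last first.
    by move=> s _; rewrite WE.
  rewrite -EFinM (_ : K = C - v0); last by rewrite /C addrAC subrr add0r.
  apply: integral_deficit.
  - have mvc : measurable_fun setT (v \_ (closed_disc c r) : mplane R -> \bar R).
      by apply: emeasurable_patch => //; exact: (measurable_funS mV dV mv).
    have mc : measurable_fun [set: mR R] (fun s => c.1 + rho * cos s : mR R).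
      apply: measurable_funD => //; apply: measurable_funM => //.
      by apply: continuous_measurable_fun; exact: continuous_cos.
    have ms : measurable_fun [set: mR R] (fun s => c.2 + rho * sin s : mR R).
      apply: measurable_funD => //; apply: measurable_funM => //.
      by apply: continuous_measurable_fun; exact: continuous_sin.
    apply: (measurable_funS measurableT) => //.
    have := measurableT_comp mvc (measurable_fun_pair mc ms).
    apply: eq_measurable_fun => s _; rewrite /= /patch mem_set//; exact: cd.
  - by move=> s _; apply: vC.
  - rewrite -vc; apply: sv => // z zz; apply: dV; apply: le_trans (ltW rr); exact: zz.
have mk : measurable_fun (disc c r : set (mplane R)) (kernel_in c e r).
  apply: (measurable_funS measurableT) => //.
  by apply: measurable_continuous_plane => z; exact: (Ck_cont (Ck_kernel_in c r 0 e0)).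
have mke : measurable_fun (disc c r : set (mplane R)) (fun z => (kernel_in c e r z)%:E).
  exact/measurable_EFinP.
have k0 z : (0 <= (kernel_in c e r z)%:E)%E by rewrite lee_fin kernel_in_ge0.
have kD z : ~ disc c r z -> kernel_in c e r z = 0.
  by move=> /negP; rewrite /disc/= -leNgt => h; exact: kernel_in_support.
have intD (F : mplane R -> \bar R) : (\int[area R]_z (F z * (kernel_in c e r z)%:E) =
    \int[area R]_(z in disc c r) (F z * (kernel_in c e r z)%:E))%E.
  rewrite [RHS]integral_mkcond; apply: eq_integral => z _; rewrite /patch.
  by case: ifPn => // /negP; rewrite in_setE => /kD ->; rewrite mule0.
pose a z := (K - (Q z - Q c)) * kernel_in c e r z.
have ma : measurable_fun (disc c r : set (mplane R)) (fun z => (a z)%:E).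
  apply/measurable_EFinP; apply: measurable_funM => //.
  by apply: measurable_funB => //; apply: measurable_funB.
have QK1 z : disc c r z -> 0 <= K - (Q z - Q c).
  by move=> /dc zc; rewrite subr_ge0; apply: le_trans (QK z zc); exact: ler_norm.
have a0 z : disc c r z -> (0 <= (a z)%:E)%E.
  by move=> zd; rewrite lee_fin mulr_ge0 ?kernel_in_ge0 ?QK1.
have K2 z : disc c r z -> K - (Q z - Q c) <= 2 * K.
  by move=> /dc zc; have := QK z zc; rewrite ler_norml => /andP[]; lra.
have mkT : measurable_fun [set: mplane R] (fun z => (kernel_in c e r z)%:E).
  by apply/measurable_EFinP; apply: measurable_continuous_plane => z; exact: (Ck_cont (Ck_kernel_in c r 0 e0)).
have massD : (\int[area R]_(z in disc c r) (kernel_in c e r z)%:E <= (4 * pi ^+ 2)%:E)%E.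
  by apply: le_trans (kernel_in_mass c e0 r0); exact: ge0_subset_integral.
have massT : (\int[area R]_z (K%:E * (kernel_in c e r z)%:E) = K%:E * \int[area R]_z (kernel_in c e r z)%:E)%E.
  by rewrite ge0_integralZl.
(* Finiteness of this integral allows it to be added to both sides of the inequality. *)
have ia : (\int[area R]_(z in disc c r) (a z)%:E)%E \is a fin_num.
  rewrite ge0_fin_numE; last exact: integral_ge0.
  apply: (@le_lt_trans _ _ ((2 * K)%:E * (4 * pi ^+ 2)%:E)%E); last by rewrite -EFinM ltry.
  apply: (@le_trans _ _ ((2 * K)%:E * \int[area R]_(z in disc c r) (kernel_in c e r z)%:E)%E); last first.
    by apply: lee_wpmul2l => //; rewrite lee_fin mulr_ge0.
  rewrite -ge0_integralZl// ?lee_fin ?mulr_ge0//.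
  apply: ge0_le_integral => //; first by apply: emeasurable_funM.
  by move=> z zd; rewrite -EFinM lee_fin ler_wpM2r ?kernel_in_ge0 ?K2.
pose B z := (`|Q z - Q c| * kernel_in c e r z)%:E.
have B0 z : disc c r z -> (0 <= B z)%E by move=> _; rewrite lee_fin mulr_ge0 ?kernel_in_ge0.
have mB : measurable_fun (disc c r : set (mplane R)) B.
  apply/measurable_EFinP; apply: measurable_funM => //.
  by apply: measurableT_comp => //; apply: measurable_funB.
pose w z := (((v0 + (Q z - Q c))%:E - v z) * (kernel_in c e r z)%:E)%E.
have w0' z : disc c r z -> (0 <= (v0 + (Q z - Q c))%:E - v z)%E.
  by move=> /dc zc; rewrite sube_ge0 ?vQ ?orbT.
have w0 z : disc c r z -> (0 <= w z)%E by move=> zd; rewrite mule_ge0 ?w0'.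
have mw : measurable_fun (disc c r : set (mplane R)) w.
  apply: emeasurable_funM => //; apply: emeasurable_funB.
    by apply/measurable_EFinP; apply: measurable_funD => //; apply: measurable_funB.
  by apply: (measurable_funS mV) mv => z /dc /dV.
rewrite -(leeD2lE _ _ ia) -(ge0_integralD _ mD a0 ma w0 mw).
apply: (@le_trans _ _ (\int[area R]_(z in disc c r) (W z * (kernel_in c e r z)%:E))%E).
  rewrite le_eqVlt; apply/orP; left; apply/eqP; apply: eq_integral => z; rewrite inE => zd.
  rewrite (WE z (dc z zd)) /a EFinM /w -ge0_muleDl ?lee_fin ?QK1// ?w0'//.
  congr (_ * _)%E; rewrite addeA -EFinD; congr (_%:E - _)%E.
  by rewrite /C addrCA subrK.
rewrite -intD; apply: le_trans circ _.
rewrite Wc -massT (intD (cst K%:E)) -(ge0_integralD _ mD a0 ma B0 mB).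
have f1 z : disc c r z -> (0 <= K%:E * (kernel_in c e r z)%:E)%E by rewrite mule_ge0// lee_fin.
apply: ge0_le_integral => //.
- by apply: emeasurable_funM.
- exact: emeasurable_funD.
move=> z zd; rewrite /a /B -EFinM -EFinD lee_fin -mulrDl ler_wpM2r ?kernel_in_ge0//.
by rewrite -addrA lerDl addrC subr_ge0 ler_norm.
Qed.

End Concentration.

(** * Forms on the surface *)

Section Atlas.
Context {R : realType} {X : compactRiemannSurface R}.
Implicit Types (i j : chart X) (x : X) (z : plane R).

Definition overlap i j : set (plane R) := img i `&` param i @^-1` dom j.

Definition trans i j : plane R -> plane R := Defs.coord j \o param i.

Lemma open_overlap i j : open (overlap i j).
Proof.
apply: open_preimage; [exact: img_open| |exact: dom_open].
by move=> z zi; exact: param_continuous.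
Qed.

Lemma overlap_trans i j z : overlap i j z -> overlap j i (trans i j z).
Proof.
move=> [zi zj]; split; first exact: coord_img.
by rewrite /preimage/= /trans/= coordK//; exact: param_dom.
Qed.

Lemma param_trans i j z : overlap i j z -> param j (trans i j z) = param i z.
Proof. by move=> [_ zj]; rewrite /trans/= coordK. Qed.

Lemma transK i j z : overlap i j z -> trans j i (trans i j z) = z.
Proof. by move=> zij; have [zi _] := zij; rewrite {1}/trans/= param_trans// paramK. Qed.

Lemma trans_holomorphic i j : holomorphic_on (overlap i j) (trans i j).
Proof. exact: transition_holomorphic. Qed.

Lemma trans_gt0 i j z : overlap i j z -> 0 < Defs.jacobian (trans i j) z.
Proof.
exact (@jacobian_gt0 _ _ _ _ _ (@open_overlap i j) (@open_overlap j i) (trans_holomorphic i j)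
  (trans_holomorphic j i) (@overlap_trans i j) (@transK i j) z).
Qed.

Lemma trans_change i j (G : mplane R -> \bar R) :
  measurable_fun (overlap j i : set (mplane R)) G ->
  (forall z, overlap j i z -> (0 <= G z)%E) ->
  (\int[area R]_(z in overlap i j) (G (trans i j z) * (Defs.jacobian (trans i j) z)%:E) =
   \int[area R]_(z in overlap j i) G z)%E.
Proof.
exact (@change_of_variables _ _ _ _ _ (@open_overlap i j) (@open_overlap j i) (trans_holomorphic i j)
  (trans_holomorphic j i) (@overlap_trans i j) (@overlap_trans j i) (@transK i j) (@transK j i) G).
Qed.

Lemma mult_ge1 x : 1 <= mult x :> R.
Proof.
have [i xi] := dom_cover x.
rewrite /mult (bigD1 i)//= indicE mem_set// lerDl.
by apply: sumr_ge0 => j _; rewrite indicE ler0n.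
Qed.

Lemma mult_gt0 x : 0 < mult x :> R.
Proof. exact: lt_le_trans (mult_ge1 x). Qed.

Lemma indic_overlap i j z : img i z -> \1_(overlap i j) z = \1_(dom j) (param i z) :> R.
Proof.
move=> zi; rewrite !indicE; congr ((_ : bool)%:R).
by apply/idP/idP; rewrite !inE; [case|split].
Qed.

Lemma measurable_img i : measurable (img i : set (mplane R)).
Proof. by apply: open_measurable_plane; exact: img_open. Qed.

Lemma measurable_overlap i j : measurable (overlap i j : set (mplane R)).
Proof. by apply: open_measurable_plane; exact: open_overlap. Qed.

Lemma measurable_mult i : measurable_fun (img i : set (mplane R)) (fun z => (mult (param i z))^-1).
Proof.
have m1 : measurable_fun (img i : set (mplane R)) (fun z => \sum_(j : chart X) (\1_(overlap i j) z : R)).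
  apply: measurable_sum => j; apply: measurable_indic; apply: open_measurable_plane.
  exact: open_overlap.
have m2 : measurable_fun (img i : set (mplane R)) (fun z => mult (param i z) : R).
  apply: (eq_measurable_fun _ _ m1) => z; rewrite inE => zi; apply: eq_bigr => j _.
  exact: indic_overlap.
apply: (@measurable_comp _ _ _ _ _ _ [set s : R | 0 < s] (fun s : R => s^-1)) m2.
- by apply: open_measurable; exact: open_gt.
- by move=> _ [z _ <-]; exact: mult_gt0.
apply: open_continuous_measurable_fun; first exact: open_gt.
by move=> s; rewrite inE/= => s0; apply: inv_continuous; rewrite gt_eqF.
Qed.

Definition form_measurable (a : chart X -> plane R -> \bar R) :=
  forall i, measurable_fun (img i : set (mplane R)) (a i).

(* A form with extended real coefficients transforming as a 2-form between the
   charts i and j and vanishing outside the domain of j. *)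
Definition carried_by j (a : chart X -> plane R -> \bar R) := forall i,
  (forall z, overlap i j z -> a i z = (a j (trans i j z) * (Defs.jacobian (trans i j) z)%:E)%E) /\
  (forall z, img i z -> ~ dom j (param i z) -> a i z = 0%E).

(** The change of variables moves the integral over each chart i to the overlap seen in chart j.
    There the weights 1 / mult, one for each chart containing the point, add up to 1. *)
Lemma form_int_carried_ge0 j (a : chart X -> plane R -> \bar R) : form_measurable a ->
  (forall i z, img i z -> (0 <= a i z)%E) -> carried_by j a ->
  form_int a = (\int[area R]_(z in img j) a j z)%E.
Proof.
move=> ma a0 ca; rewrite /form_int.
pose G z : \bar R := (a j z * ((mult (param j z))^-1)%:E)%E.
have mG : measurable_fun (img j : set (mplane R)) G.
  by apply: emeasurable_funM => //; apply/measurable_EFinP; exact: measurable_mult.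
have inv0 x : (0 <= ((mult x)^-1)%:E :> \bar R)%E by rewrite lee_fin invr_ge0 ltW// mult_gt0.
have G0 z : img j z -> (0 <= G z)%E by move=> zj; rewrite mule_ge0 ?a0.
have mU i : measurable_fun (img j : set (mplane R)) (fun z => (G z * (\1_(overlap j i) z)%:E)%E).
  apply: emeasurable_funM => //; apply/measurable_EFinP; apply: measurable_indic.
  exact: measurable_overlap.
have step i : (\int[area R]_(z in img i) (a i z * ((mult (param i z))^-1)%:E) =
    \int[area R]_(z in img j) (G z * (\1_(overlap j i) z)%:E))%E.
  transitivity (\int[area R]_(z in overlap i j) (G (trans i j z) * (Defs.jacobian (trans i j) z)%:E))%E.
    rewrite integral_mkcond [RHS]integral_mkcond; apply: eq_integral => z _; rewrite /patch.
    case: ifPn; rewrite ?notin_setE ?in_setE => zi; case: ifPn; rewrite ?notin_setE ?in_setE => // zij.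
    - by rewrite (ca i).1// /G param_trans// -!muleA (muleC (Defs.jacobian _ _)%:E).
    - by rewrite (ca i).2 ?mul0e// => zj; apply: zij; split.
    - by case: zi; case: zij.
  rewrite trans_change; last 2 first.
  - by apply: (measurable_funS (measurable_img j)) mG => z [].
  - by move=> z [zj _]; exact: G0.
  rewrite integral_mkcond [RHS]integral_mkcond; apply: eq_integral => z _; rewrite /patch indicE.
  case: ifPn; rewrite ?notin_setE ?in_setE => zi; case: ifPn; rewrite ?notin_setE ?in_setE => // zij.
  - by rewrite mule1.
  - by case: zij; case: zi.
  - by rewrite mule0.
rewrite (eq_bigr _ (fun i _ => step i)) -ge0_integral_sum//; last 2 first.
- exact: measurable_img.
- by move=> i z zj; rewrite mule_ge0 ?G0// lee_fin.
apply: eq_integral => z; rewrite inE => zj.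
rewrite -ge0_sume_distrr; last by move=> i _; rewrite lee_fin.
rewrite sumEFin /G -muleA -EFinM (_ : _ * _ = 1) ?mule1//.
rewrite (_ : \sum_i _ = mult (param j z)) ?mulVf ?gt_eqF ?mult_gt0//.
by apply: eq_bigr => i _; exact: indic_overlap.
Qed.

Lemma mule_pos_DEl (x y : \bar R) (k : R) : 0 < k -> ((x + y) * k%:E = x * k%:E + y * k%:E)%E.
Proof.
move=> k0; case: x y => [x| |] [y| |] //=.
- by rewrite -!EFinD -!EFinM mulrDl.
all: rewrite ?gt0_mulye ?gt0_mulNye ?lte_fin//.
Qed.

Definition form_integrable (a : chart X -> plane R -> \bar R) :=
  forall i, (area R).-integrable (img i : set (mplane R)) (a i).

Implicit Types (a b : chart X -> plane R -> \bar R).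

Lemma inv_mult01 x : 0 <= (mult x)^-1 <= (1 : R).
Proof. by rewrite invr_ge0 (ltW (mult_gt0 x)) invf_le1 ?mult_gt0 ?mult_ge1. Qed.

Lemma form_integrable_mult a i : form_integrable a ->
  (area R).-integrable (img i : set (mplane R)) (fun z => (a i z * ((mult (param i z))^-1)%:E)%E).
Proof.
move=> ia; apply: le_integrable (ia i); first exact: measurable_img.
  apply: emeasurable_funM; first by case/integrableP: (ia i).
  by apply/measurable_EFinP; exact: measurable_mult.
move=> z _; have /andP[m0 m1] := inv_mult01 (param i z).
by rewrite abseM /= (ger0_norm m0) -[leRHS]mule1 lee_wpmul2l// lee_fin.
Qed.

Lemma form_int_fin_num a : form_integrable a -> form_int a \is a fin_num.
Proof.
move=> ia; rewrite /form_int; rewrite sum_fin_num; apply/allP => _ /mapP[i _ ->].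
apply: integrable_fin_num; first exact: measurable_img.
exact: form_integrable_mult.
Qed.

Lemma form_int_congr a b : (forall i z, img i z -> a i z = b i z) -> form_int a = form_int b.
Proof.
by move=> ab; apply: eq_bigr => i _; apply: eq_integral => z; rewrite inE => zi; rewrite ab.
Qed.

Lemma form_integrableD a b : form_integrable a -> form_integrable b ->
  form_integrable (fun i z => a i z + b i z)%E.
Proof. by move=> ia ib i; apply: integrableD; [exact: measurable_img|..]. Qed.

Lemma form_intD a b : form_integrable a -> form_integrable b ->
  form_int (fun i z => a i z + b i z)%E = (form_int a + form_int b)%E.
Proof.
move=> ia ib; rewrite /form_int -big_split/=; apply: eq_bigr => i _.
rewrite -integralD; [|exact: measurable_img|exact: form_integrable_mult..].
apply: eq_integral => z _; apply: mule_pos_DEl.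
by rewrite invr_gt0 mult_gt0.
Qed.

Lemma form_integrableZ (k : R) a : form_integrable a ->
  form_integrable (fun i z => k%:E * a i z)%E.
Proof. by move=> ia i; apply: integrableZl; [exact: measurable_img|]. Qed.

Lemma form_intZ (k : R) a : form_integrable a ->
  form_int (fun i z => k%:E * a i z)%E = (k%:E * form_int a)%E.
Proof.
move=> ia; rewrite /form_int fin_num_sume_distrr//; last first.
  move=> i j _ _; apply: fin_num_adde_defr; apply: integrable_fin_num; first exact: measurable_img.
  exact: form_integrable_mult.
apply: eq_bigr => i _.
rewrite -integralZl; [|exact: measurable_img|exact: form_integrable_mult].
by apply: eq_integral => z _; rewrite muleA.
Qed.

Lemma form_int_ge0 a : (forall i z, img i z -> (0 <= a i z)%E) -> (0 <= form_int a)%E.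
Proof.
move=> a0; apply: sume_ge0 => i _; apply: integral_ge0 => z zi.
by rewrite mule_ge0 ?a0// lee_fin; case/andP: (inv_mult01 (param i z)).
Qed.

Lemma le_form_int a b : form_integrable a -> form_integrable b ->
  (forall i z, img i z -> (a i z <= b i z)%E) -> (form_int a <= form_int b)%E.
Proof.
move=> ia ib ab; apply: lee_sum => i _.
apply: le_integral; [exact: measurable_img|exact: form_integrable_mult..|].
move=> z; rewrite inE => zi; have /andP[m0 _] := inv_mult01 (param i z).
by apply: lee_wpmul2r; rewrite ?lee_fin// ab.
Qed.

Lemma carried_max (x y : \bar R) (k : R) : 0 < k -> x = (y * k%:E)%E ->
  maxe x 0%E = (maxe y 0%E * k%:E)%E /\ maxe (- x)%E 0%E = (maxe (- y)%E 0%E * k%:E)%E.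
Proof.
move=> k0 ->; have kE : (0 <= k%:E :> \bar R)%E by rewrite lee_fin ltW.
by rewrite !(muleC _ k%:E) !maxe_pMr// !mule0 muleN.
Qed.

(** Transition jacobians are positive, so the positive and negative parts of a carried form are
    carried too, and the nonnegative case applies to each. *)
Lemma form_int_carried j a : form_integrable a -> carried_by j a ->
  form_int a = (\int[area R]_(z in img j) a j z)%E.
Proof.
move=> ia ca.
have ma : form_measurable a by move=> i; case/integrableP: (ia i).
have P : form_int (fun i => (a i)^\+)%E = (\int[area R]_(z in img j) (a j)^\+ z)%E.
  apply: form_int_carried_ge0.
  - by move=> i; exact: measurable_funepos.
  - by move=> i z _; exact: funepos_ge0.
  split=> z; [move=> zij|move=> zi zj]; rewrite !funeposE; last by rewrite (ca i).2// maxxx.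
  exact: (carried_max (trans_gt0 zij) ((ca i).1 z zij)).1.
have N : form_int (fun i => (a i)^\-)%E = (\int[area R]_(z in img j) (a j)^\- z)%E.
  apply: form_int_carried_ge0.
  - by move=> i; exact: measurable_funeneg.
  - by move=> i z _; exact: funeneg_ge0.
  split=> z; [move=> zij|move=> zi zj]; rewrite !funenegE; last by rewrite (ca i).2// oppe0 maxxx.
  exact: (carried_max (trans_gt0 zij) ((ca i).1 z zij)).2.
have iP : form_integrable (fun i => (a i)^\+)%E.
  by move=> i; apply: integrable_funepos; [exact: measurable_img|].
have iN : form_integrable (fun i => (a i)^\-)%E.
  by move=> i; apply: integrable_funeneg; [exact: measurable_img|].
rewrite [RHS]integralE -P -N.
have -> : (- form_int (fun i => (a i)^\-) = (-1)%:E * form_int (fun i => (a i)^\-))%E.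
  by rewrite EFinN mulN1e.
rewrite -form_intZ// -form_intD//; last exact: form_integrableZ.
apply: form_int_congr => i z _; rewrite EFinN mulN1e.
by have /(congr1 (fun h => h z)) := funeposneg (a i).
Qed.

End Atlas.
Arguments open_overlap {R X} i j.

Lemma flat1_le {R : realType} (s t : R) : 0 < t -> s <= t -> flat 1 s <= flat 1 t.
Proof.
move=> t0 st; have [s0|s0] := leP s 0; first by rewrite flat_le0// flat1_ge0.
by rewrite /flat s0 t0 !hornerC !mul1r ler_expR lerN2 lef_pV2.
Qed.

(** * Functions supported in a chart and partitions of unity *)

Section ChartFunctions.
Context {R : realType} {X : compactRiemannSurface R}.
Implicit Types (i j : chart X) (x : X) (z : plane R) (k : nat).

Definition CkX k (h : X -> R) := forall i, Ck k (img i) (h \o @param R X i).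

Lemma near_dom i x : dom i x -> \forall y \near x, dom i y.
Proof. by move=> xi; apply: open_nbhs_nbhs; split => //; exact: dom_open. Qed.

Lemma near_img i z : img i z -> \forall w \near z, img i w.
Proof. by move=> zi; apply: open_nbhs_nbhs; split => //; exact: img_open. Qed.

Lemma Ck0_continuous (h : X -> R) i x : dom i x -> Ck 0 (img i) (h \o @param R X i) ->
  {for x, continuous h}.
Proof.
move=> xi hc.
have c1 : {for x, continuous ((h \o @param R X i) \o @Defs.coord R X i)}.
  exact (continuous_comp (@Defs.coord_continuous R X i x xi) (Ck_cont hc (coord_img xi))).
rewrite /prop_for /continuous_at in c1 *.
rewrite /= (coordK xi) in c1; apply: cvg_trans c1; apply: near_eq_cvg.
by near=> y; rewrite /= coordK//; near: y; exact: near_dom.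
Unshelve. all: by end_near. Qed.

Lemma CkX_continuous k (h : X -> R) : CkX k h -> continuous h.
Proof.
by move=> hk x; have [i xi] := dom_cover x; apply: (Ck0_continuous xi); exact: (Ck_le (leq0n k) (hk i)).
Qed.

Lemma Ck_trans k i j (h : plane R -> R) : Ck k (img j) h -> Ck k (overlap i j) (h \o trans i j).
Proof.
move=> hj; have [t1 t2 _] := trans_holomorphic i j.
apply: (Ck_congr (open_overlap i j) _ (Ck_comp (open_overlap i j) (@img_open R X j) hj (t1 k) (t2 k) _)).
  by move=> z zij; rewrite -surjective_pairing.
by move=> z zij; rewrite -surjective_pairing; case: (overlap_trans zij).
Qed.

Definition chart_ext j (h : plane R -> R) (x : X) : R :=
  if `[< dom j x >] then h (Defs.coord j x) else 0.

(* h vanishes off the copy in X of the compact subset K of the image of the chart j. *)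
Definition supported_in j (K : set (plane R)) (h : X -> R) :=
  [/\ compact K, K `<=` img j & forall x, h x != 0 -> dom j x /\ K (Defs.coord j x)].

Lemma closed_param_image j K : compact K -> K `<=` img j -> closed (@param R X j @` K).
Proof.
move=> cK Kj; apply: compact_closed; first exact: rs_hausdorff.
apply: continuous_compact => //; apply: continuous_in_subspaceT => z; rewrite inE => /Kj.
exact: param_continuous.
Qed.

Lemma chart_ext_param j h z : img j z -> chart_ext j h (param j z) = h z.
Proof. by move=> zj; rewrite /chart_ext asboolT ?paramK//; exact: param_dom. Qed.

Lemma chart_ext_overlap i j h z : overlap i j z -> chart_ext j h (param i z) = h (trans i j z).
Proof. by move=> [zi zj]; rewrite /chart_ext asboolT. Qed.

(** The copy of K in X is compact, hence closed as X is Hausdorff. So outside the chart h vanishes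
    on a whole neighbourhood, which is what derivatives see. *)
Lemma supported_far i j K h z : supported_in j K h -> img i z -> ~ dom j (param i z) ->
  \forall w \near z, h (param i w) = 0.
Proof.
move=> [cK Kj hK] zi zj.
have oC : open (~` (@param R X j @` K)) by apply: closed_openC; exact: closed_param_image.
have : \forall w \near z, (~` (@param R X j @` K)) (param i w).
  apply: (param_continuous zi); apply: open_nbhs_nbhs; split => //.
  by move=> [w Kw wz]; apply: zj; rewrite -wz; exact: (param_dom (Kj w Kw)).
apply: filterS => w Hw; apply/eqP; apply: contra_notT Hw => /hK[wj Kw].
by exists (Defs.coord j (param i w)) => //; rewrite coordK.
Qed.

Lemma chart_ext_supported j K h : compact K -> K `<=` img j ->
  (forall z, img j z -> ~ K z -> h z = 0) -> supported_in j K (chart_ext j h).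
Proof.
move=> cK Kj h0; split => // x; rewrite /chart_ext; case: asboolP => [xj|]; last by rewrite eqxx.
move=> hx; split => //; apply: contrapT => /(h0 _ (coord_img xj)) h0x.
by rewrite h0x eqxx in hx.
Qed.

Lemma CkX_chart_ext k j K h : compact K -> K `<=` img j ->
  (forall z, img j z -> ~ K z -> h z = 0) -> Ck k (img j) h -> CkX k (chart_ext j h).
Proof.
move=> cK Kj h0 hk i; apply/Ck_pt => z zi.
have [zj|zj] := pselect (dom j (param i z)).
  have zij : overlap i j z by split.
  apply: (@Ck_near _ k (h \o trans i j)); last first.
    by move/Ck_pt: (Ck_trans i hk) => /(_ z zij).
  apply: (near_open (open_overlap i j) zij) => w wij.
  by rewrite /= chart_ext_overlap.
apply: (@Ck_near _ k (cst 0)); last by move/Ck_pt: (Ck_cst k (0 : R) (@openT (plane R))) => /(_ z I).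
have := supported_far (chart_ext_supported cK Kj h0) zi zj.
by apply: filterS => w /= ->.
Qed.

(** In a chart this is exp (-1 / t) at t = r^2 - |w - z0|^2, normalised to 1 at the centre. The
    compact square K contains the disc of radius r and stays inside both the chart and N. *)
Lemma bump_exists x (N : set X) : nbhs x N -> exists (jK : chart X * set (plane R)) (b : X -> R),
  [/\ forall k, CkX k b, supported_in jK.1 jK.2 b, forall y, 0 <= b y <= 1, b x = 1 &
      forall y, b y != 0 -> N y].
Proof.
move=> xN; have [j xj] := dom_cover x.
have zj := coord_img xj; set z0 := Defs.coord j x in zj *.
have Nz : \forall w \near z0, img j w /\ N (param j w).
  have n1 := near_img zj.
  have n2 : \forall w \near z0, N (param j w).
    by apply: (param_continuous zj); rewrite coordK.
  by apply: filterS2 n1 n2.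
have [d /= d0 Hd] := (nbhs_ballP z0 _).1 Nz.
have [r r0 rd] : exists2 r : R, 0 < r & r < d.
  by exists (d / 2); [rewrite divr_gt0|rewrite ltr_pdivrMr// ltr_pMr// ltr1n].
pose K := boxc (z0.1 - r) (z0.1 + r) (z0.2 - r) (z0.2 + r).
have Kd w : K w -> img j w /\ N (param j w).
  move=> /boxcP[/andP[? ?] /andP[? ?]]; apply: Hd; apply/ball_planeE; rewrite !ltr_norml.
  by split; apply/andP; split; lra.
have cK : compact K by exact: compact_boxc.
have Kj : K `<=` img j by move=> w /Kd[].
pose h w := flat 1 (r ^+ 2 - sqdist z0 w) / flat 1 (r ^+ 2).
have h1 : 0 < flat 1 (r ^+ 2) :> R by rewrite flat1_gt0 exprn_gt0.
have hout w : img j w -> ~ K w -> h w = 0.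
  move=> _ Kw; rewrite /h flat_le0 ?mul0r// subr_le0.
  apply: contra_notT Kw; rewrite -ltNge => /ltW/(closed_disc_box r0)[].
  rewrite !ler_norml => /andP[? ?] /andP[? ?]; apply/boxcP.
  by split; apply/andP; split; lra.
have hk k (U : set (plane R)) : open U -> Ck k U h.
  move=> oU; have C1 : Ck k U (fun w => r ^+ 2 - sqdist z0 w).
    apply: CkB => //; first exact: Ck_cst.
    by apply/Ck_pt => w _; move/Ck_pt: (Ck_sqdist z0 k) => /(_ w I).
  apply: (Ck_congr oU _ (CkZ (flat 1 (r ^+ 2))^-1 oU (Ck_flat 1 oU C1))) => w _.
  by rewrite mulrC.
have h01 w : 0 <= h w <= 1.
  rewrite divr_ge0 ?flat1_ge0//= /h ler_pdivrMr// mul1r.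
  apply: flat1_le; first by rewrite exprn_gt0.
  by rewrite gerBl sqdist_ge0.
exists (j, K), (chart_ext j h); split => //=.
- by move=> k; apply: (CkX_chart_ext cK Kj hout); apply: hk; exact: img_open.
- exact: chart_ext_supported.
- by move=> y; rewrite /chart_ext; case: asboolP => // _; rewrite lexx ler01.
- rewrite /chart_ext asboolT// -/z0 /h /sqdist !subrr expr0n/= addr0 subr0 divff// gt_eqF//.
- move=> y; rewrite /chart_ext; case: asboolP => [yj hy|]; last by rewrite eqxx.
  have Ky : K (Defs.coord j y).
    by apply: contrapT => /(hout _ (coord_img yj)) h0; rewrite h0 eqxx in hy.
  by have [_] := Kd _ Ky; rewrite coordK.
Qed.

Lemma CkX_sum k (T : Type) (s : seq T) (h : T -> X -> R) : (forall t, CkX k (h t)) ->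
  CkX k (fun x => \sum_(t <- s) h t x).
Proof.
move=> hk i; have oi := @img_open R X i.
elim: s => [|t s IH].
  by apply: (Ck_congr oi _ (Ck_cst k 0 oi)) => z _ /=; rewrite big_nil.
by apply: (Ck_congr oi _ (CkD oi (hk t i) IH)) => z _ /=; rewrite big_cons.
Qed.

(** Finitely many bumps are enough for one of them to be positive at each point; dividing them by
    their sum preserves smoothness and supports. *)
Lemma partition_of_unity : exists (T : finType) (jK : T -> chart X * set (plane R))
  (rho : T -> X -> R), [/\ forall t k, CkX k (rho t),
    forall t, supported_in (jK t).1 (jK t).2 (rho t), forall t x, 0 <= rho t x &
    forall x, \sum_t rho t x = 1].
Proof.
have /choice[jb Hjb] : forall x, exists jb : (chart X * set (plane R)) * (X -> R),
    [/\ forall k, CkX k jb.2, supported_in jb.1.1 jb.1.2 jb.2,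
      forall y, 0 <= jb.2 y <= 1 & jb.2 x = 1].
  move=> x; have [jK [b [b1 b2 b3 b4 _]]] := @bump_exists x setT filterT.
  by exists (jK, b).
(* The filter of finite sequences ordered by inclusion: near-covering compactness along it yields a
   finite subcover. *)
pose F : set_system (seq X) := filter_from setT (fun s0 : seq X => [set s : seq X | {subset s0 <= s}]).
have FF : Filter F.
  apply: filter_from_filter; first by exists [::].
  move=> s1 s2 _ _; exists (s1 ++ s2) => // s /= Hs.
  by split=> t ts; apply: Hs; rewrite mem_cat ts ?orbT.
have /compact_near_coveringP/(_ _ F (fun s y => exists2 t, t \in s & 0 < (jb t).2 y) FF) := @rs_compact R X.
case.
  move=> x _; have [b1 _ _ bx] := Hjb x.
  exists ([set y | 0 < (jb x).2 y], [set s : seq X | x \in s]).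
    split.
      have : \forall y \near x, `|(jb x).2 x - (jb x).2 y| < 1.
        by have /cvgrPdist_lt/(_ 1 ltr01) := @CkX_continuous 0 _ (b1 0) x.
      by apply: filterS => y; rewrite bx /= ltr_norml; lra.
    by exists [:: x] => // s Hs; apply: Hs; rewrite mem_seq1.
  by move=> [y s] [/= y0 xs]; exists x.
move=> s _ /(_ s (fun _ => id)) cs.
pose S x := \sum_(k < size s) (jb (tnth (in_tuple s) k)).2 x.
have b0 t x : 0 <= (jb t).2 x by have [_ _ /(_ x)/andP[]] := Hjb t.
have S0 x : 0 < S x.
  have [t ts tx] := cs x I.
  have /tnthP[k tk] : t \in in_tuple s by [].
  rewrite /S (bigD1 k)//= -tk.
  by apply: ltr_pwDl => //; apply: sumr_ge0.
have SX k : CkX k S by apply: CkX_sum => t; have [b1 _ _ _] := Hjb (tnth (in_tuple s) t).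
exists 'I_(size s), (fun t => (jb (tnth (in_tuple s) t)).1),
  (fun t x => (jb (tnth (in_tuple s) t)).2 x / S x); split.
- move=> t k i; have [b1 _ _ _] := Hjb (tnth (in_tuple s) t).
  have oi := @img_open R X i; apply: (CkM oi (b1 k i)).
  have S1 z : img i z -> (S \o @param R X i) z != 0 by move=> _; rewrite gt_eqF//; exact: S0.
  exact (CkV oi S1 (SX k i)).
- move=> t; have [_ [c1 c2 c3] _ _] := Hjb (tnth (in_tuple s) t); split => // x.
  by rewrite mulf_eq0 negb_or => /andP[/c3].
- by move=> t x; rewrite divr_ge0// ltW.
- by move=> x; rewrite -mulr_suml -/(S x) divff// gt_eqF// S0.
Qed.

End ChartFunctions.

(** * Locality and linearity of the Laplacian *)

Section LaplacianAlgebra.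
Context {R : realType}.
Implicit Types (U : set (plane R)) (z : plane R) (f g : plane R -> R).

Lemma laplacian_near f g z : (\forall w \near z, f w = g w) -> laplacian f z = laplacian g z.
Proof.
move=> fg; rewrite /laplacian.
have -> : Dx (Dx f) z = Dx (Dx g) z := nbhs_singleton (near_Dx (near_Dx fg)).
have -> : Dy (Dy f) z = Dy (Dy g) z := nbhs_singleton (near_Dy (near_Dy fg)).
by [].
Qed.

Lemma laplacian_cst (c : R) z : laplacian (fun=> c) z = 0.
Proof.
have Ex : \forall w \near z, Dx (fun=> c) w = 0.
  by apply: filterE => w; exact: (is_derive_DxP (is_derive_cst c w ((1, 0) : plane R))).2.
have Ey : \forall w \near z, Dy (fun=> c) w = 0.
  by apply: filterE => w; exact: (is_derive_DyP (is_derive_cst c w ((0, 1) : plane R))).2.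
rewrite /laplacian.
have -> : Dx (Dx (fun=> c)) z = 0.
  rewrite (nbhs_singleton (near_Dx Ex)).
  exact: (is_derive_DxP (is_derive_cst (0 : R) z ((1, 0) : plane R))).2.
have -> : Dy (Dy (fun=> c)) z = 0.
  rewrite (nbhs_singleton (near_Dy Ey)).
  exact: (is_derive_DyP (is_derive_cst (0 : R) z ((0, 1) : plane R))).2.
exact: addr0.
Qed.

Lemma laplacian_lin U (a b : R) f g z : open U -> U z -> Ck 2 U f -> Ck 2 U g ->
  laplacian (fun w => a * f w + b * g w) z = a * laplacian f z + b * laplacian g z.
Proof.
move=> oU Uz Cf Cg.
have dZ (W : normedModType R) (c : R) (h : W -> R) (w v : W) d : is_derive w v h d ->
    is_derive w v (fun u => c * h u) (c * d) by exact: is_deriveZ.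
have dlin (W : normedModType R) (h k : W -> R) (w v : W) d e : is_derive w v h d -> is_derive w v k e ->
    is_derive w v (fun u => a * h u + b * k u) (a * d + b * e).
  by move=> dh dk; exact (is_deriveD (dZ _ a _ _ _ _ dh) (dZ _ b _ _ _ _ dk)).
have Cf1 := Ck_S Cf; have Cg1 := Ck_S Cg.
have Ex : \forall w \near z, Dx (fun w => a * f w + b * g w) w = a * Dx f w + b * Dx g w.
  apply: (near_open oU Uz) => w Uw.
  exact (is_derive_DxP (dlin _ _ _ _ _ _ _ (Ck_is_derive_x Cf1 Uw) (Ck_is_derive_x Cg1 Uw))).2.
have Ey : \forall w \near z, Dy (fun w => a * f w + b * g w) w = a * Dy f w + b * Dy g w.
  apply: (near_open oU Uz) => w Uw.
  exact (is_derive_DyP (dlin _ _ _ _ _ _ _ (Ck_is_derive_y Cf1 Uw) (Ck_is_derive_y Cg1 Uw))).2.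
have Cfx : Ck 1 U (Dx f) by exact: Ck_Dx.
have Cgx : Ck 1 U (Dx g) by exact: Ck_Dx.
have Cfy : Ck 1 U (Dy f) by exact: Ck_Dy.
have Cgy : Ck 1 U (Dy g) by exact: Ck_Dy.
rewrite /laplacian (nbhs_singleton (near_Dx Ex)) (nbhs_singleton (near_Dy Ey)).
have -> := (is_derive_DxP (dlin _ _ _ _ _ _ _ (Ck_is_derive_x Cfx Uz) (Ck_is_derive_x Cgx Uz))).2.
have -> := (is_derive_DyP (dlin _ _ _ _ _ _ _ (Ck_is_derive_y Cfy Uz) (Ck_is_derive_y Cgy Uz))).2.
move: (Dx (Dx f) z) (Dx (Dx g) z) (Dy (Dy f) z) (Dy (Dy g) z) => p q r s; ring.
Qed.

Lemma laplacianZ U (c : R) f z : open U -> U z -> Ck 2 U f ->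
  laplacian (fun w => c * f w) z = c * laplacian f z.
Proof.
move=> oU Uz Cf; have := laplacian_lin c 0 oU Uz Cf Cf; rewrite mul0r addr0 => <-.
by apply: laplacian_near; apply: filterE => w; rewrite mul0r addr0.
Qed.

Lemma Ck_laplacian k U f : open U -> Ck k.+2 U f -> Ck k U (laplacian f).
Proof.
move=> oU Cf; apply: (CkD oU); first exact (Ck_Dx (Ck_Dx Cf)).
exact (Ck_Dy (Ck_Dy Cf)).
Qed.

End LaplacianAlgebra.

(** * Continuous forms and their comparison with a Kaehler form *)

Section Forms.
Context {R : realType} {X : compactRiemannSurface R}.
Implicit Types (i j : chart X) (x : X) (z : plane R) (k : nat) (h chi : X -> R) (a : coefs X).

Lemma CkX_le k l h : (k <= l)%N -> CkX l h -> CkX k h.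
Proof. by move=> kl hl i; exact: Ck_le kl (hl i). Qed.

Definition Ck_form k a := is_form a /\ forall i, Ck k (img i) (a i).

Lemma is_formE a i j z : is_form a -> overlap i j z ->
  a i z = a j (trans i j z) * Defs.jacobian (trans i j) z.
Proof. by move=> fa [zi zj]; exact: fa. Qed.

(** Conformal covariance of the Laplacian under transition maps is exactly the transformation law of
    a 2-form. *)
Lemma Ck_form_ddc k h : CkX k.+2 h -> Ck_form k (ddc h).
Proof.
move=> hk; split; last first.
  move=> i; apply: (CkZ _ (@img_open R X i)); apply: Ck_laplacian => //; exact: img_open.
move=> i j z zi zj; have zij : overlap i j z by [].
rewrite /ddc -mulrA; congr (_ * _).
have C2 : Ck 2 (img j) (h \o @param R X j) by apply: Ck_le (hk j).
have := laplacian_holomorphic (open_overlap i j) (@img_open R X j) C2 (trans_holomorphic i j) _ zij.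
move=> <-; last by move=> w /overlap_trans[].
apply: laplacian_near; apply: (near_open (open_overlap i j) zij) => w wij.
by rewrite /= param_trans.
Qed.

Variable g : coefs X.
Hypothesis kg : kahler_form g.

Lemma kahler_Ck k : Ck_form k g.
Proof. by have [fg _ sg] := kg; split => // i; exact: sg. Qed.

(** The coefficient of [a] may be unbounded in a chart, but its ratio to that of g is the same in
    all charts, both being multiplied by the same jacobian, and is continuous on the compact X. *)
Lemma form_bounded a : Ck_form 0 a -> exists2 C, 0 <= C &
  forall i z, img i z -> `|a i z| <= C * g i z.
Proof.
move=> [fa ca]; have [fg pg sg] := kg.
have /compact_near_coveringP/(_ _ (pinfty_nbhs R)
  (fun C x => forall i, dom i x -> `|a i (Defs.coord i x)| <= C * g i (Defs.coord i x)) _) := @rs_compact R X.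
case.
  move=> x _; have [j xj] := dom_cover x.
  have zj := coord_img xj.
  have g0 := pg _ _ zj.
  pose q w := `|a j w| / g j w.
  have cq : {for Defs.coord j x, continuous q}.
    apply: continuousM.
      by apply: continuous_comp; [exact: (Ck_cont (ca j) zj)|exact: norm_continuous].
    by apply: continuousV; [rewrite gt_eqF|exact: (Ck_cont (sg j 0) zj)].
  have cqx := continuous_comp (@Defs.coord_continuous R X j x xj) cq.
  have nq : \forall y \near x, q (Defs.coord j y) < q (Defs.coord j x) + 1.
    have /cvgrPdist_lt/(_ 1 ltr01) := cqx.
    by apply: filterS => y /=; rewrite ltr_norml; lra.
  have nj := near_dom xj.
  exists ([set y | dom j y /\ q (Defs.coord j y) < q (Defs.coord j x) + 1],
          [set C | q (Defs.coord j x) + 1 < C]).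
    split; first exact: filterS2 nj nq.
    by exists (q (Defs.coord j x) + 1); split => //; exact: num_real.
  move=> [y C] [/= [yj yq] Cq] i yi.
  have zi := coord_img yi; have yij : overlap i j (Defs.coord i y).
    by split => //; rewrite /preimage/= coordK.
  have tE : trans i j (Defs.coord i y) = Defs.coord j y by rewrite /trans/= coordK.
  rewrite (is_formE fa yij) (is_formE fg yij) tE normrM (ger0_norm (ltW (trans_gt0 yij))) mulrA.
  apply: ler_wpM2r; first exact: (ltW (trans_gt0 yij)).
  have gy := pg _ _ (coord_img yj).
  by rewrite -ler_pdivrMr// -/(q _) ltW// (lt_trans yq).
move=> M [Mr HM].
exists (`|M| + 1); first by rewrite addr_ge0.
move=> i z zi; have := HM (`|M| + 1) _ (param i z) I i (param_dom zi); rewrite paramK//; apply.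
by rewrite (le_lt_trans (ler_norm M))// ltrDl.
Qed.

End Forms.

Lemma ddcE {R : realType} {X : compactRiemannSurface R} (h : X -> R) (i : chart X) (z : plane R) :
  ddc h i z = (4 * pi)^-1 * laplacian (h \o @param R X i) z.
Proof. by []. Qed.

Opaque laplacian ddc Ck.

(** * Integrability of forms and Green's formula on the surface *)

Section FormIntegrals.
Context {R : realType} {X : compactRiemannSurface R}.
Implicit Types (i j : chart X) (x : X) (z : plane R) (k : nat) (h chi : X -> R) (a : coefs X).
Variable g : coefs X.
Hypothesis kg : kahler_form g.

(** The coefficient of g may be unbounded on the image of a chart. A partition of unity cuts g into
    pieces, and each piece is moved to the chart where its support is compact. *)
Lemma kahler_integrable : form_integrable (fun i z => (g i z)%:E).
Proof.
have [fg pg sg] := kg.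
have [T [jK [rho [rhoC rhoS rho0 rho1]]]] := @partition_of_unity R X.
move=> i; have oi := @img_open R X i.
have mg j : measurable_fun (img j : set (mplane R)) (g j).
  by apply: (@Ck_measurable _ 0); [exact: img_open|exact: sg].
have mr t j : measurable_fun (img j : set (mplane R)) (rho t \o @param R X j).
  by apply: (@Ck_measurable _ 0); [exact: img_open|exact: rhoC].
pose a t j z : \bar R := (rho t (param j z) * g j z)%:E.
have ma t j : measurable_fun (img j : set (mplane R)) (a t j).
  apply/measurable_EFinP; apply: measurable_funM; [exact: mr|exact: mg].
have a0 t j z : img j z -> (0 <= a t j z)%E.
  by move=> zj; rewrite lee_fin mulr_ge0// ltW// pg.
apply/integrableP; split; first exact/measurable_EFinP.
have E : (\int[area R]_(z in img i) `|(g i z)%:E| = \int[area R]_(z in img i) (\sum_(t : T) a t i z))%E.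
  apply: eq_integral => z; rewrite inE => zi.
  rewrite abse_EFin ger0_norm ?(ltW (pg _ _ zi))// sumEFin -mulr_suml rho1 mul1r//.
rewrite E ge0_integral_sum; [|exact: measurable_img|by move=> t; exact: ma|by move=> t z zi; exact: a0].
apply: lte_sum_pinfty => t _.
set j := (jK t).1; have [cK Kj hK] := rhoS t; rewrite -/j in Kj hK.
apply: (@le_lt_trans _ _ (\int[area R]_(z in img j) a t j z)%E); last first.
  have hC : Ck 0 (img j) (fun z => rho t (param j z) * g j z).
    by apply: (CkM (@img_open R X j)); [exact: rhoC|exact: sg].
  have iz := integrable_zero_extension (@img_open R X j) cK Kj hC _.
  apply: integrable_lty; first exact: measurable_img.
  apply: iz => z zj Kz; have [->|/hK[_]] := eqVneq (rho t (param j z)) 0; first exact: mul0r.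
  by rewrite paramK.
have -> : (\int[area R]_(z in img i) a t i z = \int[area R]_(z in overlap i j) a t i z)%E.
  rewrite integral_mkcond [RHS]integral_mkcond; apply: eq_integral => z _; rewrite /patch.
  case: ifPn; rewrite ?notin_setE ?in_setE => zi; case: ifPn; rewrite ?notin_setE ?in_setE => // zij.
  - rewrite /a; have [->|/hK[zj _]] := eqVneq (rho t (param i z)) 0; first by rewrite mul0r.
    by case: zij.
  - by case: zi; case: zij.
have -> : (\int[area R]_(z in overlap i j) a t i z =
    \int[area R]_(z in overlap i j) (a t j (trans i j z) * (Defs.jacobian (trans i j) z)%:E))%E.
  apply: eq_integral => z; rewrite inE => zij.
  by rewrite /a (is_formE fg zij) param_trans// -EFinM mulrA.
rewrite trans_change.
- apply: ge0_subset_integral => //.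
  + exact: measurable_overlap.
  + exact: measurable_img.
  + by move=> z; exact: a0.
  + by move=> z [].
- by apply: (measurable_funS (measurable_img j)) (ma t j) => z [].
- by move=> z [zj _]; exact: a0.
Qed.

Lemma form_integrable_le (a : chart X -> plane R -> \bar R) (C : R) : form_measurable a ->
  (forall i z, img i z -> (`|a i z| <= (C * g i z)%:E)%E) -> form_integrable a.
Proof.
move=> ma aC i; have [_ pg _] := kg.
have := integrableZl (measurable_img i) C (kahler_integrable i).
apply: le_integrable => //; first exact: measurable_img.
move=> z zi; apply: le_trans (aC i z zi) _.
by rewrite -EFinM abse_EFin lee_fin ler_norm.
Qed.

Lemma form_integrable_Ck a h : Ck_form 0 a -> CkX 0 h ->
  form_integrable (fun i z => (h (param i z) * a i z)%:E).
Proof.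
move=> fa ch; have [C C0 HC] := form_bounded kg fa.
have fg0 : Ck_form 0 (fun i z => h (param i z) * g i z).
  have [[fg pg sg] ca] := (kg, fa.2); split.
    by move=> i j z zi zj; rewrite (fg i j z zi zj) mulrA coordK.
  by move=> i; apply: (CkM (@img_open R X i)); [exact: ch|exact: sg].
have [M M0 HM] := form_bounded kg fg0.
have [_ pg _] := kg.
apply: (@form_integrable_le _ (M * C)).
  move=> i; apply/measurable_EFinP; apply: (@Ck_measurable _ 0); first exact: img_open.
  by apply: (CkM (@img_open R X i)); [exact: ch|exact: fa.2].
move=> i z zi; have g0 := pg _ _ zi.
have := HM i z zi; rewrite normrM (ger0_norm (ltW g0)) ler_pM2r// => hM.
rewrite abse_EFin lee_fin normrM -mulrA; apply: ler_pM => //; exact: HC.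
Qed.

Lemma green_chart j K h chi : supported_in j K h -> CkX 2 h -> CkX 2 chi ->
  (\int[area R]_(z in img j) (chi (param j z) * ddc h j z)%:E =
   \int[area R]_(z in img j) (h (param j z) * ddc chi j z)%:E)%E.
Proof.
move=> [cK Kj hK] Ch Cchi; have oj := @img_open R X j.
have h0 z : img j z -> ~ K z -> (h \o param j) z = 0.
  move=> zj Kz /=; have [//|/hK[_]] := eqVneq (h (param j z)) 0.
  by rewrite paramK.
have C2 := CkZ (4 * pi)^-1 oj (Cchi j).
have G := green_plane oj cK Kj (Ch j) C2 h0.
transitivity (\int[area R]_(z in img j)
    ((4 * pi)^-1 * (chi \o param j) z * laplacian (h \o param j) z)%:E)%E.
  by apply: eq_integral => z _; rewrite ddcE mulrCA mulrA.
rewrite -G; apply: eq_integral => z; rewrite inE => zj.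
by rewrite ddcE (laplacianZ _ oj zj (Cchi j)).
Qed.

Lemma form_integrable_ddc h chi : CkX 0 h -> CkX 2 chi ->
  form_integrable (fun i z => (h (param i z) * ddc chi i z)%:E).
Proof.
by move=> Ch Cchi; apply: form_integrable_Ck => //; exact: (Ck_form_ddc Cchi).
Qed.

Lemma green_supported j K h chi : supported_in j K h -> CkX 2 h -> CkX 2 chi ->
  form_int (fun i z => (chi (param i z) * ddc h i z)%:E) =
  form_int (fun i z => (h (param i z) * ddc chi i z)%:E).
Proof.
move=> hS Ch Cchi; have [cK Kj hK] := hS.
have [fh _] := Ck_form_ddc Ch; have [fchi _] := Ck_form_ddc Cchi.
have out i z : img i z -> ~ dom j (param i z) -> ddc h i z = 0.
  move=> zi zj.
  have -> : ddc h i z = (4 * pi)^-1 * laplacian (fun=> 0) z.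
    by rewrite ddcE (laplacian_near (supported_far hS zi zj)).
  by rewrite laplacian_cst mulr0.
have I1 := form_integrable_ddc (CkX_le (leq0n 2) Cchi) Ch.
have I2 := form_integrable_ddc (CkX_le (leq0n 2) Ch) Cchi.
have C1 : carried_by j (fun i z => (chi (param i z) * ddc h i z)%:E).
  move=> i; split=> z.
    by move=> zij; rewrite (is_formE fh zij) param_trans// -EFinM mulrA.
  by move=> zi zj; rewrite out// mulr0.
have C2 : carried_by j (fun i z => (h (param i z) * ddc chi i z)%:E).
  move=> i; split=> z.
    by move=> zij; rewrite (is_formE fchi zij) param_trans// -EFinM mulrA.
  move=> zi zj; have [->|/hK[//]] := eqVneq (h (param i z)) 0.
  by rewrite mul0r.
exact (etrans (form_int_carried I1 C1) (etrans (green_chart hS Ch Cchi) (esym (form_int_carried I2 C2)))).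
Qed.

Lemma form_int_sum (T : Type) (s : seq T) (a : T -> chart X -> plane R -> \bar R) :
  (forall t, form_integrable (a t)) ->
  form_int (fun i z => \sum_(t <- s) a t i z)%E = (\sum_(t <- s) form_int (a t))%E.
Proof.
move=> ia.
have is_ (r : seq T) : form_integrable (fun i z => \sum_(t <- r) a t i z)%E.
  move=> i; apply: integrable_sum; [exact: measurable_img|by move=> t _; exact: ia].
elim: s => [|t s IH].
  rewrite big_nil /form_int big1// => i _; rewrite integral0_eq// => z _.
  by rewrite big_nil mul0e.
rewrite big_cons -IH -form_intD//.
by apply: form_int_congr => i z _; rewrite big_cons.
Qed.

Lemma green h chi : CkX 2 h -> CkX 2 chi ->
  form_int (fun i z => (chi (param i z) * ddc h i z)%:E) =
  form_int (fun i z => (h (param i z) * ddc chi i z)%:E).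
Proof.
move=> Ch Cchi.
have [T [jK [rho [rhoC rhoS rho0 rho1]]]] := @partition_of_unity R X.
pose ht t x := rho t x * h x.
have Cht t : CkX 2 (ht t).
  by move=> i; apply: (CkM (@img_open R X i)); [exact: rhoC|exact: Ch].
have Sht t : supported_in (jK t).1 (jK t).2 (ht t).
  have [c1 c2 c3] := rhoS t; split => // x.
  by rewrite mulf_eq0 negb_or => /andP[/c3].
have hE x : h x = \sum_t ht t x by rewrite -mulr_suml rho1 mul1r.
have ddc_sum i z : img i z -> ddc h i z = \sum_t ddc (ht t) i z.
  move=> zi; rewrite ddcE (eq_bigr _ (fun t _ => ddcE (ht t) i z)) -mulr_sumr; congr (_ * _).
  transitivity (laplacian (fun w => \sum_t (ht t \o @param R X i) w) z).
    by apply: laplacian_near; apply: filterE => w; exact: hE.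
  elim: (index_enum T) => [|t s IH].
    rewrite big_nil -[RHS](laplacian_cst 0 z); apply: laplacian_near.
    by apply: filterE => w; rewrite big_nil.
  rewrite big_cons -IH -[X in X + _]mul1r -[X in _ + X]mul1r.
  rewrite -(laplacian_lin _ _ (@img_open R X i) zi).
  - by apply: laplacian_near; apply: filterE => w; rewrite big_cons !mul1r.
  - exact: Cht.
  - exact: (CkX_sum s Cht i).
transitivity (form_int (fun i z => \sum_t (chi (param i z) * ddc (ht t) i z)%:E)%E).
  by apply: form_int_congr => i z zi; rewrite sumEFin ddc_sum// mulr_sumr.
rewrite form_int_sum; last first.
  move=> t; exact (form_integrable_ddc (CkX_le (leq0n 2) Cchi) (Cht t)).
transitivity (form_int (fun i z => \sum_t (ht t (param i z) * ddc chi i z)%:E)%E); last first.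
  by apply: form_int_congr => i z zi; rewrite sumEFin hE mulr_suml.
rewrite form_int_sum; last first.
  move=> t; exact (form_integrable_ddc (CkX_le (leq0n 2) (Cht t)) Cchi).
exact (eq_bigr _ (fun t _ => green_supported (Sht t) (Cht t) Cchi)).
Qed.

End FormIntegrals.

Lemma closed_disc_sub {R : realType} (z : plane R) (N : set (plane R)) : nbhs z N ->
  exists2 r, 0 < r & closed_disc z r `<=` N.
Proof.
move=> zN; have [d /= d0 Hd] := (nbhs_ballP z N).1 zN.
exists (d / 2); first by rewrite divr_gt0.
have d2 : 0 < d / 2 by rewrite divr_gt0.
move=> w wz; apply: Hd; apply/ball_planeE.
by rewrite (distrC z.1) (distrC z.2); have [] := closed_disc_box d2 wz; split; lra.
Qed.

Lemma compact_closed_disc {R : realType} (z : plane R) (r : R) : 0 < r -> compact (closed_disc z r).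
Proof.
move=> r0; apply: (@subclosed_compact _ _ (boxc (z.1 - r) (z.1 + r) (z.2 - r) (z.2 + r))).
- have -> : closed_disc z r = sqdist z @^-1` [set s | s <= r ^+ 2] by [].
  apply: closed_comp; last exact: closed_le.
  by move=> w _; exact: (Ck_cont (Ck_sqdist z 0)).
- exact: compact_boxc.
- move=> w /(closed_disc_box r0)[]; rewrite !ler_norml => /andP[? ?] /andP[? ?].
  by apply/boxcP; split; apply/andP; split; lra.
Qed.

(** For finite u the right side exceeds the left by (A - u) p: replacing u by its majorant costs
    only on the negative part q of the weight. The value -oo is settled by the sign of p - q. *)
Lemma mixed_le {R : realType} (u : \bar R) (A p q : R) : (u <= A%:E)%E -> 0 <= p -> 0 <= q ->
  (u * (p - q)%:E <= A%:E * (p - q)%:E + (A%:E - u) * q%:E)%E.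
Proof.
move=> uA p0 q0; case: u uA => [u| |] //=.
  rewrite lee_fin => uA; rewrite -EFinB -!EFinM -EFinD lee_fin.
  have : 0 <= (A - u) * p by rewrite mulr_ge0// subr_ge0.
  by rewrite !mulrBr !mulrBl; lra.
move=> _; have AB : (A%:E - -oo = +oo :> \bar R)%E by [].
rewrite AB; have [pq|pq|->] := ltgtP p q.
- have q1 : 0 < q by apply: le_lt_trans p0 pq.
  by rewrite (gt0_mulye (x := q%:E)) ?lte_fin// -EFinM addey// leey.
- by rewrite gt0_mulNye ?lte_fin ?subr_gt0// leNye.
- by rewrite subrr !mule0 add0e mule_ge0// lee_fin.
Qed.

Lemma near_le_half {R : realType} (q : plane R -> R) (z : plane R) (d : R) : 0 < d ->
  {for z, continuous q} -> q z = - (2 * d) -> \forall w \near z, q w <= - d.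
Proof.
move=> d0 cq qz; have /cvgrPdist_lt/(_ d d0) := cq.
by apply: filterS => w; rewrite qz ltr_norml; lra.
Qed.

Lemma ereal_balance {R : realType} (a b b' G : \bar R) (d m q : R) : 0 < d ->
  (0 <= a + b)%E -> (b <= b' + q%:E)%E -> (a + b' <= (- d)%:E * G)%E -> (m%:E <= G)%E ->
  a \is a fin_num -> b \is a fin_num -> b' \is a fin_num -> G \is a fin_num -> d * m <= q.
Proof.
move=> d0; case: a b b' G => [a| |] [b| |] [b'| |] [G| |] //=.
rewrite -?EFinD -?EFinM -?EFinD !lee_fin => h1 h2 h3 h4 _ _ _ _.
have : d * m <= d * G by rewrite ler_wpM2l// ltW.
by move: h3; rewrite mulNr; lra.
Qed.

Lemma shift_real {R : realType} (v : \bar R) (a b s : R) : a = b + s ->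
  ((a%:E - (v + s%:E) = b%:E - v) /\ (v + s%:E <= a%:E -> v <= b%:E))%E.
Proof.
move=> ->; case: v => [v| |]; last 2 first.
- by split => //=; rewrite leye_eq.
- by split => // _; exact: leNye.
split; first by rewrite -EFinD -!EFinB; congr EFin; lra.
by rewrite -EFinD !lee_fin; lra.
Qed.

Lemma integral_support {R : realType} (D E : set (mplane R)) (p q : mplane R -> \bar R) :
  D `<=` E -> (forall z, D z -> p z = q z) -> (forall z, E z -> ~ D z -> p z = 0%E) ->
  (\int[area R]_(z in E) p z = \int[area R]_(z in D) q z)%E.
Proof.
move=> DE pq p0; rewrite integral_mkcond [RHS]integral_mkcond; apply: eq_integral => z _.
rewrite /patch; case: ifPn; rewrite ?notin_setE ?in_setE => Ez; case: ifPn; rewrite ?notin_setE ?in_setE => Dz //.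
- exact: pq.
- exact: p0.
- by case: Ez; exact: DE.
Qed.

(** * The viscosity inequality *)

Section Viscosity.
Context {R : realType} {X : compactRiemannSurface R}.
Implicit Types (i j : chart X) (x : X) (z : plane R) (k : nat) (h chi : X -> R) (a : coefs X).
Variable g : coefs X.
Hypothesis kg : kahler_form g.

Lemma usc_measurable_param (u : X -> \bar R) i : (forall x, usc_at u x) ->
  measurable_fun (img i : set (mplane R)) (u \o @param R X i).
Proof.
move=> uu; apply: usc_measurable; first exact: img_open.
by move=> z zi a /= ua; exact: (param_continuous zi (uu _ a ua)).
Qed.

Lemma ddc_integrable (u : X -> \bar R) chi : PSH g u -> CkX 2 chi ->
  form_integrable (fun i z => (u (param i z) * (ddc chi i z)%:E)%E).
Proof.
move=> [uu uL _ _] Cchi i; have fc := Ck_form_ddc Cchi.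
have [C C0 HC] := form_bounded kg fc; have [_ pg _] := kg.
have := integrableZl (measurable_img i) C (uL i).
apply: le_integrable; first exact: measurable_img.
  apply: emeasurable_funM; first by apply: usc_measurable_param => x; exact: (uu x).2.
  by apply/measurable_EFinP; apply: (Ck_measurable (@img_open R X i) (fc.2 i)).
move=> z zi; rewrite !abseM !abse_EFin (ger0_norm C0) muleCA.
apply: lee_wpmul2l => //; rewrite -EFinM lee_fin (ger0_norm (ltW (pg _ _ zi))).
exact: HC.
Qed.

Lemma ddc_add_cst h (c : R) i z : CkX 2 h -> img i z -> ddc (fun x => h x + c) i z = ddc h i z.
Proof.
move=> Ch zi; have oi := @img_open R X i.
have L : laplacian ((fun x => h x + c) \o @param R X i) z = laplacian (h \o @param R X i) z.
  transitivity (laplacian (fun w => 1 * (h \o @param R X i) w + 1 * c) z).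
    by apply: laplacian_near; apply: filterE => w; rewrite !mul1r.
  by rewrite (laplacian_lin _ _ oi zi (Ch i) (Ck_cst 2 c oi)) laplacian_cst mulr0 addr0 mul1r.
by rewrite ddcE L -ddcE.
Qed.

Lemma carried_by_supported j K h a : supported_in j K h -> is_form a ->
  carried_by j (fun i z => (h (param i z) * a i z)%:E).
Proof.
move=> [_ _ hK] fa i; split=> z.
  by move=> zij; rewrite (is_formE fa zij) param_trans// -EFinM mulrA.
move=> zi zj; have [->|/hK[//]] := eqVneq (h (param i z)) 0.
by rewrite mul0r.
Qed.

Lemma ddc_supported_out i j K h z : supported_in j K h -> img i z -> ~ dom j (param i z) -> ddc h i z = 0.
Proof.
move=> hS zi zj; rewrite ddcE (laplacian_near (supported_far hS zi zj)).
by rewrite laplacian_cst mulr0.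
Qed.

(** The positive current is paired with the kernel planted in the chart j. There u is replaced by h
    + c at the cost of the integral against [kernel_in], then Green's formula moves dd^c from the
    kernel to h + c, and the resulting form is at most - d on the support. The factor in the
    conclusion is the normalisation of dd^c. *)
Lemma green_test (u : X -> \bar R) h j (z0 : plane R) (r e c d m eps : R) : PSH g u -> CkX 2 h ->
  0 < r -> 0 < e -> 0 < d -> closed_disc z0 r `<=` img j ->
  (forall w, closed_disc z0 r w -> (u (param j w) <= (h (param j w) + c)%:E)%E) ->
  (forall w, closed_disc z0 r w -> g j w + ddc h j w <= - d) ->
  (m%:E <= \int[area R]_z (green_kernel z0 e r z)%:E)%E ->
  (\int[area R]_(w in disc z0 r)
     (((h (param j w) + c)%:E - u (param j w)) * (kernel_in z0 e r w)%:E) <= eps%:E)%E ->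
  d * m <= (4 * pi)^-1 * eps.
Proof.
move=> pu Ch r0 e0 d0 Dj uA gd Hm Heps.
have oj := @img_open R X j; have mj := @measurable_img R X j.
have [uu uL uq up] := pu.
have cD := @compact_closed_disc _ z0 _ r0.
have CG k : Ck k (img j) (green_kernel z0 e r).
  by apply/Ck_pt => w _; move/Ck_pt: (Ck_green_kernel z0 r e0 k) => /(_ w I).
have G0 z : img j z -> ~ closed_disc z0 r z -> green_kernel z0 e r z = 0.
  by move=> _ /negP; rewrite /closed_disc/= -ltNge => /ltW; exact: green_kernel_support.
have hS := chart_ext_supported cD Dj G0.
have Cchi k := CkX_chart_ext cD Dj G0 (CG k).
set chi := chart_ext j (green_kernel z0 e r) in hS Cchi.
have chiE z : img j z -> chi (param j z) = green_kernel z0 e r z by exact: chart_ext_param.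
have chi0 x : 0 <= chi x.
  by rewrite /chi /chart_ext; case: asboolP => // _; exact: green_kernel_ge0.
have [k k0 kE] : exists2 k : R, 0 < k & k = (4 * pi)^-1.
  by exists (4 * pi)^-1 => //; rewrite invr_gt0 mulr_gt0// pi_gt0.
have dE z : img j z -> ddc chi j z = k * kernel_out z0 e r z - k * kernel_in z0 e r z.
  move=> zj; rewrite ddcE (@laplacian_near _ _ (green_kernel z0 e r)).
    by rewrite laplacian_green_kernel// -mulrBr kE.
  by apply: (near_open oj zj) => w /chiE.
have T0 : (0 <= form_current g chi + ddc_current u chi)%E.
  by apply: (up chi) => // i n; exact: Cchi.
have F1 : form_current g chi = (\int[area R]_(z in img j) (chi (param j z) * g j z)%:E)%E.
  apply: form_int_carried; first exact: (form_integrable_Ck kg (kahler_Ck kg 0) (Cchi 0%N)).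
  by have [fg _ _] := kg; exact: carried_by_supported hS fg.
have [fchi _] := Ck_form_ddc (Cchi 2%N).
have F2 : ddc_current u chi = (\int[area R]_(z in img j) (u (param j z) * (ddc chi j z)%:E))%E.
  apply: form_int_carried; first exact: (ddc_integrable pu (Cchi 2%N)).
  move=> i; split=> z.
    by move=> zij; rewrite (is_formE fchi zij) param_trans// EFinM muleA.
  by move=> zi zj; rewrite (ddc_supported_out hS zi zj) mule0.
have CH : CkX 2 (fun x => h x + c).
  by move=> i; exact (CkD (@img_open R X i) (Ch i) (Ck_cst 2 c (@img_open R X i))).
have Gc := green_chart hS (Cchi 2%N) CH.
have kinE z : ~ closed_disc z0 r z -> kernel_in z0 e r z = 0.
  by move=> /negP; rewrite /closed_disc/= -ltNge => /ltW; exact: kernel_in_support.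
have koutE z : ~ closed_disc z0 r z -> kernel_out z0 e r z = 0.
  by move=> /negP; rewrite /closed_disc/= -ltNge => /ltW; exact: kernel_out_support.
pose A z := h (param j z) + c.
pose w z := ((A z)%:E - u (param j z))%E.
pose B z := (w z * (k * kernel_in z0 e r z)%:E)%E.
have Ckin : Ck 0 (img j) (kernel_in z0 e r).
  by apply/Ck_pt => y _; move/Ck_pt: (Ck_kernel_in z0 r 0 e0) => /(_ y I).
have mkin : measurable_fun (img j : set (mplane R)) (kernel_in z0 e r) by exact: (Ck_measurable oj Ckin).
have mA : measurable_fun (img j : set (mplane R)) A by exact: (Ck_measurable oj (CH j)).
have mw : measurable_fun (img j : set (mplane R)) w.
  apply: emeasurable_funB; first exact/measurable_EFinP.
  by apply: usc_measurable_param => x; exact: (uu x).2.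
have mB : measurable_fun (img j : set (mplane R)) B.
  have mkk : measurable_fun (img j : set (mplane R)) (fun z => (k * kernel_in z0 e r z)%:E).
    apply/measurable_EFinP; exact (measurable_funM (measurable_cst k) mkin).
  exact (emeasurable_funM mw mkk).
have w0 z : closed_disc z0 r z -> (0 <= w z)%E by move=> zd; rewrite sube_ge0 ?uA ?orbT.
have in0 z : (0 <= (kernel_in z0 e r z)%:E)%E by rewrite lee_fin kernel_in_ge0.
have kin0 z : 0 <= k * kernel_in z0 e r z := mulr_ge0 (ltW k0) (kernel_in_ge0 z0 e r z).
have kout0 z : 0 <= k * kernel_out z0 e r z := mulr_ge0 (ltW k0) (kernel_out_ge0 z0 e r z).
have B0 z : (0 <= B z)%E.
  rewrite /B; have [zd|/kinE->] := pselect (closed_disc z0 r z); last by rewrite mulr0 mule0.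
  by apply: mule_ge0; [exact: w0|rewrite lee_fin; exact: kin0].
have dj z : disc z0 r z -> img j z by move=> /ltW zd; exact: Dj.
have mdisc : measurable (disc z0 r : set (mplane R)).
  by apply: open_measurable_plane; exact: open_disc.
have IB : (\int[area R]_(z in img j) B z <= (k * eps)%:E)%E.
  have -> : (\int[area R]_(z in img j) B z = \int[area R]_(z in disc z0 r) (k%:E * (w z * (kernel_in z0 e r z)%:E)))%E.
    apply: (integral_support dj) => z; first by move=> _; rewrite /B EFinM muleCA.
    move=> _ /negP; rewrite /disc/= -leNgt => zd.
    by rewrite /B kernel_in_support ?mulr0 ?mule0.
  have m1 : measurable_fun (disc z0 r : set (mplane R)) (fun z => (w z * (kernel_in z0 e r z)%:E)%E).
    by apply: emeasurable_funM; [exact: (measurable_funS mj dj mw)|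
      apply/measurable_EFinP; exact: (measurable_funS mj dj mkin)].
  have p1 z : disc z0 r z -> (0 <= w z * (kernel_in z0 e r z)%:E)%E.
    by move=> /ltW zd; exact (mule_ge0 (w0 z zd) (in0 z)).
  have kk : (0 <= k%:E :> \bar R)%E by rewrite lee_fin; exact (ltW k0).
  rewrite (ge0_integralZl _ mdisc m1 p1 kk) EFinM; exact (lee_wpmul2l kk Heps).
have intB : (area R).-integrable (img j : set (mplane R)) B.
  apply/integrableP; split; first exact mB.
  apply: le_lt_trans (ltry (k * eps)); apply: le_trans IB.
  rewrite le_eqVlt; apply/orP; left; apply/eqP.
  by apply: eq_integral => z _; exact (gee0_abs (B0 z)).
have int1 : (area R).-integrable (img j : set (mplane R)) (fun z => (A z * ddc chi j z)%:E).
  exact: (form_integrable_ddc kg (CkX_le (leq0n 2) CH) (Cchi 2%N) j).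
(* Outside the disc both parts of the Laplacian of the kernel vanish; inside it [mixed_le] applies,
   with [kernel_out] free of charge. *)
have F3 : (\int[area R]_(z in img j) (u (param j z) * (ddc chi j z)%:E) <=
    \int[area R]_(z in img j) (chi (param j z) * ddc (fun x => (h x + c)%R) j z)%:E + (k * eps)%:E)%E.
  rewrite -Gc; apply: (@le_trans _ _ (\int[area R]_(z in img j) ((A z * ddc chi j z)%:E + B z))%E); last first.
    rewrite (integralD mj int1 intB); exact (leeD (lexx _) IB).
  apply: (le_integral mj (ddc_integrable pu (Cchi 2%N) j) (integrableD mj int1 intB)).
  move=> z; rewrite inE => zj; rewrite (dE z zj) /B EFinM.
  have [zd|zd] := pselect (closed_disc z0 r z); last first.
    by rewrite (kinE z zd) (koutE z zd) mulr0 subrr !mule0 add0e.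
  exact (mixed_le (uA z zd) (kout0 z) (kin0 z)).
have int2 : (area R).-integrable (img j : set (mplane R)) (fun z => (chi (param j z) * g j z)%:E).
  exact: (form_integrable_Ck kg (kahler_Ck kg 0) (Cchi 0%N) j).
have int3 : (area R).-integrable (img j : set (mplane R)) (fun z => (chi (param j z) * ddc (fun x => h x + c) j z)%:E).
  exact: (form_integrable_ddc kg (Cchi 0%N) CH j).
have int4 : (area R).-integrable (img j : set (mplane R)) (fun z => (green_kernel z0 e r z)%:E).
  by apply: (integrable_zero_extension oj cD Dj _ G0); exact: CG.
have F4 : (\int[area R]_(z in img j) (chi (param j z) * g j z)%:E +
    \int[area R]_(z in img j) (chi (param j z) * ddc (fun x => (h x + c)%R) j z)%:E <=
    (- d)%:E * \int[area R]_(z in img j) (green_kernel z0 e r z)%:E)%E.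
  rewrite -(integralD mj int2 int3) -(integralZl mj int4).
  apply: (le_integral mj (integrableD mj int2 int3) (integrableZl mj (- d) int4)).
  move=> z; rewrite inE => zj; rewrite -EFinD -EFinM lee_fin -mulrDr (chiE z zj).
  have [zd|zd] := pselect (closed_disc z0 r z); last by rewrite (G0 z zj zd) mul0r mulr0.
  rewrite mulrC; apply: ler_wpM2r; first exact: green_kernel_ge0.
  by rewrite (ddc_add_cst c Ch zj); exact: gd.
have GE : (\int[area R]_(z in img j) (green_kernel z0 e r z)%:E = \int[area R]_z (green_kernel z0 e r z)%:E)%E.
  apply/esym; apply: integral_support.
  - exact: subsetT.
  - by move=> z _; exact: erefl.
  - move=> z _ zj; rewrite green_kernel_support; [exact: erefl|exact: e0|exact: r0|].
    by rewrite leNgt; apply/negP => /ltW/Dj.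
have finG := integrable_fin_num mj int4.
have fin2 := integrable_fin_num mj int2.
have fin3 := integrable_fin_num mj int3.
rewrite -kE; move: T0 F3 F4 Hm; rewrite F1 F2 -GE.
have finF2 := integrable_fin_num mj (ddc_integrable pu (Cchi 2%N) j).
by move=> h1 h2 h3 h4; exact (ereal_balance d0 h1 h2 h3 h4 fin2 finF2 fin3 finG).
Qed.

(* The test functions are Green kernels with smoothed poles at x0. *)
Lemma viscosity (u : X -> \bar R) h j x0 (u0 : R) : PSH g u -> dom j x0 -> u x0 = u0%:E ->
  CkX 2 h -> (\forall y \near x0, (u y <= (u0 + (h y - h x0))%:E)%E) ->
  0 <= g j (Defs.coord j x0) + ddc h j (Defs.coord j x0).
Proof.
move=> pu xj ux Ch uh; rewrite leNgt; apply/negP.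
have zj := coord_img xj; have zx := coordK xj.
set z0 := Defs.coord j x0 in zj zx *; move=> neg.
have oj := @img_open R X j.
have [uu uL uq up] := pu.
have fh := Ck_form_ddc Ch; have fg := kahler_Ck kg 0.
pose hj := h \o @param R X j.
have [V [oV Vz Vj [v [s [psv sv vs]]]]] := uq j z0 zj.
(* The form is - 2 d at the point, hence at most - d nearby by continuity. *)
have [d d0 dE] : exists2 d, 0 < d & g j z0 + ddc h j z0 = - (2 * d).
  by exists (- (g j z0 + ddc h j z0) / 2); [lra|field].
have n1 : \forall w \near z0, g j w + ddc h j w <= - d.
  have c0 : {for z0, continuous (fun w => g j w + ddc h j w)}.
    exact (continuousD (Ck_cont (fg.2 j) zj) (Ck_cont (fh.2 j) zj)).
  exact (near_le_half d0 c0 dE).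
have n2 : \forall w \near z0, (u (param j w) <= (u0 + (hj w - hj z0))%:E)%E.
  have c0 := param_continuous zj; rewrite /prop_for /continuous_at zx in c0.
  have : \forall w \near z0, (fun y => (u y <= (u0 + (h y - h x0))%:E)%E) (param j w) := c0 _ uh.
  by rewrite /hj/= zx.
have Chj : Ck 2 (img j) hj by exact: Ch.
(* Subtracting the smooth part s leaves the psh part v, touched from above by [Q] up to a
   constant. *)
pose Q w := hj w - s w.
have cQ w : V w -> {for w, continuous Q}.
  move=> Vw; exact (continuousB (Ck_cont Chj (Vj w Vw)) (Ck_cont (sv 0%N) Vw)).
have n3 : \forall w \near z0, `|Q w - Q z0| <= 1.
  have /cvgrPdist_le/(_ 1 ltr01) := cQ z0 Vz.
  by apply: filterS => w; rewrite distrC.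
have n4 : \forall w \near z0, V w by exact: open_nbhs_nbhs.
have [r r0 Hr] := closed_disc_sub (filterI (filterI n1 n2) (filterI n3 n4)).
have zr : closed_disc z0 r z0 by rewrite /closed_disc/= !subrr expr0n/= addr0 sqr_ge0.
have vz : v z0 = (u0 - s z0)%:E.
  have := vs z0 Vz; rewrite zx ux; case: (v z0) => [a| |] //= [].
  by move=> ->; rewrite addrK.
have [m m0 Hm] := green_kernel_mass z0 r0.
have pi4 : 0 < (4 * pi)^-1 :> R by rewrite invr_gt0 mulr_gt0// pi_gt0.
(* [m] does not depend on the smoothing, so eps can be fixed to contradict [green_test] before the
   kernel is sharpened. *)
have [eps eps0 epsE] : exists2 eps, 0 < eps & (4 * pi)^-1 * eps < d * m.
  have dm : 0 < d * m by rewrite mulr_gt0.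
  exists (d * m / 2 / (4 * pi)^-1); first by rewrite divr_gt0// divr_gt0.
  by rewrite mulrC divfK ?gt_eqF//; lra.
have HV w : closed_disc z0 r w -> V w by move=> /Hr[_ []].
have QK w : closed_disc z0 r w -> `|Q w - Q z0| <= 1 by move=> /Hr[_ []].
have uA w : closed_disc z0 r w -> (u (param j w) <= (h (param j w) + (u0 - h x0))%:E)%E.
  move=> /Hr[[_ /=]]; rewrite /hj/= zx => H _; apply: le_trans H _.
  by rewrite lee_fin; lra.
have gd w : closed_disc z0 r w -> g j w + ddc h j w <= - d by move=> /Hr[[]].
have ab w : h (param j w) + (u0 - h x0) = (u0 - s z0 + (Q w - Q z0)) + s w.
  have -> : Q z0 = h x0 - s z0 by rewrite /Q /hj/= zx.
  rewrite /Q /hj/=; ring.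
have wE w : closed_disc z0 r w -> ((h (param j w) + (u0 - h x0))%:E - u (param j w) =
    (u0 - s z0 + (Q w - Q z0))%:E - v w)%E.
  by move=> wd; rewrite (vs w (HV w wd)); exact: (shift_real _ (ab w)).1.
have vQ w : closed_disc z0 r w -> (v w <= (u0 - s z0 + (Q w - Q z0))%:E)%E.
  move=> wd; apply: (shift_real _ (ab w)).2; rewrite -(vs w (HV w wd)); exact: uA.
have [e1 e10 He1] := viscosity_plane oV psv r0 HV vz cQ QK vQ eps0.
have [e e0 [er ee1]] : exists2 e, 0 < e & e <= r / 2 /\ e <= e1.
  have r2 : 0 < r / 2 by rewrite divr_gt0.
  by have [e e0 [h1 h2 _]] := min3_exists r2 e10 e10; exists e.
suff : d * m <= (4 * pi)^-1 * eps by lra.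
apply: (green_test pu Ch r0 e0 d0 _ uA gd (Hm e e0 er)).
  by move=> w /HV/Vj.
apply: le_trans (He1 e e0 ee1).
rewrite le_eqVlt; apply/orP; left; apply/eqP; apply: eq_integral => w; rewrite inE => /ltW wd.
by rewrite wE.
Qed.

End Viscosity.

(** * Smooth quasi-psh functions *)

Section SecondDifference.
Context {R : realType}.
Local Notation leb := (@lebesgue_measure R).

(** Translating the angle by pi does not change the integral over the circle, so twice the integral
    is that of the sum over antipodal points, bounded below pointwise by 2 v c. Nonnegativity gives
    the integrals a meaning and allows [integral_period]. *)
Lemma circle_mean (v : plane R -> R) (c : plane R) (r : R) : 0 < r ->
  (forall t, {for (c.1 + r * cos t, c.2 + r * sin t), continuous v}) ->
  0 <= v c -> (forall t, 0 <= v (c.1 + r * cos t, c.2 + r * sin t)) ->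
  (forall t, 2 * v c <= v (c.1 + r * cos t, c.2 + r * sin t) + v (c.1 - r * cos t, c.2 - r * sin t)) ->
  ((v c)%:E <= ((2 * pi)^-1)%:E * \int[leb]_(s in `[0%R, (2 * pi)%R])
     (v (c.1 + r * cos s, c.2 + r * sin s)%R)%:E)%E.
Proof.
move=> r0 cv vc0 v0 sv; have p0 := pi_gt0 R.
have pi2 : 0 < 2 * pi :> R by rewrite mulr_gt0.
pose F (t : mR R) : \bar R := (v (c.1 + r * cos t, c.2 + r * sin t))%:E.
have mF : measurable_fun setT F.
  apply/measurable_EFinP; apply: continuous_measurable_fun => t.
  apply: (@continuous_comp _ _ _ (fun t : R => ((c.1 + r * cos t, c.2 + r * sin t) : plane R)) v); last exact: cv.
  apply: continuous_pair; apply: continuousD; try exact: cst_continuous.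
    by apply: continuousM; [exact: cst_continuous|exact: continuous_cos].
  by apply: continuousM; [exact: cst_continuous|exact: continuous_sin].
have F0 t : (0 <= F t)%E by rewrite lee_fin.
have Fp t : F (t + 2 * pi) = F t.
  by rewrite /F mulr_natl cosD2pi sinD2pi.
have Fpi t : F (t + pi) = (v (c.1 - r * cos t, c.2 - r * sin t))%:E.
  by rewrite /F (cosDpi t) (sinDpi t) !mulrN.
have ppi : 0 <= (pi : R) <= 2 * pi by lra.
have E := integral_period ppi mF F0 Fp.
pose I := `[0%R, (2 * pi)%R]%classic : set (mR R).
have mI : measurable I by exact: measurable_itv.
have lI : leb I = (2 * pi)%:E by rewrite /I lebesgue_measure_itv/= lte_fin pi2 oppr0 adde0.
have mFI : measurable_fun I F by exact: (measurable_funS measurableT _ mF).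
have mFpi : measurable_fun I (fun t => F (t + pi)).
  apply: (measurable_funS measurableT) => //; apply: (measurableT_comp mF).
  exact: measurable_funD.
have H : ((2 * v c)%:E * (2 * pi)%:E <= \int[leb]_(s in I) F s + \int[leb]_(s in I) F s)%E.
  rewrite -{2}E -ge0_integralD//.
  apply: (@le_trans _ _ (\int[leb]_(s in I) cst (2 * v c)%:E s)%E).
    by rewrite -lI le_eqVlt; apply/orP; left; apply/eqP; rewrite integral_cst.
  apply: ge0_le_integral => //; first by move=> t _; rewrite lee_fin mulr_ge0.
  - exact: emeasurable_funD.
  - by move=> t _; rewrite Fpi /F -EFinD lee_fin; exact: sv.
rewrite -/F -/I; move: H.
have : (0 <= \int[leb]_(s in I) F s)%E by exact: integral_ge0.
case: (\int[leb]_(s in I) F s)%E => [x| |] // _.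
  rewrite -EFinM -EFinD -EFinM !lee_fin => h.
  by rewrite ler_pdivlMl//; lra.
by move=> _; rewrite gt0_muley ?lte_fin ?invr_gt0// leey.
Qed.

Definition sqnorm (w : plane R) : R := w.1 ^+ 2 + w.2 ^+ 2.

Lemma sqnormE : sqnorm = sqdist (0 : plane R).
Proof. by apply/funext => w; rewrite /sqnorm /sqdist !subr0. Qed.

Lemma add_square_mean (M K a b x y q1 q2 q3 : R) : 0 <= M ->
  - (M * (a ^+ 2 + b ^+ 2)) <= q1 + q2 - 2 * q3 ->
  2 * (q3 - - (M * (x ^+ 2 + y ^+ 2) + K)) <=
  q1 - - (M * ((x + a) ^+ 2 + (y + b) ^+ 2) + K) + (q2 - - (M * ((x - a) ^+ 2 + (y - b) ^+ 2) + K)).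
Proof.
move=> M0 h; have ab : 0 <= M * (a ^+ 2 + b ^+ 2) by rewrite mulr_ge0// addr_ge0// sqr_ge0.
rewrite -subr_ge0 (_ : _ - _ = (q1 + q2 - 2 * q3 + M * (a ^+ 2 + b ^+ 2)) + M * (a ^+ 2 + b ^+ 2)); last by ring.
by rewrite addr_ge0// -lerBlDr sub0r.
Qed.

(** By [second_difference], q + M |w|^2 has nonnegative second differences near z, which is the
    antipodal inequality of [circle_mean]. The smooth part to be removed is minus this quadratic
    term and a constant. *)
Lemma quasi_psh_plane U (q : plane R -> R) (z : plane R) : open U -> U z -> Ck 2 U q ->
  exists (V : set (plane R)) (s : plane R -> R), [/\ open V, V z, V `<=` U, smooth_on V s &
    psh_on V (fun w => (q w - s w)%:E)].
Proof.
move=> oU Uz Cq; have [M [d d0 [M0 HM]]] := second_difference oU Uz Cq.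
have cq : {for z, continuous (fun w => q w + M * sqnorm w)}.
  apply: continuousD; first exact: (Ck_cont Cq Uz).
  apply: continuousM; first exact: cst_continuous.
  by rewrite sqnormE; exact: (Ck_cont (Ck_sqdist (0 : plane R) 0)).
(* The constant makes the function equal to 1 at z, hence nonnegative nearby. *)
pose K := 1 - (q z + M * sqnorm z).
have n1 : \forall w \near z, 0 <= q w + M * sqnorm w + K.
  have /cvgrPdist_lt/(_ 1 ltr01) := cq.
  by apply: filterS => w; rewrite ltr_norml /K; lra.
have n2 : \forall w \near z, U w by exact: open_nbhs_nbhs.
have n3 : \forall w \near z, ball z d w by exact: nbhsx_ballx.
have [e /= e0 He] := (nbhs_ballP z _).1 (filterI n1 (filterI n2 n3)).
exists (ball z e), (fun w => - (M * sqnorm w + K)); split.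
- exact: ball_open.
- exact: ballxx.
- by move=> w /He[_ []].
- have oB : open (ball z e) by exact: ball_open.
  move=> k; apply: (CkN oB); apply: (CkD oB); last exact: Ck_cst.
  apply: (CkZ _ oB); rewrite sqnormE.
  by apply/Ck_pt => w _; move/Ck_pt: (Ck_sqdist (0 : plane R) k) => /(_ w I).
have cB w : ball z e w -> {for w, continuous (fun w => q w - - (M * sqnorm w + K))}.
  move=> /He[_ [Uw _]]; apply: continuousB; first exact: (Ck_cont Cq Uw).
  apply: continuousN; apply: continuousD; last exact: cst_continuous.
  apply: continuousM; first exact: cst_continuous.
  by rewrite sqnormE; exact: (Ck_cont (Ck_sqdist (0 : plane R) 0)).
split.
  move=> w wB; split; first exact: ltry.
  move=> a; rewrite lte_fin => wa.
  have := cB w wB; move=> /cvgrPdist_lt/(_ (a - (q w - - (M * sqnorm w + K)))).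
  rewrite subr_gt0 => /(_ wa); apply: filterS => y; rewrite lte_fin ltr_norml.
  by move: (q y - _) (q w - _) wa => s t; lra.
move=> c r r0 cV.
have circ t : closed_disc c r (c.1 + r * cos t, c.2 + r * sin t).
  by rewrite /closed_disc/= -/(sqdist c (_, _)) sqdist_circle.
have circN t : closed_disc c r (c.1 - r * cos t, c.2 - r * sin t).
  have := circ (t + pi); rewrite (cosDpi t) (sinDpi t) !mulrN.
  exact.
have cc : closed_disc c r c by rewrite /closed_disc/= !subrr expr0n/= addr0 sqr_ge0.
apply: (@circle_mean (fun w => q w - - (M * sqnorm w + K)) c r r0).
- by move=> t; apply: cB; apply: cV.
- by have [h _] := He _ (cV _ cc); rewrite opprK addrA.
- move=> t; have [h _] := He _ (cV _ (circ t)); rewrite opprK addrA; exact: h.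
move=> t.
have [_ [_ b0]] := He _ (cV _ cc).
have [_ [_ b1]] := He _ (cV _ (circ t)).
have [_ [_ b2]] := He _ (cV _ (circN t)).
have := HM c (r * cos t, r * sin t) b0 b1 b2.
rewrite -[c + _]/(c.1 + r * cos t, c.2 + r * sin t) -[c - _]/(c.1 - r * cos t, c.2 - r * sin t) /=.
move: (q (c.1 + _, _)) (q (c.1 - _, _)) (q c) => q1 q2 q3.
rewrite /sqnorm /=; exact: add_square_mean.
Qed.

End SecondDifference.

Section SmoothPSH.
Context {R : realType} {X : compactRiemannSurface R}.
Variable g : coefs X.
Hypothesis kg : kahler_form g.

Lemma form_current_add_ddc (h chi : X -> R) : CkX 2 h -> smooth_fun chi ->
  form_current (add_ddc g h) chi = (form_current g chi + ddc_current (fun x => (h x)%:E) chi)%E.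
Proof.
move=> Ch schi; have Cchi k : CkX k chi by move=> i; exact: schi.
have -> : ddc_current (fun x => (h x)%:E) chi = form_int (fun i z => (chi (param i z) * ddc h i z)%:E).
  by rewrite (green kg Ch (Cchi 2%N)); apply: form_int_congr => i z _; rewrite EFinM.
rewrite -form_intD.
- by apply: form_int_congr => i z _; rewrite -EFinD -mulrDr.
- exact: (form_integrable_Ck kg (kahler_Ck kg 0) (Cchi 0%N)).
- exact: (form_integrable_ddc kg (Cchi 0%N) Ch).
Qed.

(** Green's formula identifies the current of h with the pointwise form, whose sign is assumed; the
    local splittings come from [quasi_psh_plane]. *)
Lemma C2_PSH (h : X -> R) : CkX 2 h -> (forall i z, img i z -> 0 <= add_ddc g h i z) ->
  PSH g (fun x => (h x)%:E).
Proof.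
move=> Ch h0; split.
- move=> x; split; first exact: ltry.
  move=> a; rewrite lte_fin => xa.
  have /cvgrPdist_lt/(_ (a - h x)) := @CkX_continuous R X 2 h Ch x.
  rewrite subr_gt0 => /(_ xa); apply: filterS => y; rewrite lte_fin ltr_norml.
  by move: (h y) (h x) xa => s t; lra.
- move=> i; have := form_integrable_Ck kg (kahler_Ck kg 0) (CkX_le (leq0n 2) Ch) i.
  by under eq_fun do rewrite EFinM.
- move=> i z zi; have [V [s [oV Vz VU sV psV]]] := quasi_psh_plane (@img_open R X i) zi (Ch i).
  exists V; split => //; exists (fun w => (h (param i w) - s w)%:E), s; split => //.
  by move=> w _; rewrite -EFinD subrK.
- move=> chi schi chi0; rewrite /add_ddc_current -form_current_add_ddc//.
  apply: form_int_ge0 => i z zi; rewrite lee_fin mulr_ge0 ?chi0//.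
  exact: h0.
Qed.

End SmoothPSH.

(** * Maximum principles along the flow *)

(** If no point were maximal, near each p the values would stay below some H q, by upper
    semicontinuity. Compactness along the filter of superlevel sets then produces a point with H p <
    H p. *)
Lemma usc_compact_max {R : realType} {T : topologicalType} (K : set T) (H : T -> \bar R) :
  compact K -> K !=set0 -> (forall p, K p -> (H p < +oo)%E) ->
  (forall p, K p -> forall a : R, (H p < a%:E)%E -> \forall q \near p, K q -> (H q < a%:E)%E) ->
  exists2 p, K p & forall q, K q -> (H q <= H p)%E.
Proof.
move=> cK [k0 Kk0] Hoo usc; apply: contrapT => nomax.
have nx p : K p -> exists2 q, K q & (H p < H q)%E.
  move=> Kp; apply: contrapT => h; apply: nomax; exists p => // q Kq.
  by rewrite leNgt; apply/negP => pq; apply: h; exists q.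
pose F : set_system T := filter_from K (fun p => [set q | K q /\ (H p <= H q)%E]).
have FF : Filter F.
  apply: filter_from_filter; first by exists k0.
  move=> p q Kp Kq; have [pq|/ltW qp] := leP (H p) (H q).
    by exists q => // r [Kr qr]; split; split => //; exact: le_trans qr.
  by exists p => // r [Kr qr]; split; split => //; exact: le_trans qr.
have /compact_near_coveringP/(_ _ F (fun r q => K q -> (H q < H r)%E) FF) := cK.
case.
  move=> p Kp; have [q Kq pq] := nx p Kp.
  move: (Hoo q Kq) (pq); case Eq : (H q) => [b| |] // _ pb; last by rewrite ltNge leNye in pb.
  exists ([set r | K r -> (H r < b%:E)%E], [set r | K r /\ (H q <= H r)%E]).
    by split; [exact: usc|exists q].
  by move=> [r s] [/= h1 [Ks h2]] Kr; apply: lt_le_trans (h1 Kr) _; rewrite -Eq.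
move=> p Kp /(_ p (conj Kp (lexx _)) p Kp Kp).
by rewrite ltxx.
Qed.

Lemma slope_neg {R : realType} (a b c d K : R) : a <= b -> c <= d -> b < K -> a + c - (d + K) < 0.
Proof. lra. Qed.

(** The sign of the time derivative in the lower comparison. Since u <= T c, the source terms leave
    at most - d c, hence d M; the logarithm contributes at most b. *)
Lemma slope_neg' {R : realType} (a b c d u M T K : R) : 0 < T -> 0 <= d -> d <= 1 -> - b <= a ->
  `|c| <= M -> u <= T * c -> b + d * M < K -> (1 - d) * (T^-1 * u) - (a + c) - K < 0.
Proof.
move=> T0 d0 d1 ab cM uc bK.
have v : T^-1 * u <= c by rewrite mulrC ler_pdivrMr// mulrC.
have v2 : (1 - d) * (T^-1 * u) <= (1 - d) * c by rewrite ler_wpM2l// subr_ge0.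
have dM : - (d * M) <= d * c.
  by rewrite -mulrN ler_wpM2l//; move: cM; rewrite ler_norml => /andP[].
by move: v2; rewrite mulrBl mul1r; lra.
Qed.

(** For c > 0 a suitable b slightly above u x, or very negative if u x = -oo, persists near x. For c
    = 0, which is the initial time, the product is 0 even at -oo, and the global bound B serves. *)
Lemma usc_product_bound {R : realType} {T : topologicalType} (u : T -> \bar R) (x : T) (c B s a : R) :
  0 <= c -> usc_at u x -> (forall y, (u y <= B%:E)%E) -> (c%:E * u x - s%:E < a%:E)%E ->
  exists b, (\forall y \near x, (u y <= b%:E)%E) /\ c * b - s < a.
Proof.
move=> c0 uu uB h; move: c0; rewrite le_eqVlt => /predU1P[c0|c0].
  exists B; split; first exact: filterE.
  by move: h; rewrite -c0 mul0e mul0r sub0e -EFinN lte_fin sub0r.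
have [b [ub cb]] : exists b : R, (u x < b%:E)%E /\ c * b - s < a.
  move: h (uB x); case: (u x) => [r| |] //.
    rewrite -EFinM -EFinB lte_fin => h _.
    exists (r + (a - (c * r - s)) / 2 / c); split.
      by rewrite lte_fin ltrDl !divr_gt0// subr_gt0.
    by rewrite mulrDr (mulrC c (_ / c)) divfK ?gt_eqF//; lra.
  move=> _ _; exists ((a + s - 1) / c); split; first exact: ltNyr.
  by rewrite mulrC divfK ?gt_eqF//; lra.
by exists b; split => //; apply: filterS (uu b ub) => y /ltW.
Qed.

Lemma near_arith {R : realType} (a P K1 F P' K1' F' : R) :
  - ((a - (P - (F + K1))) / 2) < P - K1 - (P' - K1') < (a - (P - (F + K1))) / 2 ->
  - ((a - (P - (F + K1))) / 2) < F' - F < (a - (P - (F + K1))) / 2 -> P' - (F' + K1') < a.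
Proof. by move=> /andP[h1 h2] /andP[h3 h4]; lra. Qed.

Lemma touch_above {R : realType} (v : \bar R) (c u0 p p0 k : R) : 0 < c ->
  (c%:E * v - (p + k)%:E <= (c * u0 - (p0 + k))%:E)%E ->
  (v <= (u0 + (c^-1 * p - c^-1 * p0))%:E)%E.
Proof.
move=> c0; case: v => [v| |] //.
- rewrite -EFinM -EFinB !lee_fin => h.
  rewrite -(ler_pM2l c0) mulrDr mulrBr !mulVKf ?gt_eqF//; lra.
- by rewrite gt0_muley ?lte_fin.
- by move=> _; exact: leNye.
Qed.

(** The hypothesis says L >= - c g, and c <= 1 - d leaves the share d of g. *)
Lemma visc_arith {R : realType} (c d g L : R) : 0 < c -> c <= 1 - d -> 0 <= g ->
  0 <= g + c^-1 * L -> d * g <= g + L.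
Proof.
move=> c0 cd g0 h; have := mulr_ge0 (ltW c0) h; rewrite mulrDr mulVKf ?gt_eqF// => h2.
have : c * g <= (1 - d) * g by rewrite ler_wpM2r.
by rewrite mulrBl mul1r; lra.
Qed.

Lemma ratio_arith {R : realType} (C d g w L : R) : 0 < C -> 0 < w -> 0 <= d -> d * g <= L ->
  w <= C * g -> d / C <= L / w.
Proof.
move=> C0 w0 d0 dg wC; rewrite ler_pdivlMr// mulrAC ler_pdivrMr//.
apply: le_trans (ler_wpM2l d0 wC) _; rewrite mulrCA mulrC.
by rewrite ler_wpM2r// ltW.
Qed.

Section Flow.
Context {R : realType} {X : compactRiemannSurface R}.
Variables (f : X -> R) (g w : coefs X) (beta : R) (phi : R -> X -> R).
Hypotheses (kg : kahler_form g) (kw : kahler_form w) (b0 : 0 < beta).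
Hypothesis flow : kahler_ricci_flow g w f beta phi.

Definition cylinder (T : R) : set (R * X) := `[0, T]%classic `*` [set: X].

Lemma cylinderP T (p : R * X) : cylinder T p <-> 0 <= p.1 <= T.
Proof. by rewrite /cylinder /setX/= in_itv/=; split => [[]|]. Qed.

Lemma compact_cylinder T : compact (cylinder T).
Proof. by apply: compact_setX; [exact: segment_compact|exact: rs_compact]. Qed.

Lemma flow_CkX t : 0 <= t -> CkX 2 (phi t).
Proof.
by move=> t0; have [_ _ _ [a _ /(_ t t0) C] _] := flow => i; have [] := C i.
Qed.

Lemma flow_near T (p : R * X) (e : R) : cylinder T p -> 0 < e ->
  \forall q \near p, cylinder T q -> `|phi q.1 q.2 - phi p.1 p.2| < e.
Proof.
move=> /cylinderP/andP[p0 _] e0; have [cphi _ _ _ _] := flow.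
have /subspace_continuousP/(_ p p0) := cphi.
move=> /cvgrPdist_lt/(_ e e0); rewrite near_withinE; apply: filterS => q H /cylinderP/andP[q0 _].
by rewrite distrC; exact: H.
Qed.

Lemma flow_derive (t : R) (x : X) : 0 < t -> exists i (D : R), [/\ dom i x,
  is_derive t 1 (fun s => phi s x) D &
  D = beta^-1 * ln ((g i (Defs.coord i x) + ddc (phi t) i (Defs.coord i x)) / w i (Defs.coord i x)) + f x].
Proof.
move=> t0; have [_ _ _ _ dphi] := flow; have [i xi] := dom_cover x.
by exists i, (beta^-1 * ln (add_ddc g (phi t) i (Defs.coord i x) / w i (Defs.coord i x)) + f x);
  split => //; exact: dphi.
Qed.

(* At a positive maximum of phi - s f1 - K s the two sides of the flow equation are incompatible. *)
Lemma flow_upper (f1 : X -> R) (T C K : R) : 0 <= T -> CkX 2 f1 -> (forall x, f x <= f1 x) -> 0 < C ->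
  (forall s i z, 0 <= s <= T -> img i z -> g i z + s * ddc f1 i z <= C * w i z) ->
  beta^-1 * ln C < K -> forall x, phi T x <= T * f1 x + K * T.
Proof.
move=> T0 Cf1 ff1 C0 HC HK x1; rewrite leNgt; apply/negP => neg.
have [_ phi0 pphi _ _] := flow.
pose h (p : R * X) := p.1 * f1 p.2 + K * p.1.
have ch : continuous h.
  move=> p; apply: cvgD; last by apply: cvgM; [exact: cvg_cst|exact: cvg_fst].
  apply: cvgM; first exact: cvg_fst.
  apply: (@continuous_comp _ _ _ (@snd R X) f1); first exact: cvg_snd.
  exact: (@CkX_continuous R X 2 f1 Cf1).
have usc p : cylinder T p -> forall a : R, ((phi p.1 p.2 - h p)%:E < a%:E)%E ->
    \forall q \near p, cylinder T q -> ((phi q.1 q.2 - h q)%:E < a%:E)%E.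
  move=> pT a; rewrite lte_fin => pa.
  have e0 : 0 < (a - (phi p.1 p.2 - h p)) / 2 by rewrite divr_gt0// subr_gt0.
  have n1 := flow_near pT e0.
  have /cvgrPdist_lt/(_ _ e0) n2 := ch p.
  apply: filterS2 n1 n2 => q H1 H2 qT; rewrite lte_fin.
  have := H1 qT; move: H2; rewrite !ltr_norml.
  by move: (phi q.1 q.2) (h q) (phi p.1 p.2) (h p) pa => a1 a2 a3 a4 pa; lra.
have [[s0 x0] p0 pmax] := usc_compact_max (@compact_cylinder T)
  (ex_intro _ (T, x1) ((cylinderP T (T, x1)).2 (introT andP (conj T0 (lexx T)))))
  (fun p _ => ltry (phi p.1 p.2 - h p)) usc.
have {}pmax s x : 0 <= s <= T -> phi s x - (s * f1 x + K * s) <= phi s0 x0 - (s0 * f1 x0 + K * s0).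
  by move=> sT; have := pmax (s, x) ((cylinderP T (s, x)).2 sT); rewrite lee_fin.
move/cylinderP : p0 => /= /andP[s00 s0T].
have pos : 0 < phi s0 x0 - (s0 * f1 x0 + K * s0).
  apply: lt_le_trans (pmax T x1 _); last by rewrite T0 lexx.
  by rewrite subr_gt0.
(* At time 0 the comparison function is 0, since phi starts from 0; a positive maximum is thus
   attained where the flow equation holds. *)
have s0p : 0 < s0.
  rewrite lt_neqAle s00 andbT; apply/eqP => E; move: pos.
  by rewrite -E phi0 !mul0r mulr0 addr0 subrr ltxx.
have [i [D [xi dD DE]]] := flow_derive x0 s0p.
have zi := coord_img xi; have zx := coordK xi; set z0 := Defs.coord i x0 in zi zx DE *.
have Cphi := flow_CkX s00.
have oi := @img_open R X i.
(* At fixed time s0 the difference phi - s0 f1 has a spatial maximum at x0. *)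
have lap : laplacian (phi s0 \o @param R X i) z0 <= s0 * laplacian (f1 \o @param R X i) z0.
  have C2 := CkD oi (CkZ 1 oi (Cphi i)) (CkZ (- s0) oi (Cf1 i)).
  have N : \forall y \near z0, 1 * (phi s0 \o @param R X i) y + - s0 * (f1 \o @param R X i) y <=
      1 * (phi s0 \o @param R X i) z0 + - s0 * (f1 \o @param R X i) z0.
    apply: (near_open oi zi) => y yi /=; rewrite !mul1r !mulNr zx.
    by have := pmax s0 (param i y); rewrite s00 s0T => /(_ isT); lra.
  have := laplacian_max oi zi C2 N; rewrite (laplacian_lin _ _ oi zi (Cphi i) (Cf1 i)).
  by move: (laplacian _ _) (laplacian _ _) => a1 a2; rewrite mul1r mulNr subr_le0.
have ddcle : g i z0 + ddc (phi s0) i z0 <= C * w i z0.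
  apply: le_trans (HC s0 i z0 _ zi); last by rewrite s00 s0T.
  rewrite lerD2l !ddcE mulrCA; apply: ler_wpM2l => //.
  by rewrite invr_ge0 mulr_ge0// pi_ge0.
have [_ pw _] := kw; have w0 := pw _ _ zi.
have lnC : beta^-1 * ln ((g i z0 + ddc (phi s0) i z0) / w i z0) <= beta^-1 * ln C.
  apply: ler_wpM2l; first by rewrite invr_ge0 ltW.
  have g0 : 0 < g i z0 + ddc (phi s0) i z0 by exact: (pphi s0 s00 i z0 zi).
  by rewrite ler_ln ?posrE ?divr_gt0// ler_pdivrMr.
have dF : is_derive s0 1 (fun s => phi s x0 - (s * f1 x0 + K * s)) (D - (f1 x0 + K)).
  have d1 := is_deriveM (is_derive_id s0 (1 : R)) (is_derive_cst (f1 x0) s0 (1 : R)).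
  have d2 := is_deriveZ K (is_derive_id s0 (1 : R)).
  apply: (is_derive_eq (is_deriveB dD (is_deriveD d1 d2))).
  by rewrite /GRing.scale/= mulr0 add0r !mulr1.
have := is_derive_left_max dF _; rewrite leNgt => /(_ _)/negP; apply.
  have : \forall s \near s0, 0 < s by exact: lt_nbhsr.
  apply: filterS => s s1 ss0; apply: pmax.
  by rewrite (ltW s1) (le_trans ss0 s0T).
by rewrite DE; exact: (slope_neg lnC (ff1 x0) HK).
Qed.

Lemma flow_lower (u : X -> \bar R) (d T C M K : R) : PSH g u -> 0 < T -> 0 < d < 1 ->
  (forall x, `|f x| <= M) -> (forall x, (u x <= (T * f x)%:E)%E) -> 0 < C ->
  (forall i z, img i z -> w i z <= C * g i z) -> beta^-1 * ln (C / d) + d * M < K ->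
  forall x, ((1 - d)%:E * u x <= (phi T x + K * T)%:E)%E.
Proof.
move=> pu T0 /andP[d0 d1] fM uf C0 HC HK x1; rewrite leNgt; apply/negP => neg.
have [_ phi0 pphi _ _] := flow; have [uu _ _ _] := pu.
have d1' : 0 < 1 - d by rewrite subr_gt0.
have T1 : 0 < T^-1 by rewrite invr_gt0.
(* It vanishes at time 0 and reaches 1 - d at time T, so it never exceeds 1 - d on the cylinder. *)
pose c (s : R) := (1 - d) * (T^-1 * s).
have c0 s : 0 <= s -> 0 <= c s by move=> s0; rewrite !mulr_ge0// ltW.
pose H (p : R * X) : \bar R := ((c p.1)%:E * u p.2 - (phi p.1 p.2 + K * p.1)%:E)%E.
have HE s x : H (s, x) = ((c s)%:E * u x - (phi s x + K * s)%:E)%E by [].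
have uB x : (u x <= (T * M)%:E)%E.
  apply: le_trans (uf x) _; rewrite lee_fin ler_wpM2l ?(ltW T0)//.
  by apply: le_trans (fM x); exact: ler_norm.
have Hoo p : cylinder T p -> (H p < +oo)%E.
  move=> /cylinderP/andP[p0 _].
  apply: (@le_lt_trans _ _ ((c p.1)%:E * (T * M)%:E - (phi p.1 p.2 + K * p.1)%:E)%E).
    by apply: leeB => //; apply: lee_wpmul2l; rewrite ?lee_fin ?c0.
  by rewrite -EFinM -EFinB ltry.
have usc p : cylinder T p -> forall a : R, (H p < a%:E)%E ->
    \forall q \near p, cylinder T q -> (H q < a%:E)%E.
  move=> pT a pa; have /cylinderP/andP[p0 p0T] := pT.
  have [b [ub cb]] : exists b, (\forall y \near p.2, (u y <= b%:E)%E) /\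
      c p.1 * b - (phi p.1 p.2 + K * p.1) < a.
    exact: (usc_product_bound (c0 _ p0) (uu p.2).2 uB pa).
  have ch : {for p, continuous (fun q : R * X => c q.1 * b - K * q.1)}.
    apply: cvgB; last by apply: cvgM; [exact: cvg_cst|exact: cvg_fst].
    apply: cvgM; last exact: cvg_cst.
    by apply: cvgM; [exact: cvg_cst|apply: cvgM; [exact: cvg_cst|exact: cvg_fst]].
  have e0 : 0 < (a - (c p.1 * b - (phi p.1 p.2 + K * p.1))) / 2 by rewrite divr_gt0// subr_gt0.
  have n1 := flow_near pT e0.
  have /cvgrPdist_lt/(_ _ e0) n2 := ch.
  have n3 : \forall q \near p, (u q.2 <= b%:E)%E by exact: (cvg_snd ub).
  apply: filterS3 n1 n2 n3 => q H1 H2 H3 qT; have /cylinderP/andP[q0 _] := qT.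
  apply: (@le_lt_trans _ _ ((c q.1)%:E * b%:E - (phi q.1 q.2 + K * q.1)%:E)%E).
    by apply: leeB => //; apply: lee_wpmul2l; rewrite ?lee_fin ?c0.
  rewrite -EFinM -EFinB lte_fin; have := H1 qT; move: H2; rewrite !ltr_norml.
  exact: near_arith.
have [[s0 x0] p0 pmax] := usc_compact_max (@compact_cylinder T)
  (ex_intro _ (T, x1) ((cylinderP T (T, x1)).2 (introT andP (conj (ltW T0) (lexx T))))) Hoo usc.
have {}pmax s x : 0 <= s <= T -> (H (s, x) <= H (s0, x0))%E.
  by move=> sT; exact: (pmax (s, x) ((cylinderP T (s, x)).2 sT)).
move/cylinderP : p0 => /= /andP[s00 s0T].
have pos : (0 < H (s0, x0))%E.
  apply: lt_le_trans (pmax T x1 _); last by rewrite (ltW T0) lexx.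
  rewrite HE /c mulVf ?gt_eqF// mulr1.
  by rewrite sube_gt0.
have s0p : 0 < s0.
  rewrite lt_neqAle s00 andbT; apply/eqP => E; move: pos.
  by rewrite HE -E phi0 /c !mulr0 mul0e addr0 sube0 ltxx.
have cs0 : 0 < c s0 by rewrite !mulr_gt0.
have [u0 ux] : exists u0, u x0 = u0%:E.
  move: pos (uB x0); rewrite HE; case: (u x0) => [u0| |] //; first by exists u0.
  by rewrite gt0_muleNy ?lte_fin.
have Hx0 s : H (s, x0) = (c s * u0 - (phi s x0 + K * s))%:E by rewrite HE ux.
have [i [D [xi dD DE]]] := flow_derive x0 s0p.
have zi := coord_img xi; have zx := coordK xi; set z0 := Defs.coord i x0 in zi zx DE *.
have Cphi := flow_CkX s00.
have oi := @img_open R X i.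
have Ch : CkX 2 (fun x => (c s0)^-1 * phi s0 x).
  by move=> j; exact: (CkZ _ (@img_open R X j) (Cphi j)).
(* Maximality at time s0, divided by [c s0], puts a translate of phi / c above u, with equality at
   x0. *)
have touch : \forall y \near x0, (u y <= (u0 + ((c s0)^-1 * phi s0 y - (c s0)^-1 * phi s0 x0))%:E)%E.
  apply: filterE => y; have := pmax s0 y; rewrite s00 s0T => /(_ isT).
  rewrite Hx0 HE; exact: touch_above.
have visc := viscosity kg pu xi ux Ch touch.
have ddcE' : ddc (fun x => (c s0)^-1 * phi s0 x) i z0 = (c s0)^-1 * ddc (phi s0) i z0.
  by rewrite !ddcE mulrCA; congr (_ * _); exact: (laplacianZ _ oi zi (Cphi i)).
have g0 : 0 < g i z0 by have [_ pg _] := kg; exact: pg.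
have c1 : c s0 <= 1 - d.
  by rewrite /c ler_piMr ?(ltW d1')// mulrC ler_pdivrMr// mul1r.
have low : d * g i z0 <= g i z0 + ddc (phi s0) i z0.
  rewrite -/z0 ddcE' in visc; exact: (visc_arith cs0 c1 (ltW g0) visc).
have [_ pw _] := kw; have w0 := pw _ _ zi.
have lnC : - (beta^-1 * ln (C / d)) <= beta^-1 * ln ((g i z0 + ddc (phi s0) i z0) / w i z0).
  rewrite -mulrN; apply: ler_wpM2l; first by rewrite invr_ge0 ltW.
  have g1 : 0 < g i z0 + ddc (phi s0) i z0 by exact: (pphi s0 s00 i z0 zi).
  rewrite -lnV ?posrE ?divr_gt0// ler_ln ?posrE ?invr_gt0 ?divr_gt0// invf_div.
  exact: (ratio_arith C0 w0 (ltW d0) low (HC i z0 zi)).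
have dF : is_derive s0 1 (fun s => c s * u0 - (phi s x0 + K * s)) ((1 - d) * (T^-1 * u0) - (D + K)).
  have d2 := is_deriveZ K (is_derive_id s0 (1 : R)).
  have d3 := is_deriveZ ((1 - d) * (T^-1 * u0)) (is_derive_id s0 (1 : R)).
  rewrite (_ : (fun s => _) = (((1 - d) * (T^-1 * u0)) *: id - ((fun s => phi s x0) + K *: id))); last first.
    by apply/funext => s; rewrite !fctE /GRing.scale/= /c; ring.
  by apply: (is_derive_eq (is_deriveB d3 (is_deriveD dD d2))); rewrite /GRing.scale/= !mulr1.
have := is_derive_left_max dF _; rewrite leNgt => /(_ _)/negP; apply.
  have : \forall s \near s0, 0 < s by exact: lt_nbhsr.
  apply: filterS => s s1 ss0; rewrite -lee_fin -!Hx0; apply: pmax.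
  by rewrite (ltW s1) (le_trans ss0 s0T).
rewrite DE opprD addrA.
have uf0 := uf x0; rewrite ux lee_fin in uf0.
exact: (slope_neg' T0 (ltW d0) (ltW d1) lnC (fM x0) uf0 HK).
Qed.

End Flow.

(** * Convergence *)

Section Continuity.
Context {R : realType} {X : compactRiemannSurface R}.

Lemma hoelder_on_continuous (a : R) (U : set (plane R)) (h : plane R -> R) z : 0 < a -> U z ->
  hoelder_on a U h -> {for z, continuous h}.
Proof.
move=> a0 Uz /(_ z Uz)[C [V zV HV]]; apply/cvgrPdist_lt => e e0.
have C0 : 0 < `|C| + 1 by rewrite ltr_wpDl.
have q0 : 0 < e / (`|C| + 1) by rewrite divr_gt0.
have [d d0 dE] : exists2 d : R, 0 < d & d `^ a = e / (`|C| + 1).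
  exists ((e / (`|C| + 1)) `^ a^-1); first exact: powR_gt0.
  by rewrite -powRrM mulVf ?gt_eqF// powRr1// ltW.
have nb : \forall p \near z, `|z - p| < d.
  by have /cvgrPdist_lt/(_ d d0) : (fun p : plane R => p) @ z --> z by exact: cvg_id.
have Vz : V z by exact: nbhs_singleton zV.
apply: filterS2 zV nb => p Vp zp.
apply: le_lt_trans (HV z p Vz Vp) _.
have pw : `|z - p| `^ a < e / (`|C| + 1) by rewrite -dE gt0_ltr_powR// ?nnegrE// ltW.
apply: (@le_lt_trans _ _ (`|C| * `|z - p| `^ a)); first by rewrite ler_wpM2r ?powR_ge0// ler_norm.
have [->|C1] := eqVneq C 0; first by rewrite normr0 mul0r.
apply: (@lt_le_trans _ _ (`|C| * (e / (`|C| + 1)))); first by rewrite ltr_pM2l// normr_gt0.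
by rewrite mulrCA ler_piMr ?(ltW e0)// ler_pdivrMr// mul1r lerDl.
Qed.

Lemma hoelder_continuous (a : R) (h : X -> R) : 0 < a -> hoelder_fun a h -> continuous h.
Proof.
move=> a0 hh x; have [i xi] := dom_cover x.
apply: (Ck0_continuous xi).
apply/Ck_pt => z zi; have := hoelder_on_continuous a0 zi (hh i).
Transparent Ck.
by move=> c; split => // y ->.
Opaque Ck.
Qed.

Lemma continuous_CkX (h : X -> R) : continuous h -> CkX 0 h.
Proof.
Transparent Ck.
move=> ch i; split=> // z zi.
Opaque Ck.
exact (continuous_comp (param_continuous zi) (ch (param i z))).
Qed.

Lemma continuous_bounded (f : X -> R) : continuous f -> exists2 M, 0 <= M & forall x, `|f x| <= M.
Proof.
move=> cf.
have /compact_near_coveringP/(_ _ (pinfty_nbhs R) (fun C x => `|f x| <= C) _) := @rs_compact R X.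
case.
  move=> x _; exists ([set y | `|f x - f y| < 1], [set C | `|f x| + 1 < C]).
    split; last by exists (`|f x| + 1); split => //; exact: num_real.
    by have /cvgrPdist_lt/(_ 1 ltr01) := cf x.
  move=> [y C] [/= h1 h2]; apply: le_trans (ltW h2).
  have := ler_normB (f x) (f x - f y); rewrite subKr; lra.
move=> M [Mr HM]; exists (`|M| + 1); first by rewrite addr_ge0.
move=> x; have := HM (`|M| + 1) _ x I; apply.
by rewrite (le_lt_trans (ler_norm M))// ltrDl.
Qed.

(** f1 interpolates between a constant A above f, away from x0, and the value f x0 + e at x0. Where
    the bump is nonzero f is below f x0 + e, and f1 never goes below that value. *)
Lemma barrier (f : X -> R) (M e : R) x0 : continuous f -> (forall x, `|f x| <= M) -> 0 < e ->
  exists f1, [/\ forall k, CkX k f1, forall x, f x <= f1 x & f1 x0 <= f x0 + e].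
Proof.
move=> cf fM e0.
have nN : \forall y \near x0, f y < f x0 + e.
  have /cvgrPdist_lt/(_ e e0) := cf x0.
  by apply: filterS => y; rewrite ltr_norml; lra.
have [jK [b [bC _ b01 b1 bN]]] := bump_exists nN.
have [A [A1 A2]] : exists A, M <= A /\ f x0 + e <= A.
  by exists (Num.max M (f x0 + e)); rewrite !le_max !lexx orbT.
exists (fun x => A + (f x0 + e - A) * b x); split.
- move=> k i; have oi := @img_open R X i.
  exact (CkD oi (Ck_cst k A oi) (CkZ (f x0 + e - A) oi (bC k i))).
- move=> x; have [bx|bx] := eqVneq (b x) 0.
    rewrite bx mulr0 addr0; apply: le_trans A1; apply: le_trans (fM x); exact: ler_norm.
  have fx := bN x bx; have /andP[b0 bl] := b01 x.
  have : (A - (f x0 + e)) * b x <= A - (f x0 + e) by rewrite ler_piMr// subr_ge0.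
  by rewrite -(opprB A) mulNr; lra.
- by rewrite b1 mulr1 addrC subrK.
Qed.

End Continuity.

Lemma pinfty_inv {R : realType} (c K : R) : 0 < K -> \forall b \near +oo, b^-1 * c < K /\ 0 < b.
Proof.
move=> K0; near=> b.
have b0 : 0 < b by near: b; exact: nbhs_pinfty_gt.
split => //; rewrite mulrC ltr_pdivrMr// mulrC -ltr_pdivrMr//.
by near: b; apply: nbhs_pinfty_gt; exact: num_real.
Unshelve. all: by end_near. Qed.

Lemma small_factor {R : realType} (T e n : R) : 0 < T -> 0 < e -> 0 < n ->
  exists2 K, 0 < K & n * (T * K) <= e.
Proof.
move=> T0 e0 n0; have T1 : 0 < T + 1 by rewrite addr_gt0.
exists (e / (n * (T + 1))); first by rewrite divr_gt0// mulr_gt0.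
rewrite (_ : _ * _ = e * (T / (T + 1))); last by field; rewrite !gt_eqF.
by rewrite ler_piMr ?(ltW e0)// ler_pdivrMr// mul1r lerDl.
Qed.

Lemma lower_arith {R : realType} (d r T K p e : R) : (1 - d) * r <= p + K * T ->
  d * r <= T * (K / 2) -> 2 * (T * K) <= e -> 0 < T * K -> r <= p + e.
Proof.
rewrite mulrBl mul1r (mulrC K) mulrA; move: (d * r) (T * K) => x y; lra.
Qed.

(** * Uniform two-sided estimates and passage to the limit *)

Section Limit.
Context {R : realType} {X : compactRiemannSurface R}.
Variables (f : X -> R) (g w : coefs X) (phi : R -> R -> X -> R) (M : R).
Hypotheses (cf : continuous f) (M0 : 0 <= M) (fM : forall x, `|f x| <= M).
Hypotheses (kg : kahler_form g) (kw : kahler_form w).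
Hypothesis flow : forall b, 0 < b -> kahler_ricci_flow g w f b (phi b).

(** The constant C depends on the barrier, hence on x0, so beta has to be large in terms of x0.
    Compactness of X gives one threshold for all points. *)
Lemma upper_uniform (T e : R) : 0 < T -> 0 < e ->
  \forall b \near +oo, forall x, phi b T x <= T * f x + e.
Proof.
move=> T0 e0.
(* Four errors T e1: the oscillations of f and of f1 near x0, the gap f1 x0 - f x0, and the
   logarithmic term. *)
have [e1 e10 e1E] := small_factor T0 e0 (@ltr0Sn R 3).
have /compact_near_coveringP/(_ _ (pinfty_nbhs R) (fun b x => phi b T x <= T * f x + e) _) := @rs_compact R X.
case; last first.
  move=> B [Br HB]; exists B; split => // b Bb x; exact: (HB b Bb x I).
move=> x0 _; have [f1 [f1C ff1 f1x]] := barrier x0 cf fM e10.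
have cf1 := @CkX_continuous R X 0 f1 (f1C 0%N).
have [C1 C10 HC1] := form_bounded kw (kahler_Ck kg 0).
have [C2 C20 HC2] := form_bounded kw (Ck_form_ddc (f1C 2%N)).
(* C1 bounds omega_0 and C2 bounds dd^c f1 against omega; the summand 1 makes C positive. *)
pose C := C1 + T * C2 + 1.
have C0 : 0 < C by rewrite ltr_wpDl// addr_ge0// mulr_ge0// ltW.
have [_ pw _] := kw.
have HC s i z : 0 <= s <= T -> img i z -> g i z + s * ddc f1 i z <= C * w i z.
  move=> /andP[s0 sT] zi; have h1 := HC1 i z zi; have h2 := HC2 i z zi.
  have w0 := pw _ _ zi.
  rewrite /C !mulrDl mul1r; apply: ler_wpDr; first exact: ltW.
  apply: lerD; first exact: le_trans (ler_norm _) h1.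
  rewrite -mulrA; apply: (@le_trans _ _ (s * (C2 * w i z))).
    by apply: ler_wpM2l => //; exact: le_trans (ler_norm _) h2.
  by apply: ler_wpM2r => //; rewrite mulr_ge0// ltW.
have n1 : \forall y \near x0, `|f x0 - f y| < e1.
  by have /cvgrPdist_lt/(_ e1 e10) := @cf x0.
have n2 : \forall y \near x0, `|f1 x0 - f1 y| < e1.
  by have /cvgrPdist_lt/(_ e1 e10) := cf1 x0.
exists ([set y | `|f x0 - f y| < e1 /\ `|f1 x0 - f1 y| < e1],
        [set b | b^-1 * ln C < e1 /\ 0 < b]).
  by split; [exact: filterS2 n1 n2|exact: pinfty_inv].
move=> [y b] [/= [h1 h2] [h3 b0]].
have := flow_upper kw b0 (flow b0) (ltW T0) (f1C 2%N) ff1 C0 HC h3 y.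
move: h1 h2; rewrite !ltr_norml => h1 h2 h.
apply: le_trans h _.
have : T * f1 y <= T * (f y + 3 * e1) by rewrite ler_wpM2l ?(ltW T0)//; lra.
by rewrite mulrDr (mulrC e1) (mulrCA T 3); lra.
Qed.

Lemma lower_uniform (T e : R) : 0 < T -> 0 < e -> \forall b \near +oo, forall u, PSH g u ->
  (forall y, (u y <= (T * f y)%:E)%E) -> forall x, (u x <= (phi b T x + e)%:E)%E.
Proof.
move=> T0 e0.
have [K K0 KE] := small_factor T0 e0 (@ltr0Sn R 1).
(* d is fixed before beta. The bound d M <= K / 2 serves twice: for the term d sup |f| in the
   comparison and for passing from (1 - d) u back to u. The other half of K absorbs the logarithm,
   for beta large in terms of d. *)
have [d d0 [d1 dK]] : exists2 d, 0 < d & d < 1 /\ d * M <= K / 2.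
  have M1 : 0 < M + 1 by rewrite ltr_wpDl.
  have K2 : 0 < K / 2 / (M + 1) by rewrite !divr_gt0.
  have [d d0 [h1 h2 _]] := min3_exists (@divr_gt0 R 1 2 ltr01 (ltr0Sn R 1)) K2 K2.
  exists d => //; split; first by lra.
  apply: (@le_trans _ _ (K / 2 / (M + 1) * (M + 1))); last by rewrite divfK// gt_eqF.
  by rewrite ler_pM ?(ltW d0)// lerDl.
have [C C0 HC] := form_bounded kg (kahler_Ck kw 0).
have C1 : 0 < C + 1 by rewrite ltr_wpDl.
have [_ pg _] := kg.
have HC' i z : img i z -> w i z <= (C + 1) * g i z.
  move=> zi; apply: le_trans (ler_norm _) _; apply: le_trans (HC i z zi) _.
  by rewrite ler_wpM2r ?lerDl// ltW// pg.
have K2 : 0 < K / 2 by rewrite divr_gt0.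
apply: filterS (pinfty_inv (ln ((C + 1) / d)) K2) => b [h b0] u pu uf x.
have d01 : 0 < d < 1 by rewrite d0 d1.
have hK : b^-1 * ln ((C + 1) / d) + d * M < K by lra.
have := flow_lower kg kw b0 (flow b0) pu T0 d01 fM uf C1 HC' hK x.
have := uf x; case: (u x) => [r| |] //; last by move=> _ _; exact: leNye.
rewrite -EFinM !lee_fin => rf rK.
have rM : r <= T * M.
  apply: le_trans rf _; rewrite ler_wpM2l ?(ltW T0)//; apply: le_trans (fM x); exact: ler_norm.
have dr : d * r <= T * (K / 2).
  apply: (@le_trans _ _ (d * (T * M))); first by rewrite ler_wpM2l// ltW.
  by rewrite mulrCA ler_wpM2l// ltW.
exact: (lower_arith rK dr KE (mulr_gt0 T0 K0)).
Qed.

Lemma envelope_close (T e : R) : 0 <= T -> 0 < e -> \forall b \near +oo, forall x,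
  ((phi b T x - e)%:E <= envelope g (fun x => T * f x)%R x)%E /\
  (envelope g (fun x => T * f x)%R x <= (phi b T x + e)%:E)%E.
Proof.
(* The lower comparison divides by T. At T = 0 both sides are checked directly: phi is 0 and the
   zero function is a competitor. *)
rewrite le_eqVlt => /predU1P[<-|T0] e0.
  have p0 : PSH g (fun=> 0%:E : \bar R).
    have C0 : CkX 2 ((fun=> 0) : X -> R) by move=> i; exact (Ck_cst 2 0 (@img_open R X i)).
    apply: (C2_PSH kg C0) => i z zi.
    rewrite /add_ddc ddcE (_ : (_ \o _) = (fun=> 0))// laplacian_cst mulr0 addr0.
    by have [_ pg _] := kg; apply: ltW; exact: pg.
  near=> b => x; have b0 : 0 < b by near: b; exact: nbhs_pinfty_gt.
  have [_ -> _ _ _] := flow b0; split.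
    apply: (@le_trans _ _ 0%:E); first by rewrite lee_fin sub0r oppr_le0 ltW.
    apply: ereal_sup_ubound; exists (fun=> 0%:E) => //=; split => // y.
    by rewrite mul0r.
  apply: ge_ereal_sup => _ [u [_ uf] <-]; apply: le_trans (uf x) _.
  by rewrite mul0r lee_fin add0r ltW.
have n1 := upper_uniform T0 e0; have n2 := lower_uniform T0 e0.
near=> b => x; have b0 : 0 < b by near: b; exact: nbhs_pinfty_gt.
have Hu : forall x, phi b T x <= T * f x + e by near: b.
have Hl : forall u, PSH g u -> (forall y, (u y <= (T * f y)%:E)%E) ->
  forall x, (u x <= (phi b T x + e)%:E)%E by near: b.
split; last by apply: ge_ereal_sup => _ [u [pu uf] <-]; exact: Hl.
have Cphi := flow_CkX (flow b0) (ltW T0).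
apply: ereal_sup_ubound; exists (fun x => (phi b T x - e)%:E) => //=; split; last first.
  by move=> y; rewrite lee_fin lerBlDr.
have Ce : CkX 2 (fun x => phi b T x - e).
  by move=> i; exact (CkB (@img_open R X i) (Cphi i) (Ck_cst 2 e (@img_open R X i))).
apply: (C2_PSH kg Ce) => i z zi; rewrite /add_ddc (ddc_add_cst (- e) Cphi zi).
by have [_ _ pp _ _] := flow b0; apply: ltW; exact: (pp T (ltW T0) i z zi).
Unshelve. all: by end_near. Qed.

Section AtTime.
Variable T : R.
Hypothesis T0 : 0 <= T.

Let P := envelope g (fun x => T * f x)%R.

Lemma envelope_fin_num x : P x \is a fin_num.
Proof.
have /filter_ex[b /(_ x)[h1 h2]] := envelope_close T0 (@ltr01 R).
rewrite fin_numE; apply/andP; split; apply/eqP => E.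
  by move: h1; rewrite -/P E leeNy_eq.
by move: h2; rewrite -/P E leye_eq.
Qed.

Lemma envelope_dist e : 0 < e -> \forall b \near +oo, forall x, `|phi b T x - fine (P x)| <= e.
Proof.
move=> e0; apply: filterS (envelope_close T0 e0) => b H x.
have [h1 h2] := H x; move: h1 h2; rewrite -/P -(fineK (envelope_fin_num x)) !lee_fin.
by rewrite /= ler_norml; move: (fine _) => p; lra.
Qed.

Lemma flow_cvg_uniform : {uniform, (fun b => phi b T) @ +oo --> (fun x => fine (P x))}.
Proof.
move=> A /uniform_nbhs[E [entE subA]].
move: entE; rewrite -entourage_ballE => -[e /= e0 He].
have e2 : 0 < e / 2 by rewrite divr_gt0.
apply: filterS (envelope_dist e2) => b Hb; apply: subA => x _; apply: He => /=.
rewrite /ball/= distrC; apply: le_lt_trans (Hb x) _.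
by rewrite ltr_pdivrMr// ltr_pMr// ltr1n.
Qed.

(** The envelope is a uniform limit of the continuous functions phi b T. *)
Lemma envelope_continuous : continuous (fun x => fine (P x)).
Proof.
apply: (@uniform_limit_continuous _ _ ((fun b => phi b T) @ +oo)); last exact: flow_cvg_uniform.
apply: filterS (nbhs_pinfty_gt (num_real (0 : R))) => b b0.
exact: (@CkX_continuous R X 2 _ (flow_CkX (flow b0) T0)).
Qed.

(** By Green's formula the pairing with chi puts dd^c on chi, so it depends on phi only through its
    integral against dd^c chi, whose absolute value has finite integral. Uniform convergence then
    suffices. *)
Lemma flow_cvg_current : cvg_current (fun b => form_current (add_ddc g (phi b T))) (add_ddc_current g P).
Proof.
move=> chi schi; have Cchi k : CkX k chi by move=> i; exact: schi.
have Cp : CkX 0 (fun x => fine (P x)) := continuous_CkX envelope_continuous.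
have fc := Ck_form_ddc (Cchi 2%N).
pose D (h : X -> R) := form_int (fun i z => (h (param i z) * ddc chi i z)%:E).
have intD h : CkX 0 h -> form_integrable (fun i z => (h (param i z) * ddc chi i z)%:E).
  by move=> Ch; exact: (form_integrable_ddc kg Ch (Cchi 2%N)).
have intA : form_integrable (fun i z => (`|ddc chi i z|)%:E).
  have [C C0 HC] := form_bounded kg fc.
  apply: (@form_integrable_le _ _ _ kg _ C) => i; last first.
    by move=> z zi; rewrite abse_EFin lee_fin normr_id; exact: HC.
  apply/measurable_EFinP; apply: measurableT_comp => //.
  exact: (Ck_measurable (@img_open R X i) (fc.2 i)).
pose N := fine (form_int (fun i z => (`|ddc chi i z|)%:E)).
have NE : N%:E = form_int (fun i z => (`|ddc chi i z|)%:E) by rewrite fineK// form_int_fin_num.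
(* A one-sided estimate, used in both directions. *)
have half h k e : CkX 0 h -> CkX 0 k -> (forall x, `|h x - k x| <= e) -> fine (D h) <= fine (D k) + e * N.
  move=> Ch Ck_ hk; rewrite -lee_fin EFinD EFinM NE !fineK; try exact: (form_int_fin_num (intD _ _)).
  rewrite -form_intZ// -form_intD; [|exact: intD|exact: form_integrableZ].
  apply: le_form_int; [exact: intD|apply: form_integrableD; [exact: intD|exact: form_integrableZ]|].
  move=> i z zi; rewrite -EFinM -EFinD lee_fin -lerBlDl -mulrBl.
  apply: le_trans (ler_norm _) _; rewrite normrM.
  by apply: ler_wpM2r => //; exact: hk.
have DE h : ddc_current (fun x => (h x)%:E) chi = D h.
  by apply: form_int_congr => i z _; rewrite EFinM.
have PE : ddc_current P chi = D (fun x => fine (P x)).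
  by rewrite -DE; congr ddc_current; apply/funext => x; rewrite fineK// envelope_fin_num.
have fg : form_current g chi \is a fin_num.
  by apply: form_int_fin_num; exact: (form_integrable_Ck kg (kahler_Ck kg 0) (Cchi 0%N)).
have fD h : CkX 0 h -> D h \is a fin_num by move=> Ch; apply: form_int_fin_num; exact: intD.
rewrite /add_ddc_current PE -(fineK fg) -(fineK (fD _ Cp)) -EFinD.
have Cphi b : 0 < b -> CkX 2 (phi b T) by move=> b0; exact: (flow_CkX (flow b0) T0).
have currE b : 0 < b -> form_current (add_ddc g (phi b T)) chi =
    (fine (form_current g chi) + fine (D (phi b T)))%:E.
  move=> b0; rewrite (form_current_add_ddc kg (Cphi b b0) schi) DE EFinD !fineK//.
  by apply: fD; exact: (CkX_le (leq0n 2) (Cphi b b0)).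
have nb0 := nbhs_pinfty_gt (num_real (0 : R)).
apply/fine_cvgP; split.
  by apply: filterS nb0 => b b0; rewrite currE.
apply/cvgrPdist_le => e e0.
have N0 : 0 <= N by apply: fine_ge0; apply: form_int_ge0 => i z _; rewrite lee_fin.
have N1 : 0 < N + 1 by rewrite ltr_wpDl.
have e1 : 0 < e / (N + 1) by rewrite divr_gt0.
apply: filterS2 nb0 (envelope_dist e1) => b b0 Hb.
rewrite /= currE//= opprD addrACA subrr add0r.
have Cb := CkX_le (leq0n 2) (Cphi b b0).
have eN : e / (N + 1) * N <= e.
  by rewrite mulrAC ler_pdivrMr// ler_wpM2l ?(ltW e0)// lerDl.
have h1 := half _ _ _ Cb Cp Hb.
have h2 : fine (D (fun x => fine (P x))) <= fine (D (phi b T)) + e / (N + 1) * N.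
  by apply: half => // x; rewrite distrC.
by move: h1 h2 eN; move: (fine (D _)) (fine (D _)) (_ * N) => p q r; rewrite ler_norml; lra.
Qed.

End AtTime.

End Limit.

(** * Hoelder regularity of the metrics *)

Section Regularity.
Context {R : realType}.
Implicit Types (U : set (plane R)) (h k : plane R -> R) (a : R).

Lemma hoelder_onD a U h k : hoelder_on a U h -> hoelder_on a U k -> hoelder_on a U (fun z => h z + k z).
Proof.
move=> hh hk z Uz; have [C [V zV HV]] := hh z Uz; have [D [W zW HW]] := hk z Uz.
exists (C + D), (V `&` W); first exact: filterI.
move=> p q [Vp Wp] [Vq Wq]; rewrite opprD addrACA mulrDl.
by apply: le_trans (ler_normD _ _) _; apply: lerD; [exact: HV|exact: HW].
Qed.

Lemma hoelder_onZ a U (c : R) h : hoelder_on a U h -> hoelder_on a U (fun z => c * h z).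
Proof.
move=> hh z Uz; have [C [V zV HV]] := hh z Uz.
exists (`|c| * C), V => // p q Vp Vq.
by rewrite -mulrBr normrM -mulrA ler_wpM2l//; exact: HV.
Qed.

Lemma Ck1_hoelder_on a U h : 0 < a <= 1 -> open U -> Ck 1 U h -> hoelder_on a U h.
Proof.
move=> /andP[a0 a1] oU Ch z Uz; have [M [d d0 [M0 HM]]] := Ck1_lipschitz oU Uz Ch.
have n1 : \forall p \near z, ball z d p by exact: nbhsx_ballx.
(* Points within 1 / 2 of z are at distance at most 1 from each other, where distance is at most its
   power a <= 1. *)
have h0 : 0 < 1 / 2 :> R by rewrite divr_gt0.
have n2 : \forall p \near z, `|z - p| < 1 / 2.
  by have /cvgrPdist_lt/(_ _ h0) : (fun p : plane R => p) @ z --> z by exact: cvg_id.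
exists M, [set p | ball z d p /\ `|z - p| < 1 / 2]; first exact: filterS2 n1 n2.
move=> p q [pd p2] [qd q2]; apply: le_trans (HM p q pd qd) _.
rewrite ler_wpM2l//.
have pq : `|p - q| <= 1.
  by apply: le_trans (ler_distD z p q) _; rewrite (distrC p z); lra.
have [->|n0] := eqVneq `|p - q| 0; first exact: powR_ge0.
have n1' : 0 < `|p - q| by rewrite lt_neqAle eq_sym n0 normr_ge0.
have h1 : 0 < `|p - q| <= 1 by rewrite pq andbT.
by have := ger_powR h1 a1; rewrite powRr1.
Qed.

End Regularity.

(** The coefficient is a smooth function plus a multiple of the pure second derivatives of phi,
    which are Hoelder. The exponent comes with the flow and is common to all times. *)
Lemma flow_hoelder_metric {R : realType} {X : compactRiemannSurface R} (f : X -> R) (g w : coefs X)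
    (b : R) (phi : R -> X -> R) : kahler_form g -> kahler_ricci_flow g w f b phi ->
  exists2 a : R, 0 < a <= 1 & forall t, 0 <= t -> hoelder_kahler_metric a (add_ddc g (phi t)).
Proof.
move=> kg flow; have [_ _ pp [a a01 HC] _] := flow; exists a => // t t0.
have [fg _ sg] := kg; have Cphi := flow_CkX flow t0; have [fd _] := Ck_form_ddc Cphi.
split; [|exact: pp|].
  by move=> i j z zi zj; rewrite /add_ddc (fg i j z zi zj) (fd i j z zi zj) mulrDl.
move=> i; have [_ [h1 _ _ h2]] := HC t t0 i.
apply: hoelder_onD; first exact: (Ck1_hoelder_on a01 (@img_open R X i) (sg i 1%N)).
exact: (hoelder_onZ (4 * pi)^-1 (hoelder_onD h1 h2)).
Qed.

Theorem theorem6p3 (R : realType) (X : compactRiemannSurface R)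
    (f : X -> R) (omega0 omega : coefs X) (phi : R -> R -> X -> R)
    (hf : exists2 a : R, 0 < a <= 1 & hoelder_fun a f)
    (homega0 : kahler_form omega0) (homega : kahler_form omega)
    (hphi : forall beta : R, 0 < beta ->
      kahler_ricci_flow omega0 omega f beta (phi beta)) :
  (forall beta : R, 0 < beta -> exists2 a : R, 0 < a <= 1 &
     forall t : R, 0 <= t ->
       hoelder_kahler_metric a (add_ddc omega0 (phi beta t))) /\
  (forall t : R, 0 <= t ->
     let P : X -> \bar R := envelope omega0 (fun x => t * f x) in
     cvg_current (fun beta => form_current (add_ddc omega0 (phi beta t)))
       (add_ddc_current omega0 P) /\
     [/\ forall x, P x \is a fin_num,
         continuous (fun x => fine (P x)) &
         {uniform, (fun beta => phi beta t) @ +oo --> (fun x => fine (P x))}]).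
Proof.
have [a /andP[a0 _] fa] := hf; have cf := hoelder_continuous a0 fa.
have [M M0 fM] := continuous_bounded cf.
split; first by move=> b bp; exact (flow_hoelder_metric homega0 (hphi b bp)).
move=> t t0 P; split; first exact (flow_cvg_current cf M0 fM homega0 homega hphi t0).
split.
- move=> x; exact (envelope_fin_num cf M0 fM homega0 homega hphi t0 x).
- exact (envelope_continuous cf M0 fM homega0 homega hphi t0).
- exact (flow_cvg_uniform cf M0 fM homega0 homega hphi t0).
Qed.
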